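(* For all integers $d>k\ge 1$ there exists a constant $C_{d,k}$ (depending only on $d$ and $k$) such that for all $R>0$ and all Borel probability measures $\mu,\nu$ on $\mathbb{R}^d$ supported on $B_R$, one has $$ W_1(\mu,\nu)\;\le\; C_{d,k}\, R^{\frac{d-k}{d-k+1}}\; SW_1^k(\mu,\nu)^{\frac{1}{d-k+1}}.$$
   Context: $B_R$ denotes the closed Euclidean ball of radius $R$ centered at $0$ in $\mathbb{R}^d$. For probability measures $\mu,\nu$ with finite first moment on a Euclidean space, $W_1(\mu,\nu)=\inf_{\gamma}\int |x-y|\,d\gamma(x,y)$ is the 1-Wasserstein distance, where the infimum runs over all probability measures $\gamma$ on the product space with marginals $\mu$ and $\nu$. $G(d,k)$ is the Grassmannian of $k$-dimensional linear subspaces of $\mathbb{R}^d$, $\sigma$ is the unique rotation-invariant Borel probability measure on $G(d,k)$, and for $\xi\in G(d,k)$, $P_\xi$ is the orthogonal projection of $\mathbb{R}^d$ onto $\xi$, with $P_{\xi\#}\mu$ the pushforward of $\mu$ by $P_\xi$. The $k$-plane sliced 1-Wasserstein distance is $$SW_1^k(\mu,\nu)=\int_{G(d,k)} W_1(P_{\xi\#}\mu,P_{\xi\#}\nu)\,d\sigma(\xi).$$ *)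

(* Defs.v *)
From HB Require Import structures.
From mathcomp Require Import all_boot all_order all_algebra.
From mathcomp Require Import all_classical all_reals all_analysis.

Set Implicit Arguments.
Unset Strict Implicit.
Unset Printing Implicit Defensive.

Import Order.TTheory GRing.Theory Num.Theory.
Import numFieldNormedType.Exports.

Local Open Scope classical_set_scope.
Local Open Scope ring_scope.

Section EuclideanStructure.
Context {R : realType} {d : nat}.
Implicit Types (u v x : 'rV[R]_d) (U : {vspace 'rV[R]_d}).

Definition dotrv u v : R := \sum_(i < d) u 0 i * v 0 i.

Lemma dotrvC u v : dotrv u v = dotrv v u.
Proof. by apply: eq_bigr => i _; rewrite mulrC. Qed.

Lemma dotrv_linearl v : linear_for *%R (dotrv ^~ v).
Proof.
move=> a u u'; rewrite /dotrv mulr_sumr -big_split /=.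
by apply: eq_bigr => i _; rewrite !mxE mulrDl mulrA.
Qed.

Lemma dotrv_bilinear : bilinear_for
  (GRing.Scale.Law.clone _ _ *%R _) (GRing.Scale.Law.clone _ _ (idfun \; *%R) _) dotrv.
Proof.
split=> [v a u u'|u a v v'] /=; first exact: dotrv_linearl.
by rewrite !(dotrvC u) dotrv_linearl.
Qed.

HB.instance Definition _ := bilinear_isBilinear.Build R
  'rV[R]_d 'rV[R]_d R _ _ dotrv dotrv_bilinear.

Lemma dotrv_sym u v : dotrv u v = (-1) ^+ false * idfun (dotrv v u).
Proof. by rewrite mul1r dotrvC. Qed.

HB.instance Definition _ := isHermitianSesquilinear.Build R 'rV[R]_d
  false idfun dotrv dotrv_sym.

Lemma dotrv_gt0 u : u != 0 -> 0 < dotrv u u.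
Proof.
move=> /rV0Pn[i ui]; rewrite /dotrv (bigD1 i)//= ltr_wpDr//.
  by apply: sumr_ge0 => j _; rewrite -expr2 sqr_ge0.
by rewrite -expr2 lt0r sqr_ge0 sqrf_eq0 ui.
Qed.

HB.instance Definition _ := isDotProduct.Build R 'rV[R]_d dotrv dotrv_gt0.


(* The library norm `|u| on 'rV[R]_d is the sup norm. *)
Definition enorm u : R := Num.sqrt (dotrv u u).

Definition eclosed_ball (r : R) : set 'rV[R]_d := [set x | enorm x <= r].

(* Orthogonal projection onto U: the projection along the orthogonal complement. *)
Definition oproj U (x : 'rV[R]_d) : 'rV[R]_d := daddv_pi U (orthov dotrv U) x.

Lemma cap_orthov U : (U :&: orthov dotrv U = 0)%VS.
Proof.
apply/eqP; rewrite -subv0; apply/subvP => x; rewrite memv_cap memv0.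
move=> /andP[xU /mem_orthovP/(_ x xU) /= x0].
by apply: contraT => /dotrv_gt0; rewrite x0 ltxx.
Qed.

Lemma add_orthov U : (U + orthov dotrv U = fullv)%VS.
Proof.
pose f x : 'rV[R]_(\dim U) := \row_i dotrv x (vbasis U)`_i.
have f_lin : linear f.
  by move=> a x y; apply/rowP => i; rewrite !mxE linearPl.
pose F : {linear 'rV[R]_d -> 'rV[R]_(\dim U)} :=
  HB.pack f (GRing.isLinear.Build _ _ _ _ f f_lin).
have kerF : (lker (linfun F) <= orthov dotrv U)%VS.
  apply/subvP => x; rewrite memv_ker lfunE/= => /eqP fx0.
  apply/mem_orthovP => v /coord_vbasis ->; rewrite linear_sumr big1// => i _.
  have /rowP/(_ i) := fx0; rewrite !mxE => xi0.
  by rewrite linearZr/= xi0 mulr0.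
apply/eqP; rewrite eqEdim subvf dimv_disjoint_sum ?cap_orthov//=.
rewrite -(limg_ker_dim (linfun F) fullv) capfv addnC leq_add//; last exact: dimvS.
by rewrite (leq_trans (dimvS (subvf _)))// dimvf /dim/= mul1n.
Qed.

Lemma oproj_mem U x : oproj U x \in U.
Proof. exact: memv_pi. Qed.

Lemma oproj_orthov U x : x - oproj U x \in orthov dotrv U.
Proof.
have x_in : x \in (U + orthov dotrv U)%VS by rewrite add_orthov memvf.
by rewrite -{1}(daddv_pi_add (cap_orthov U) x_in) addrC addKr memv_pi.
Qed.

Lemma oproj_linear U : linear (oproj U).
Proof. by move=> a x y; rewrite /oproj linearP. Qed.

HB.instance Definition _ U := GRing.isLinear.Build R 'rV[R]_d 'rV[R]_d _
  (oproj U) (oproj_linear U).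

End EuclideanStructure.

(* Matrices, hence row vectors, carry the Borel sigma-algebra. *)
HB.instance Definition _ (R : realType) (m n : nat) :=
  Measurable.copy 'M[R]_(m, n) (g_sigma_algebraType (@open 'M[R]_(m, n))).

Section ProjectionMeasurable.
Context {R : realType} {d : nat}.

Lemma oproj_continuous (U : {vspace 'rV[R]_d}) : continuous (oproj U).
Proof.
have -> : oproj U = fun x => \sum_(i < d) x 0 i *: oproj U 'e_i.
  apply/funext => x; rewrite {1}[x]row_sum_delta linear_sum.
  by apply: eq_bigr => i _; rewrite linearZ.
apply: continuous_big => [|i _ x]; first exact: add_continuous.
have cx := @coord_continuous R 1 d 0 i x; exact: cvgZr_tmp cx.
Qed.

Lemma oproj_measurable (U : {vspace 'rV[R]_d}) : measurable_fun setT (oproj U).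
Proof.
apply: (measurability (@open 'rV[R]_d)) => //.
move=> _ [B oB <-]; rewrite setTI; apply: sub_sigma_algebra.
by have /continuousP := @oproj_continuous U; exact.
Qed.

HB.instance Definition _ (U : {vspace 'rV[R]_d}) :=
  isMeasurableFun.Build _ _ 'rV[R]_d 'rV[R]_d (oproj U) (oproj_measurable U).

End ProjectionMeasurable.

Section Wasserstein.
Context {R : realType} {d : nat}.
Local Open Scope ereal_scope.
Implicit Types mu nu : probability 'rV[R]_d R.

(* For closed A this is equivalent to: the topological support of mu is
   contained in A. *)
Definition supported_on mu (A : set 'rV[R]_d) : Prop := mu A = 1.

Definition coupling mu nu (gamma : probability ('rV[R]_d * 'rV[R]_d)%type R) : Prop :=
  forall A : set 'rV[R]_d, measurable A ->
    gamma (fst @^-1` A) = mu A /\ gamma (snd @^-1` A) = nu A.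

(* A projected measure is regarded as a measure on the ambient space; all
   couplings of measures concentrated on a subspace are concentrated on its
   square, so W1 is the same as when computed inside the subspace. *)
Definition W1 mu nu : \bar R := ereal_inf
  [set \int[gamma]_z (enorm (z.1 - z.2))%:E | gamma in coupling mu nu].

End Wasserstein.

(* The proof argument provides a base point, as measurable types are pointed. *)
Definition grassmannian (R : realType) (d k : nat) of (k <= d)%N :=
  {U : {vspace 'rV[R]_d} | \dim U == k}.

Section Grassmannian.
Context {R : realType} {d k : nat} {kd : (k <= d)%N}.
Local Notation G := (grassmannian R kd).

HB.instance Definition _ := SubType.on G.
HB.instance Definition _ := Choice.on G.

Lemma grassmannian_point :
  \dim <<take k (vbasis (@fullv R 'rV[R]_d))>>%VS == k.
Proof.
have Bfree : free (take k (vbasis (@fullv R 'rV[R]_d))).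
  apply: (@catl_free _ _ (drop k (vbasis fullv))).
  by rewrite cat_take_drop (basis_free (vbasisP _)).
rewrite (eqP Bfree) size_takel// size_tuple dimvf /dim/= mul1n.
exact: kd.
Qed.

HB.instance Definition _ := isPointed.Build G
  (exist (fun U : {vspace 'rV[R]_d} => \dim U == k) _ grassmannian_point).

Definition proj_matrix (xi : G) : 'M[R]_d := lin1_mx (oproj (val xi)).

(* The usual topology of the Grassmannian: that of the metric
   |P_xi - P_eta|; its Borel sets are the measurable sets. *)
HB.instance Definition _ := Topological.copy G (initial_topology proj_matrix).

HB.instance Definition _ := Measurable.copy G (g_sigma_algebraType (@open G)).

(* g acts on row vectors by x |-> x *m g. *)
Definition grassmannian_image (g : 'M[R]_d) (A : set G) : set G :=
  [set eta | exists2 xi, A xi & val eta = (linfun (mulmxr g) @: val xi)%VS].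

(* Invariance under SO(d) only; for 1 <= k < d this action is transitive, and
   it determines the probability sigma uniquely. *)
Definition rotation_invariant (sigma : probability G R) : Prop :=
  forall g : 'M[R]_d, g *m g^T = 1%:M -> \det g = 1 ->
  forall A : set G, measurable A -> sigma (grassmannian_image g A) = sigma A.

Definition SW1 (sigma : probability G R) (mu nu : probability 'rV[R]_d R) : \bar R :=
  (\int[sigma]_xi W1 (distribution mu (oproj (val xi)))
                     (distribution nu (oproj (val xi))))%E.

End Grassmannian.

(* Main.v *)
From HB Require Import structures.
Require Import Defs.
From mathcomp Require Import all_boot all_order all_algebra.
From mathcomp Require Import all_classical all_reals all_analysis.
From mathcomp Require Import measurable_realfun.
From mathcomp Require Import zify ring lra.

Set Implicit Arguments.
Unset Strict Implicit.
Unset Printing Implicit Defensive.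

Import Order.TTheory GRing.Theory Num.Theory.
Import numFieldNormedType.Exports.

Local Open Scope ring_scope.

(** The heart of the matter is the estimate [W1_le_scale]: for every scale
    [0 < eps <= r],

      [W1 mu nu <= C * eps + C' * (r / eps) ^+ (d - k) * SW1 sigma mu nu].

    Taking [eps = r ^ ((d-k)/(d-k+1)) * SW1 ^ (1/(d-k+1))] makes both terms equal
    to [eps] up to constants, which is the theorem.

    By duality, [W1 mu nu] is tested against 1-Lipschitz functions [F] of bounded
    support. Replacing [F] by its convolution with the kernel [K (x / eps)], where
    [K x = (1 + |x|^2)^(-(k + 2 d)/2)], changes it by [O(eps)]. The kernel is an
    average over the planes [xi] of ridge functions:
    [K x = E_xi (psi (|P_xi x|^2))] with [psi] a combination of the functions
    [(1 + v)^(-(d + 2 j)/2)] ([ridge_identity]). Hence the convolution is an average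
    of functions [g_xi] that depend on [P_xi x] only, and
    [\int g_xi d(mu - nu) <= Lip (g_xi) * W1 (P_xi mu) (P_xi nu)].
    Now a translation of [x] inside [xi] can be moved to [F], so that [Lip (g_xi)]
    is at most the integral of [|psi|] over the translates that meet the support of
    [F], relative to the mass [eps ^ d] of the kernel. The profile decays away from
    a tube of width [eps] around a plane of dimension [d - k], which meets a ball of
    radius [O(r)] in a volume of order [r ^ (d - k) * eps ^ k]. This gives
    [Lip (g_xi) = O((r / eps) ^ (d - k))], uniformly in [xi] ([tube_estimate],
    [ridge_sum_lip]), and integration over [xi] yields the estimate.

    The ridge identity is proved from invariance alone. Let [X = |x|^2] and
    [Y = |P_xi x|^2]. Differentiating expectations along one-parameter families of
    rotations in the planes spanned by [x] and a basis vector gives a Stein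
    identity for [Y] ([stein]). For the exponent [d] it is a linear differential
    equation in [S] for the mean of [(1 + S * Y)^(-d/2)], solved by
    [(1 + S * X)^(-k/2)] ([expect_isq_d]). Differentiating in [S] raises the
    exponents by steps of 2 and provides kernels with the decay that the first
    moment in the convolution estimate demands.

    Convolutions are taken over a lattice of mesh [eps / n0], with [n0] tending to
    infinity, and the measures are discretised on its cells. Duality then is a
    statement about finite transport problems ([kantorovich_finite], from Farkas'
    lemma), finite plans are glued into couplings of [mu] and [nu] ([W1_le_plan]),
    and the integrals above become sums over boxes that split into one-dimensional
    telescoping sums ([sum_rootdec]). *)

(** * Finite Kantorovich duality *)

(** Induction on the number of constraints. If the last one cannot be dropped,
    some [x1] satisfies the others and violates the conclusion, so that
    [alpha m x1 > 0]; composing all forms with the projection along [x1] onto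
    the kernel of [alpha m] removes that constraint. *)
Lemma farkas (R : realFieldType) (W : lmodType R) (m : nat)
    (alpha : nat -> W -> R) (gamma : W -> R) :
  (forall i, scalar (alpha i)) -> scalar gamma ->
  (forall x, (forall i, (i < m)%N -> alpha i x <= 0) -> gamma x <= 0) ->
  exists2 u : nat -> R, (forall i, 0 <= u i) &
    forall x, gamma x = \sum_(i < m) u i * alpha i x.
Proof.
elim: m alpha gamma => [|m IH] alpha gamma lin_a lin_g imp.
  exists (fun=> 0) => // x; rewrite big_ord0; apply/le_anti.
  rewrite imp//= -oppr_le0 -mulN1r.
  have g0 : gamma 0 = 0.
    by have := lin_g (-1) 0 0; rewrite scaler0 addr0 mulN1r addNr.
  have <- : gamma (-1 *: x + 0) = -1 * gamma x by rewrite lin_g g0 addr0.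
  exact: imp.
have [imp'|/existsNP[x1 /not_implyP[ax1 /negP]]] :=
  pselect (forall x, (forall i, (i < m)%N -> alpha i x <= 0) -> gamma x <= 0).
  have [u u0 gE] := IH _ _ lin_a lin_g imp'.
  exists (fun i => if i == m then 0 else u i).
    by move=> i; case: ifP.
  move=> x; rewrite big_ord_recr /= eqxx mul0r addr0 gE.
  by apply: eq_bigr => i _; rewrite ltn_eqF.
rewrite -ltNge => gx1.
have am1 : 0 < alpha m x1.
  rewrite ltNge; apply/negP => am; move: gx1; rewrite ltNge imp// => i.
  by rewrite ltnS leq_eqVlt => /orP[/eqP ->//|]; exact: ax1.
pose c x := alpha m x / alpha m x1.
have lin_c : scalar c by move=> a x y; rewrite /c lin_a mulrDl mulrA.
pose alpha' i x := alpha i x - c x * alpha i x1.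
pose gamma' x := gamma x - c x * gamma x1.
have proj f : scalar f -> forall x, f (- c x *: x1 + x) = f x - c x * f x1.
  by move=> lf x; rewrite lf mulNr addrC.
have linp f y : scalar f -> scalar (fun x => f x - c x * y).
  by move=> lf a x z; rewrite lf lin_c; ring.
have [||x apx|u u0 gE] := IH alpha' gamma'.
- by move=> i; exact: linp.
- exact: linp.
- rewrite /gamma' -proj//; apply: imp => i.
  rewrite ltnS leq_eqVlt => /orP[/eqP ->|im].
    by rewrite proj// /c divfK ?gt_eqF// subrr.
  by rewrite proj//; exact: apx.
exists (fun i => if i == m
  then (gamma x1 - \sum_(i < m) u i * alpha i x1) / alpha m x1 else u i).
  move=> i; case: ifP => // _; rewrite divr_ge0 ?(ltW am1)// subr_ge0.
  apply: le_trans (ltW gx1); rewrite -oppr_ge0 -sumrN sumr_ge0// => j _.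
  by rewrite oppr_ge0 mulr_ge0_le0// ax1.
move=> x; rewrite big_ord_recr /= eqxx.
rewrite (eq_bigr (fun i : 'I_m => u i * alpha i x)); last first.
  by move=> i _; rewrite ltn_eqF.
have := gE x; rewrite /gamma' /alpha'.
rewrite (eq_bigr (fun i : 'I_m => u i * alpha i x - c x * (u i * alpha i x1))).
  rewrite big_split/= sumrN -mulr_sumr => /eqP; rewrite subr_eq => /eqP ->.
  by rewrite /c; field; rewrite gt_eqF.
by move=> i _; ring.
Qed.

(** The plan is read off Farkas' lemma for the system [u s + v t <= c s t * w],
    [0 <= w], which homogenises the constraints on the potentials: comparing
    the coefficients of [u], [v] and [w] gives the marginals and the cost. *)
Lemma finite_transport (R : realFieldType) (T : finType) (c : T -> T -> R)
    (a b : T -> R) (B : R) :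
  (forall t, 0 <= a t) -> (forall t, 0 <= b t) ->
  \sum_t a t = 1 -> \sum_t b t = 1 ->
  (forall u v : T -> R, (forall s t, u s + v t <= c s t) ->
     \sum_t a t * u t + \sum_t b t * v t <= B) ->
  exists pi : T -> T -> R,
  [/\ forall s t, 0 <= pi s t, forall s, \sum_t pi s t = a s,
      forall t, \sum_s pi s t = b t & \sum_s \sum_t pi s t * c s t <= B].
Proof.
move=> a0 b0 a1 b1 dual.
pose W : lmodType R := ({ffun T -> R^o} * {ffun T -> R^o} * R^o)%type.
pose e := enum {: T * T}.
have [s0 _|T0] := pickP (@predT T); last first.
  by move: a1; rewrite big_pred0// => /eqP; rewrite eq_sym oner_eq0.
pose nt i := nth (s0, s0) e i.
pose m := size e.
(* The constraint of index [m] is [0 <= w.2]; the others are indexed by pairs. *)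
pose alpha i (w : W) : R := if (i < m)%N then
   w.1.1 (nt i).1 + w.1.2 (nt i).2 - c (nt i).1 (nt i).2 * w.2 else - w.2.
pose gamma (w : W) : R := \sum_t a t * w.1.1 t + \sum_t b t * w.1.2 t - B * w.2.
have [||w hw|u u0 gE] := @farkas R W m.+1 alpha gamma.
- move=> i k x y; rewrite /alpha /=; case: ifP => _; last by rewrite /GRing.scale /=; ring.
  by rewrite !ffunE /GRing.scale /=; ring.
- move=> k x y; rewrite /gamma /=.
  under eq_bigr do rewrite !ffunE /GRing.scale /= mulrDr mulrCA.
  under [X in _ + X - _]eq_bigr do rewrite !ffunE /GRing.scale /= mulrDr mulrCA.
  by rewrite !big_split/= -!mulr_sumr /GRing.scale/=; ring.
- have w2 : 0 <= w.2.
    by have := hw m (ltnSn _); rewrite /alpha ltnn oppr_le0.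
  have le_c s t : w.1.1 s + w.1.2 t <= c s t * w.2.
    have si : (index (s, t) e < m)%N by rewrite index_mem mem_enum.
    have := hw _ (leqW si); rewrite /alpha si /nt nth_index ?mem_enum//=.
    by rewrite subr_le0.
  (* If [w.2 = 0], integrate the constraints against the product plan [a * b]. *)
  rewrite /gamma subr_le0; move: w2; rewrite le_eqVlt => /orP[/eqP w2|w2].
    rewrite -w2 mulr0.
    have -> : \sum_t a t * w.1.1 t + \sum_t b t * w.1.2 t =
        \sum_s \sum_t a s * b t * (w.1.1 s + w.1.2 t).
      have -> : \sum_t a t * w.1.1 t = \sum_s \sum_t a s * b t * w.1.1 s.
        apply: eq_bigr => s _; rewrite -mulr_suml; congr (_ * _).
        by rewrite -mulr_sumr b1 mulr1.
      have -> : \sum_t b t * w.1.2 t = \sum_s \sum_t a s * b t * w.1.2 t.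
        rewrite exchange_big/=; apply: eq_bigr => t _; rewrite -mulr_suml.
        by rewrite -mulr_suml a1 mul1r.
      rewrite -big_split/=; apply: eq_bigr => s _.
      by rewrite -big_split/=; apply: eq_bigr => t _; rewrite mulrDr.
    rewrite -oppr_ge0 -sumrN sumr_ge0// => s _; rewrite -sumrN sumr_ge0// => t _.
    rewrite oppr_ge0 mulr_ge0_le0//; first exact: mulr_ge0.
    by rewrite (le_trans (le_c s t))// -w2 mulr0.
  rewrite -ler_pdivrMr// mulrDl !mulr_suml.
  under eq_bigr do rewrite -mulrA.
  under [X in _ + X <= _]eq_bigr do rewrite -mulrA.
  apply: (dual (fun t => w.1.1 t / w.2) (fun t => w.1.2 t / w.2)) => s t.
  by rewrite -mulrDl ler_pdivrMr.
pose pi s t := u (index (s, t) e).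
have gE' w : gamma w = \sum_s \sum_t
    pi s t * (w.1.1 s + w.1.2 t - c s t * w.2) - u m * w.2.
  rewrite gE big_ord_recr/=; congr (_ + _); last by rewrite /alpha ltnn mulrN.
  rewrite pair_bigA/= (eq_bigr (fun p : T * T =>
    u (index p e) * (w.1.1 p.1 + w.1.2 p.2 - c p.1 p.2 * w.2))); last by case.
  rewrite -[RHS]big_enum/= -/e (big_nth (s0, s0)) big_mkord.
  apply: eq_bigr => i _; rewrite /alpha ltn_ord /nt index_uniq ?enum_uniq//.
exists pi; split.
- by move=> s t; exact: u0.
- move=> s; have := gE' ([ffun t => (t == s)%:R], 0, 0).
  rewrite /gamma/= !mulr0 !subr0.
  rewrite [X in X + _](bigD1 s)//= ffunE eqxx mulr1.
  rewrite [X in _ + X + _]big1; last first.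
    by move=> t /negPf ts; rewrite ffunE ts mulr0.
  rewrite [X in _ + _ + X]big1; last by move=> t _; rewrite ffunE mulr0.
  rewrite !addr0 => ->; rewrite [RHS](bigD1 s)//= [X in _ = _ + X]big1 ?addr0.
    by apply: eq_bigr => t _; rewrite !ffunE eqxx mulr0 subr0 addr0 mulr1.
  move=> s' /negPf ss; rewrite big1// => t _.
  by rewrite !ffunE ss mulr0 subr0 addr0 mulr0.
- move=> t; have := gE' (0, [ffun s => (s == t)%:R], 0).
  rewrite /gamma/= !mulr0 !subr0.
  rewrite [X in _ + X](bigD1 t)//= ffunE eqxx mulr1.
  rewrite [X in _ + (_ + X)]big1; last first.
    by move=> s /negPf ts; rewrite ffunE ts mulr0.
  rewrite [X in X + _]big1; last by move=> s _; rewrite ffunE mulr0.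
  rewrite addr0 add0r => ->; apply: eq_bigr => s _.
  rewrite (bigD1 t)//= big1 ?addr0.
    by rewrite !ffunE eqxx mulr0 subr0 add0r mulr1.
  by move=> s' /negPf ss; rewrite !ffunE ss mulr0 subr0 addr0 mulr0.
- have := gE' (0, 0, 1); rewrite /gamma/=.
  rewrite [X in X + _ - _]big1; last by move=> t _; rewrite ffunE mulr0.
  rewrite [X in _ + X - _]big1; last by move=> t _; rewrite ffunE mulr0.
  rewrite (eq_bigr (fun s => - \sum_t pi s t * c s t)); last first.
    move=> s _; rewrite -sumrN; apply: eq_bigr => t _.
    by rewrite !ffunE addr0 mulr1 add0r mulrN.
  by rewrite sumrN; have := u0 m; lra.
Qed.

(** * The Euclidean norm and 1-Lipschitz potentials *)

Section EuclideanNorm.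
Context {R : realType} {d : nat}.
Implicit Types (u v x y : 'rV[R]_d) (F : 'rV[R]_d -> R).

Lemma dotrvDl u v x : dotrv (u + v) x = dotrv u x + dotrv v x.
Proof. by have := dotrv_linearl x 1 u v; rewrite scale1r mul1r. Qed.
Lemma dotrvZl a u x : dotrv (a *: u) x = a * dotrv u x.
Proof.
by rewrite /dotrv mulr_sumr; apply: eq_bigr => i _; rewrite mxE mulrA.
Qed.
Lemma dotrvDr u v x : dotrv x (u + v) = dotrv x u + dotrv x v.
Proof. by rewrite dotrvC dotrvDl !(dotrvC x). Qed.
Lemma dotrvZr a u x : dotrv x (a *: u) = a * dotrv x u.
Proof. by rewrite dotrvC dotrvZl !(dotrvC x). Qed.
Lemma dotrvNl u x : dotrv (- u) x = - dotrv u x.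
Proof. by rewrite -scaleN1r dotrvZl mulN1r. Qed.
Lemma dotrvNr u x : dotrv x (- u) = - dotrv x u.
Proof. by rewrite -scaleN1r dotrvZr mulN1r. Qed.

Lemma dotrv_delta u i : dotrv u 'e_i = u 0 i.
Proof.
rewrite /dotrv (bigD1 i)//= mxE !eqxx mulr1 big1 ?addr0// => j /negPf ji.
by rewrite mxE ji mulr0.
Qed.

Lemma dotrv_ge0 u : 0 <= dotrv u u.
Proof. by apply: sumr_ge0 => i _; rewrite -expr2 sqr_ge0. Qed.

Lemma enorm_ge0 u : 0 <= enorm u.
Proof. exact: sqrtr_ge0. Qed.

Lemma enorm_sqr u : enorm u ^+ 2 = dotrv u u.
Proof. by rewrite sqr_sqrtr// dotrv_ge0. Qed.

Lemma dotrv_le u v : dotrv u v <= enorm u * enorm v.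
Proof.
have [->|v0] := eqVneq v 0.
  rewrite /dotrv big1 ?mulr_ge0 ?enorm_ge0// => i _.
  by rewrite mxE mulr0.
have v_gt0 := dotrv_gt0 v0.
rewrite /enorm -sqrtrM ?dotrv_ge0//; apply: le_trans (ler_norm _) _.
rewrite -sqrtr_sqr ler_wsqrtr//.
have := dotrv_ge0 (dotrv v v *: u - dotrv u v *: v).
rewrite dotrvDl !dotrvDr !dotrvNl !dotrvNr !dotrvZl !dotrvZr (dotrvC v u).
rewrite (_ : _ + _ = dotrv v v * (dotrv u u * dotrv v v - dotrv u v ^+ 2)).
  by rewrite pmulr_rge0// subr_ge0.
by ring.
Qed.

Lemma enormN u : enorm (- u) = enorm u.
Proof. by rewrite /enorm dotrvNl dotrvNr opprK. Qed.

Lemma enormZ a u : enorm (a *: u) = `|a| * enorm u.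
Proof.
by rewrite /enorm dotrvZl dotrvZr mulrA -expr2 sqrtrM ?sqr_ge0// sqrtr_sqr.
Qed.

Lemma enormD u v : enorm (u + v) <= enorm u + enorm v.
Proof.
rewrite -(@ler_pXn2r _ 2)// ?nnegrE ?addr_ge0 ?enorm_ge0//.
rewrite enorm_sqr dotrvDl !dotrvDr -!enorm_sqr (dotrvC v u).
by have := dotrv_le u v; lra.
Qed.

Lemma enorm0 : enorm (0 : 'rV[R]_d) = 0.
Proof. by rewrite -(scale0r 0) enormZ normr0 mul0r. Qed.

Lemma enorm_distC u v : enorm (u - v) = enorm (v - u).
Proof. by rewrite -opprB enormN. Qed.

Lemma norm_dotrv_le u v : `|dotrv u v| <= enorm u * enorm v.
Proof. by rewrite ler_norml dotrv_le andbT lerNl -dotrvNl -(enormN u) dotrv_le. Qed.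

Lemma enorm_triangle x u v : enorm (u - v) <= enorm (u - x) + enorm (x - v).
Proof. by rewrite (_ : u - v = (u - x) + (x - v)) ?enormD// addrA subrK. Qed.

Lemma enorm_dist u v : `|enorm u - enorm v| <= enorm (u - v).
Proof.
have := enorm_triangle v u 0; have := enorm_triangle u v 0.
by rewrite !subr0 (enorm_distC v u) ler_norml; lra.
Qed.

Lemma coord_le_enorm u i : `|u 0 i| <= enorm u.
Proof.
rewrite -sqrtr_sqr ler_wsqrtr// /dotrv (bigD1 i)//= -expr2 lerDl.
by apply: sumr_ge0 => j _; rewrite -expr2 sqr_ge0.
Qed.

Lemma enorm_delta i : enorm ('e_i : 'rV[R]_d) = 1.
Proof. by rewrite /enorm dotrv_delta mxE !eqxx sqrtr1. Qed.

Lemma enorm_le_sum u : enorm u <= \sum_i `|u 0 i|.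
Proof.
rewrite {1}[u]row_sum_delta; elim/big_ind2 : _ => [|x a y b xa yb|i _].
- by rewrite enorm0.
- by rewrite (le_trans (enormD _ _)) ?lerD.
- by rewrite enormZ enorm_delta mulr1.
Qed.

Lemma enorm_le_const u (c : R) : (forall i, `|u 0 i| <= c) -> enorm u <= d%:R * c.
Proof.
move=> uc; apply: (le_trans (enorm_le_sum u)).
by rewrite -[d in leRHS]card_ord mulr_natl -sumr_const; apply: ler_sum.
Qed.

Definition lipschitz1 F := forall x y, F x <= F y + enorm (x - y).

Lemma lipschitz1_norm F x y : lipschitz1 F -> `|F x - F y| <= enorm (x - y).
Proof.
move=> Fl; rewrite ler_norml.
by have := Fl x y; have := Fl y x; rewrite (enorm_distC y x); lra.
Qed.

(** Potentials [u], [v] are replaced by the single 1-Lipschitz function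
    [F0 x = min_t (|x - p t| - v t)], for which [u <= F0 <= - v] at the points
    [p t]. Clipping [F0 - F0 0] by the cone [phi] makes its support bounded
    without changing it at these points: where [|x| <= rho], the cone is at
    least [rho] and [|F0 x - F0 0| <= |x| <= rho]. *)
Lemma kantorovich_finite (T : finType) (p : T -> 'rV[R]_d) (rho : R)
    (a b : T -> R) (B : R) :
  (forall t, 0 <= a t) -> (forall t, 0 <= b t) ->
  \sum_t a t = 1 -> \sum_t b t = 1 ->
  (forall t, enorm (p t) <= rho) ->
  (forall F, lipschitz1 F -> (forall x, 2 * rho <= enorm x -> F x = 0) ->
     \sum_t (a t - b t) * F (p t) <= B) ->
  exists pi : T -> T -> R,
  [/\ forall s t, 0 <= pi s t, forall s, \sum_t pi s t = a s,
      forall t, \sum_s pi s t = b t &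
      \sum_s \sum_t pi s t * enorm (p s - p t) <= B].
Proof.
move=> a0 b0 a1 b1 p_rho dual; apply: finite_transport => // u v uv.
have [t0 _|T0] := pickP (@predT T); last first.
  by move: a1; rewrite big_pred0// => /eqP; rewrite eq_sym oner_eq0.
pose F0 x := let t := [arg min_(t < t0) (enorm (x - p t) - v t)]%O in
  enorm (x - p t) - v t.
have F0_le x t : F0 x <= enorm (x - p t) - v t.
  by rewrite /F0; case: arg_minP => //= t1 _; apply.
have F0_lip : lipschitz1 F0.
  move=> x y; rewrite [in leRHS]/F0; case: arg_minP => //= t1 _ _.
  have := F0_le x t1; have := enorm_triangle y x (p t1); lra.
have F0_v t : F0 (p t) <= - v t.
  by have := F0_le (p t) t; rewrite subrr enorm0 add0r.
have u_F0 t : u t <= F0 (p t).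
  by rewrite /F0; case: arg_minP => //= t1 _ _; have := uv t t1; lra.
pose phi x : R := Num.max 0 (2 * rho - enorm x).
have phi_lip : lipschitz1 phi.
  move=> x y; rewrite /phi; have := enorm_triangle x y 0.
  rewrite !subr0 (enorm_distC y) => ?; have := enorm_ge0 (x - y).
  by rewrite /Num.max; do !case: ifPn; rewrite -?leNgt; lra.
pose F x := Num.max (Num.min (F0 x - F0 0) (phi x)) (- phi x).
have F_lip : lipschitz1 F.
  move=> x y; have := F0_lip x y; have := phi_lip x y; have := phi_lip y x.
  rewrite (enorm_distC y x) /F /Num.max /Num.min.
  by do !case: ifPn; rewrite -?leNgt; lra.
have F_supp x : 2 * rho <= enorm x -> F x = 0.
  move=> h; have phi0 : phi x = 0 by rewrite /phi max_l// subr_le0.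
  rewrite /F phi0 oppr0.
  by rewrite /Num.max /Num.min; do !case: ifPn; rewrite -?leNgt; lra.
have F_p t : F (p t) = F0 (p t) - F0 0.
  have := lipschitz1_norm (p t) 0 F0_lip; rewrite subr0 ler_norml => /andP[h1 h2].
  have := p_rho t => h3.
  rewrite /F /phi /Num.max /Num.min.
  by do !case: ifPn; rewrite -?leNgt; lra.
apply: le_trans (dual F F_lip F_supp).
have -> : \sum_t (a t - b t) * F (p t) =
    \sum_t a t * F0 (p t) - \sum_t b t * F0 (p t).
  rewrite (eq_bigr (fun t => a t * F0 (p t) - b t * F0 (p t)
      - F0 0 * a t + F0 0 * b t)); last by move=> t _; rewrite F_p; ring.
  by rewrite !big_split/= !sumrN -!mulr_sumr a1 b1; ring.
rewrite -sumrN; apply: lerD; apply: ler_sum => t _.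
  by rewrite ler_wpM2l.
by rewrite -mulrN ler_wpM2l// lerNr.
Qed.

End EuclideanNorm.

(** * Couplings glued from finite transport plans *)

Section Measurability.
Local Open Scope classical_set_scope.
Context {R : realType} {d : nat}.

Lemma measurable_coord (i : 'I_d) :
  measurable_fun setT (fun x : 'rV[R]_d => x 0 i).
Proof.
apply: (measurability _ (RGenOInfty.measurableE R)).
move=> _ [_ [a ->] <-]; rewrite setTI; apply: sub_sigma_algebra.
have /continuousP := @coord_continuous R 1 d 0 i.
by apply; exact: interval_open.
Qed.

Lemma measurable_enorm_comp disp (U : measurableType disp) (f : U -> 'rV[R]_d) :
  (forall i, measurable_fun setT (fun x => f x 0 i)) ->
  measurable_fun setT (fun x => enorm (f x)).
Proof.
move=> mf; apply: (@measurableT_comp _ _ _ _ _ _ (@Num.sqrt R)).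
  by apply: continuous_measurable_fun; exact: sqrt_continuous.
by apply: measurable_sum => i; apply: measurable_funM; exact: mf.
Qed.

Lemma measurable_enorm_diff :
  measurable_fun setT
    (fun z : 'rV[R]_d * 'rV[R]_d => enorm (z.1 - z.2)).
Proof.
apply: measurable_enorm_comp => i; under eq_fun do rewrite !mxE.
by apply: measurable_funB; apply: (measurableT_comp (measurable_coord i)).
Qed.

Lemma measurable_eclosed_ball (r : R) : measurable (@eclosed_ball R d r).
Proof.
rewrite (_ : eclosed_ball r = (@enorm R d) @^-1` `]-oo, r]); last first.
  by apply/seteqP; split=> x; rewrite /eclosed_ball/= in_itv.
rewrite -[X in measurable X]setTI.
by apply: (measurable_enorm_comp (f := id)) => //; exact: measurable_coord.
Qed.

End Measurability.

Section Cells.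
Local Open Scope classical_set_scope.
Context {R : realType} {disp : measure_display} {U : measurableType disp}.
Variables (mu : probability U R) (T : finType) (E : T -> set U).
Hypothesis mE : forall t, measurable (E t).

Lemma measure_bigcup_fin : trivIset setT E ->
  mu (\bigcup_(t in [set: T]) E t) = (\sum_t mu (E t))%E.
Proof.
move=> tE; rewrite measure_fin_bigcup; last 3 first.
- exact: finite_finset.
- by [].
- by move=> t _; exact: mE.
rewrite (_ : [set: T] = [set` index_enum T]); last first.
  by apply/seteqP; split=> t //= _; rewrite mem_index_enum.
by rewrite -fsbig_seq// index_enum_uniq.
Qed.

Lemma sum_fine_cells : (\sum_t mu (E t) = 1)%E -> \sum_t fine (mu (E t)) = 1.
Proof.
move=> muE; apply: EFin_inj; rewrite -sumEFin -muE; apply: eq_bigr => t _.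
by rewrite fineK// fin_num_measure.
Qed.

End Cells.

Section CellRestriction.
Local Open Scope classical_set_scope.

(** Cells of total mass 1 leave out only a null set. *)
Lemma measure_cells {R : realType} disp (U : measurableType disp)
    (mu : probability U R) (T : finType) (E : T -> set U) :
  (forall t, measurable (E t)) -> trivIset setT E ->
  (\sum_t mu (E t) = 1)%E ->
  forall B, measurable B -> (\sum_t mu (B `&` E t) = mu B)%E.
Proof.
move=> mE tE sumE B mB.
pose V := \bigcup_(t in [set: T]) E t.
have mV : measurable V by apply: fin_bigcup_measurable.
have V1 : mu V = 1%E by exact: (etrans (measure_bigcup_fin mu mE tE) sumE).
have V0 : mu (~` V) = 0%E by rewrite probability_setC// V1 subee.
rewrite -measure_bigcup_fin; last 2 first.
- by move=> t; exact: measurableI.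
- apply/trivIsetP => s t _ _ st; move/trivIsetP : tE => /(_ s t I I st) Est.
  by rewrite setIACA Est setI0.
rewrite -setI_bigcupr -/V.
have BV0 : mu (B `\` V) = 0%E.
  apply/eqP; rewrite eq_le measure_ge0 andbT -V0 le_measure ?inE//.
  - exact: measurableD.
  - exact: measurableC.
rewrite -[LHS]add0e -BV0; exact/esym/measureDI.
Qed.

End CellRestriction.

Section Gluing.
Local Open Scope classical_set_scope.
Context {R : realType} {d : nat}.
Variables (mu nu : probability 'rV[R]_d R) (T : finType).
Variables (E : T -> set 'rV[R]_d) (pi : T -> T -> R) (c : T -> T -> R).
Hypothesis mE : forall t, measurable (E t).
Hypothesis tE : trivIset setT E.
Hypothesis muE : (\sum_t mu (E t) = 1)%E.
Hypothesis nuE : (\sum_t nu (E t) = 1)%E.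
Hypothesis pi0 : forall s t, 0 <= pi s t.
Hypothesis pi_mu : forall s, \sum_t pi s t = fine (mu (E s)).
Hypothesis pi_nu : forall t, \sum_s pi s t = fine (nu (E t)).
Hypothesis c_ge : forall s t x y, E s x -> E t y -> enorm (x - y) <= c s t.

Let e := enum {: T * T}.
Let coef (p : T * T) : R := pi p.1 p.2 / (fine (mu (E p.1)) * fine (nu (E p.2))).

Let coef_ge0 p : 0 <= coef p.
Proof. by rewrite divr_ge0// mulr_ge0// fine_ge0. Qed.

Let D (p : T * T) := E p.1 `*` E p.2.
Let mD p : measurable (D p).
Proof. exact: measurableX. Qed.

(** The mass [pi s t] is spread over [E s] x [E t] as the product of the
    conditional laws of [mu] on [E s] and of [nu] on [E t]. *)
Definition glued_piece (p : T * T) :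
    {measure set ('rV[R]_d * 'rV[R]_d) -> \bar R} :=
  mscale (NngNum (coef_ge0 p)) (mrestr (mu \x nu)%E (mD p)).

(** Finite sums of measures are indexed by natural numbers; the zero measure
    is a default value beyond the enumeration of the pairs. *)
Definition glued_seq (n : nat) : {measure set ('rV[R]_d * 'rV[R]_d) -> \bar R} :=
  if onth e n is Some p then glued_piece p else mzero.

Definition glued := msum glued_seq (size e).

HB.instance Definition _ := Measure.on glued.

Lemma glued_sum (f : {measure set ('rV[R]_d * 'rV[R]_d) -> \bar R} -> \bar R) :
  (\sum_(n < size e) f (glued_seq n) = \sum_p f (glued_piece p))%E.
Proof.
rewrite -[RHS]big_enum/= -/e.
have [e0|[p0 p0e]] : e = [::] \/ exists p0, p0 \in e.
- by case: (e) => [|p0 e']; [left|right; exists p0; rewrite mem_head].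
- by rewrite e0 big_ord0 big_nil.
rewrite (big_nth p0) big_mkord; apply: eq_bigr => i _.
by rewrite /glued_seq onthE (nth_map p0).
Qed.

Lemma glued_pieceX A B : measurable A -> measurable B ->
  forall s t, glued_piece (s, t) (A `*` B) =
    ((pi s t)%:E * (fine (mu (A `&` E s)) / fine (mu (E s)) *
                    (fine (nu (B `&` E t)) / fine (nu (E t))))%:E)%E.
Proof.
move=> mA mB s t; rewrite /glued_piece /= /mscale /= /mrestr /D /= -setXI.
rewrite product_measure1E; [|exact: measurableI..].
transitivity ((coef (s, t))%:E *
    ((fine (mu (A `&` E s)))%:E * (fine (nu (B `&` E t)))%:E))%E.
  by rewrite !fineK//; exact/fin_num_measure/measurableI.
rewrite -!EFinM /coef /=; congr EFin.
by rewrite invfM; ring.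
Qed.

Lemma gluedX A B : measurable A -> measurable B ->
  glued (A `*` B) = (\sum_s \sum_t
    (pi s t)%:E * (fine (mu (A `&` E s)) / fine (mu (E s)) *
                    (fine (nu (B `&` E t)) / fine (nu (E t))))%:E)%E.
Proof.
move=> mA mB; rewrite /glued /msum (glued_sum (fun m => m (A `*` B))).
by rewrite pair_bigA/=; apply: eq_bigr => -[s t] _; exact: glued_pieceX.
Qed.

(** The division by the masses of the cells in [glued_piece] is harmless: the
    plan carries nothing from or to a null cell. *)
Lemma pi_mu0 s : fine (mu (E s)) = 0 -> forall t, pi s t = 0.
Proof.
move=> mu0 t; have /eqP := pi_mu s; rewrite mu0 psumr_eq0//.
by move=> /allP/(_ t (mem_index_enum _))/eqP.
Qed.

Lemma pi_nu0 t : fine (nu (E t)) = 0 -> forall s, pi s t = 0.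
Proof.
move=> nu0 s; have /eqP := pi_nu t; rewrite nu0 psumr_eq0//.
by move=> /allP/(_ s (mem_index_enum _))/eqP.
Qed.

Lemma glued_fst A : measurable A -> glued (fst @^-1` A) = mu A.
Proof.
move=> mA; rewrite -setXT gluedX//.
rewrite -(measure_cells mE tE muE mA); apply: eq_bigr => s _.
have mAs : mu (A `&` E s) \is a fin_num by exact/fin_num_measure/measurableI.
have [mu0|mu0] := eqVneq (fine (mu (E s))) 0.
  rewrite big1; last by move=> t _; rewrite (pi_mu0 mu0) mul0e.
  apply/esym/eqP; rewrite eq_le measure_ge0 andbT.
  have <- : mu (E s) = 0%E by rewrite -[LHS]fineK ?mu0// fin_num_measure.
  by rewrite le_measure ?inE//; exact: measurableI.
rewrite (eq_bigr (fun t => (pi s t * (fine (mu (A `&` E s)) / fine (mu (E s))))%:E)).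
  by rewrite sumEFin -mulr_suml pi_mu mulrC divfK// fineK.
move=> t _; rewrite setTI -EFinM; congr EFin.
have [nu0|nu0] := eqVneq (fine (nu (E t))) 0.
  by rewrite (pi_nu0 nu0) !mul0r.
by rewrite divff// mulr1.
Qed.

Lemma glued_snd A : measurable A -> glued (snd @^-1` A) = nu A.
Proof.
move=> mA; rewrite -setTX gluedX//.
rewrite -(measure_cells mE tE nuE mA) exchange_big/=; apply: eq_bigr => t _.
have mAs : nu (A `&` E t) \is a fin_num by exact/fin_num_measure/measurableI.
have [nu0|nu0] := eqVneq (fine (nu (E t))) 0.
  rewrite big1; last by move=> s _; rewrite (pi_nu0 nu0) mul0e.
  apply/esym/eqP; rewrite eq_le measure_ge0 andbT.
  have <- : nu (E t) = 0%E by rewrite -[LHS]fineK ?nu0// fin_num_measure.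
  by rewrite le_measure ?inE//; exact: measurableI.
rewrite (eq_bigr (fun s => (pi s t * (fine (nu (A `&` E t)) / fine (nu (E t))))%:E)).
  by rewrite sumEFin -mulr_suml pi_nu mulrC divfK// fineK.
move=> s _; rewrite setTI -EFinM; congr EFin.
have [mu0|mu0] := eqVneq (fine (mu (E s))) 0.
  by rewrite (pi_mu0 mu0) !mul0r.
by rewrite divff// mul1r.
Qed.

Lemma glued_setT : glued setT = 1%E.
Proof. by rewrite -(@probability_setT _ _ _ mu) -(glued_fst measurableT). Qed.

HB.instance Definition _ :=
  Measure_isProbability.Build _ _ _ glued glued_setT.

Lemma coupling_glued : coupling mu nu glued.
Proof. by move=> A mA; split; [exact: glued_fst|exact: glued_snd]. Qed.

(** The glued measure is a coupling of [mu] and [nu], and it only moves mass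
    from [E s] to [E t] at a cost of at most [c s t] per unit. *)
Lemma W1_le_plan : (W1 mu nu <= (\sum_s \sum_t pi s t * c s t)%:E)%E.
Proof.
apply: (@le_trans _ _ (\int[glued]_z (enorm (z.1 - z.2))%:E)%E).
  by apply: ereal_inf_lbound; exists glued => //; exact: coupling_glued.
have mf : measurable_fun [set: 'rV[R]_d * 'rV[R]_d]
    (fun z => (enorm (z.1 - z.2))%:E).
  by apply/measurable_EFinP; apply: measurable_enorm_diff.
have f0 (z : 'rV[R]_d * 'rV[R]_d) : (0 <= (enorm (z.1 - z.2))%:E)%E.
  by rewrite lee_fin enorm_ge0.
rewrite ge0_integral_measure_sum//.
rewrite (glued_sum (fun m => \int[m]_z (enorm (z.1 - z.2))%:E)%E).
rewrite -sumEFin (eq_bigr (fun s => \sum_t (pi s t * c s t)%:E)%E); last first.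
  by move=> s _; rewrite sumEFin.
rewrite pair_bigA/=; apply: lee_sum => -[s t] _ /=.
rewrite /glued_piece ge0_integral_mscale//=.
have [mu0|mu0] := eqVneq (fine (mu (E s))) 0.
  by rewrite /coef/= (pi_mu0 mu0) !mul0r mul0e.
have [nu0|nu0] := eqVneq (fine (nu (E t))) 0.
  by rewrite /coef/= (pi_nu0 nu0) !mul0r mul0e.
have neq0 (P : probability 'rV[R]_d R) A : fine (P A) != 0 -> exists x, A x.
  move=> PA; apply/set0P; apply: contra_neq PA => ->.
  by rewrite measure0.
have [x Ex] := neq0 _ _ mu0; have [y Ey] := neq0 _ _ nu0.
have c0 : 0 <= c s t by rewrite (le_trans (enorm_ge0 (x - y)))// c_ge.
have : (\int[mrestr (mu \x nu) (mD (s, t))]_z (enorm (z.1 - z.2))%:E <=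
    \int[mrestr (mu \x nu) (mD (s, t))]_z (c s t)%:E)%E.
  apply: ae_ge0_le_integral => //.
  exists (~` D (s, t)); split.
  - exact: measurableC.
  - by rewrite /= /mrestr setICl measure0.
  - by apply: subsetC => -[u v] [/= Eu Ev] _; rewrite lee_fin c_ge.
move=> /(lee_wpmul2l _) => /(_ (coef (s, t))%:E); rewrite lee_fin coef_ge0.
move=> /(_ isT)/le_trans; apply.
rewrite integral_cst//= /mrestr setTI product_measure1E//.
apply: (@le_trans _ _ ((coef (s, t))%:E * ((c s t)%:E *
    ((fine (mu (E s)))%:E * (fine (nu (E t)))%:E)))%E).
  by rewrite !fineK// fin_num_measure.
rewrite -!EFinM lee_fin /coef/=.
move: (fine (mu (E s))) (fine (nu (E t))) mu0 nu0 => m n m0 n0.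
by rewrite le_eqVlt; apply/orP; left; apply/eqP; field; rewrite m0 n0.
Qed.

End Gluing.

(** * Expectations of bounded functions *)

Section Expectation.
Local Open Scope classical_set_scope.
Context {R : realType} disp (U : measurableType disp) (P : probability U R).
Implicit Types f g : U -> R.

(** On bounded measurable functions, integrals against a probability are finite
    and hence linear with values in [R]. *)
Definition bmf f := measurable_fun setT f /\ exists M, forall x, `|f x| <= M.

Definition expect f : R := fine (\int[P]_x (f x)%:E).

Lemma bmf_cst c : bmf (fun=> c).
Proof. by split; [exact: measurable_cst|exists `|c|]. Qed.

Lemma bmfD f g : bmf f -> bmf g -> bmf (fun x => f x + g x).
Proof.
move=> [mf [M fM]] [mg [N gN]]; split; first exact: measurable_funD.
exists (M + N) => x; exact: le_trans (ler_normD _ _) (lerD _ _).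
Qed.

Lemma bmfM f g : bmf f -> bmf g -> bmf (fun x => f x * g x).
Proof.
move=> [mf [M fM]] [mg [N gN]]; split; first exact: measurable_funM.
by exists (M * N) => x; rewrite normrM ler_pM.
Qed.

Lemma bmfZ c f : bmf f -> bmf (fun x => c * f x).
Proof. exact/bmfM/bmf_cst. Qed.

Lemma bmfN f : bmf f -> bmf (fun x => - f x).
Proof.
by move=> /(bmfZ (-1)); congr bmf; apply/funext => x; rewrite mulN1r.
Qed.

Lemma bmfB f g : bmf f -> bmf g -> bmf (fun x => f x - g x).
Proof. by move=> bf /bmfN; exact: bmfD. Qed.

Lemma bmf_sum I (s : seq I) (h : I -> U -> R) : (forall i, bmf (h i)) ->
  bmf (fun x => \sum_(i <- s) h i x).
Proof.
move=> bh; elim: s => [|i s IH].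
  by under eq_fun do rewrite big_nil; exact: bmf_cst.
by under eq_fun do rewrite big_cons; exact: bmfD.
Qed.

Lemma bmfX n f : bmf f -> bmf (fun x => f x ^+ n).
Proof.
move=> bf; elim: n => [|n IH].
  by under eq_fun do rewrite expr0; exact: bmf_cst.
by under eq_fun do rewrite exprS; exact: bmfM.
Qed.

Lemma bmf_indic A : measurable A -> bmf (\1_A : U -> R).
Proof.
move=> mA; split; first exact: measurable_indic.
exists 1 => x; rewrite indicE; case: (_ \in _); rewrite ?normr1 ?normr0//.
Qed.

Lemma bmf_integrable f : bmf f -> P.-integrable setT (EFin \o f).
Proof.
move=> [mf [M fM]]; apply: measurable_bounded_integrable => //.
  by apply: (@le_lt_trans _ _ 1%E); [exact: probability_le1|exact: ltry].
exists M; split; first exact: num_real.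
by move=> N MN x _; exact: le_trans (fM x) (ltW MN).
Qed.

Lemma expectE f : expect f = \int[P]_x f x. Proof. by []. Qed.

Lemma expect_EFin f : bmf f -> (expect f)%:E = (\int[P]_x (f x)%:E)%E.
Proof.
by move=> bf; rewrite /expect fineK//; apply: integrable_fin_num => //;
  exact: bmf_integrable.
Qed.

Lemma expect_cst c : expect (fun=> c) = c.
Proof.
rewrite expectE Rintegral_cst//.
have -> : fine (P setT) = 1 by rewrite probability_setT.
by rewrite mulr1.
Qed.

Lemma expectD f g : bmf f -> bmf g ->
  expect (fun x => f x + g x) = expect f + expect g.
Proof. by move=> bf bg; rewrite !expectE RintegralD//; exact: bmf_integrable. Qed.

Lemma expectZ c f : bmf f -> expect (fun x => c * f x) = c * expect f.
Proof. by move=> bf; rewrite !expectE RintegralZl//; exact: bmf_integrable. Qed.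

Lemma expectN f : bmf f -> expect (fun x => - f x) = - expect f.
Proof.
by move=> bf; under eq_fun do rewrite -mulN1r; rewrite expectZ// mulN1r.
Qed.

Lemma expectB f g : bmf f -> bmf g ->
  expect (fun x => f x - g x) = expect f - expect g.
Proof. by move=> bf bg; rewrite expectD ?expectN//; exact: bmfN. Qed.

Lemma expect_sum I (s : seq I) (h : I -> U -> R) : (forall i, bmf (h i)) ->
  expect (fun x => \sum_(i <- s) h i x) = \sum_(i <- s) expect (h i).
Proof.
move=> bh; elim: s => [|i s IH].
  by under eq_fun do rewrite big_nil; rewrite big_nil expect_cst.
under eq_fun do rewrite big_cons; rewrite big_cons expectD ?IH//.
exact: bmf_sum.
Qed.

Lemma le_expect f g : bmf f -> bmf g -> (forall x, f x <= g x) ->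
  expect f <= expect g.
Proof.
by move=> bf bg fg; rewrite !expectE le_Rintegral//; exact: bmf_integrable.
Qed.

Lemma expect_norm_le f M : bmf f -> (forall x, `|f x| <= M) -> `|expect f| <= M.
Proof.
move=> bf fM; rewrite ler_norml -(expect_cst M) -expectN; last exact: bmf_cst.
by apply/andP; split; apply: le_expect => //; try exact: bmf_cst;
  move=> x; have := fM x; rewrite ler_norml => /andP[].
Qed.

Lemma expect_indic A : measurable A -> expect \1_A = fine (P A).
Proof. by move=> mA; rewrite /expect integral_indic// setIT. Qed.

End Expectation.

Section ExpectationTransport.
Local Open Scope classical_set_scope.
Context {R : realType}.

Lemma expect_comp d1 d2 (U : measurableType d1) (V : measurableType d2)
    (P : probability U R) (Q : probability V R) (X : U -> V) (f : V -> R) :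
  measurable_fun setT X -> (forall A, measurable A -> P (X @^-1` A) = Q A) ->
  bmf f -> bmf (f \o X) /\ expect P (f \o X) = expect Q f.
Proof.
move=> mX PQ bf; have [mf [M fM]] := bf.
have bfX : bmf (f \o X).
  by split; [exact: measurableT_comp|exists M => x; exact: fM].
split=> //; rewrite /expect.
have <- : (\int[pushforward P X]_x (f x)%:E = \int[Q]_x (f x)%:E)%E.
  by apply: eq_measure_integral => A mA _; exact: PQ.
rewrite integral_pushforward//; first exact/measurable_EFinP.
exact: (bmf_integrable P bfX).
Qed.

Context {d : nat}.
Implicit Types mu nu : probability 'rV[R]_d R.

Lemma W1_ge0 mu nu : (0 <= W1 mu nu)%E.
Proof.
apply: le_ereal_inf_tmp => _ [gam _ <-]; apply: integral_ge0 => z _.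
by rewrite lee_fin enorm_ge0.
Qed.

(** The easy half of duality: every coupling pays for the variation of [g]. The
    slack [eta] allows for test functions that are Lipschitz only at scales
    above a lattice mesh. *)
Lemma W1_ge_expect mu nu (g : 'rV[R]_d -> R) (L eta : R) :
  bmf g -> 0 < L -> (forall x y, g x - g y <= L * enorm (x - y) + eta) ->
  (((expect mu g - expect nu g - eta) / L)%:E <= W1 mu nu)%E.
Proof.
move=> bg L0 gL; apply: le_ereal_inf_tmp => _ [gamma cpl <-].
have [bg1 <-] := @expect_comp _ _ _ _ gamma mu fst g measurable_fst
  (fun A mA => (cpl A mA).1) bg.
have [bg2 <-] := @expect_comp _ _ _ _ gamma nu snd g measurable_snd
  (fun A mA => (cpl A mA).2) bg.
have mf : measurable_fun [set: 'rV[R]_d * 'rV[R]_d]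
    (fun z => (enorm (z.1 - z.2))%:E).
  by apply/measurable_EFinP; apply: measurable_enorm_diff.
have f0 (z : 'rV[R]_d * 'rV[R]_d) : (0 <= (enorm (z.1 - z.2))%:E)%E.
  by rewrite lee_fin enorm_ge0.
have [int_oo|int_oo] := eqVneq (\int[gamma]_z (enorm (z.1 - z.2))%:E)%E +oo%E.
  by rewrite int_oo leey.
have int_e : gamma.-integrable setT (fun z => (enorm (z.1 - z.2))%:E).
  apply/integrableP; split=> //; under eq_integral do rewrite gee0_abs//.
  by rewrite ltey.
rewrite -[leRHS]fineK; last by apply: integrable_fin_num.
rewrite lee_fin ler_pdivrMr// lerBlDr -expectB//.
rewrite -/(Rintegral gamma setT _) mulrC -RintegralZl//.
have int_Le : gamma.-integrable setT
    (EFin \o (fun z => L * enorm (z.1 - z.2))).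
  exact: (integrableZl measurableT L int_e).
have int_eta := bmf_integrable gamma (bmf_cst _ eta).
rewrite -(expect_cst gamma eta) [expect gamma (fun=> _)]expectE -RintegralD//.
apply: le_Rintegral => //.
- exact: (bmf_integrable gamma (bmfB bg1 bg2)).
- exact: (integrableD measurableT int_Le int_eta).
- by move=> z _; exact: gL.
Qed.

(** The step function with value [v t] on [E t] is within [eta] of [g] outside
    of a null set. *)
Lemma expect_cells mu (T : finType) (E : T -> set 'rV[R]_d) (g : 'rV[R]_d -> R)
    (v : T -> R) (eta : R) :
  (forall t, measurable (E t)) -> trivIset setT E ->
  (\sum_t mu (E t) = 1)%E -> bmf g ->
  (forall t x, E t x -> `|g x - v t| <= eta) ->
  `|expect mu g - \sum_t fine (mu (E t)) * v t| <= eta.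
Proof.
move=> mE tE muE bg gv.
have bE t := @bmf_indic R _ _ _ (mE t).
have sE1 := sum_fine_cells mE muE.
have -> : \sum_t fine (mu (E t)) * v t =
    expect mu (fun x => \sum_t v t * \1_(E t) x).
  rewrite expect_sum; last by move=> t; exact: bmfZ.
  by apply: eq_bigr => t _; rewrite expectZ// expect_indic// mulrC.
have [_ [M gM]] := bg.
have M0 : 0 <= M by exact: le_trans (normr_ge0 _) (gM 0).
pose s x : R := \sum_t \1_(E t) x.
have sE x : (exists2 t, E t x & forall t', t' != t -> ~ E t' x) \/
            (forall t, ~ E t x).
  have [[t Et]|nE] := pselect (exists t, E t x); last first.
    by right=> t Et; apply: nE; exists t.
  left; exists t => // t' t't Et'.
  move/trivIsetP : tE => /(_ t' t I I t't)/seteqP[+ _].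
  by move=> /(_ x); apply.
have bs : bmf s by exact: bmf_sum.
have bv : bmf (fun x => \sum_t v t * \1_(E t) x).
  by apply: bmf_sum => t; exact: bmfZ.
have Es : expect mu s = 1.
  by rewrite expect_sum// -[RHS]sE1; apply: eq_bigr => t _; rewrite expect_indic.
(* [1 - s] is the indicator of the null set missed by the cells, where only the
   bound [M] on [g] is available. *)
have key x : `|g x - \sum_t v t * \1_(E t) x| <= eta * s x + M * (1 - s x).
  rewrite /s; case: (sE x) => [[t Et nE]|nE].
    have i1 : \1_(E t) x = 1 :> R by rewrite indicE mem_set.
    have i0 t' : t' != t -> \1_(E t') x = 0 :> R.
      by move=> /nE ?; rewrite indicE memNset.
    rewrite (bigD1 t)//= big1 ?addr0; last by move=> t' /i0 ->; rewrite mulr0.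
    rewrite (bigD1 t)//= big1 ?addr0; last by move=> t' /i0 ->.
    by rewrite i1 !mulr1 subrr mulr0 addr0 gv.
  have i0 t : \1_(E t) x = 0 :> R by rewrite indicE memNset.
  rewrite big1; last by move=> t _; rewrite i0 mulr0.
  by rewrite big1// !subr0 mulr0 mulr1 add0r.
have bk : bmf (fun x => eta * s x + M * (1 - s x)).
  by apply: bmfD; apply: bmfZ => //; apply: bmfB => //; exact: bmf_cst.
have Ek : expect mu (fun x => eta * s x + M * (1 - s x)) = eta.
  rewrite expectD ?expectZ ?expectB ?expect_cst ?Es ?subrr ?mulr0 ?addr0 ?mulr1//.
  all: try exact: bmf_cst; try exact: bmfZ.
    by apply: bmfB => //; exact: bmf_cst.
  by apply: bmfZ; apply: bmfB => //; exact: bmf_cst.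
rewrite -expectB// ler_norml -{1 2}Ek -expectN//; apply/andP.
by split; apply: le_expect; [exact: bmfN| exact: bmfB| |exact: bmfB|by[]|];
  move=> x; have := key x; rewrite ler_norml => /andP[].
Qed.

End ExpectationTransport.

(** * Orthogonal projections *)

Section Projections.
Context {R : realType} {d : nat}.
Implicit Types (U : {vspace 'rV[R]_d}) (x y : 'rV[R]_d).

Lemma dotrvE x y : dotrv x y = (x *m y^T) 0 0.
Proof. by rewrite mxE; apply: eq_bigr => i _; rewrite mxE. Qed.

Lemma dotrv_mulmx x y (g : 'M[R]_d) : dotrv (x *m g) y = dotrv x (y *m g^T).
Proof. by rewrite !dotrvE trmx_mul trmxK mulmxA. Qed.

Lemma dotrv_orthogonal x y (g : 'M[R]_d) : g *m g^T = 1%:M ->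
  dotrv (x *m g) (y *m g) = dotrv x y.
Proof. by move=> gg; rewrite dotrv_mulmx -mulmxA gg mulmx1. Qed.

Lemma oproj_unique U x y : y \in U -> (forall z, z \in U -> dotrv (x - y) z = 0) ->
  oproj U x = y.
Proof.
move=> yU xyU; apply/eqP; rewrite -subr_eq0; apply: contraT => /dotrv_gt0.
have zU : oproj U x - y \in U by rewrite rpredB// oproj_mem.
have /mem_orthovP/(_ _ zU)/= h := oproj_orthov U x.
have xyz := xyU _ zU.
set z := oproj U x - y in zU h xyz *.
have zE : z = (x - y) - (x - oproj U x).
  by apply/rowP => i; rewrite !mxE; ring.
have -> : dotrv z z = 0.
  by rewrite {1}zE dotrvDl dotrvNl xyz h oppr0 addr0.
by rewrite ltxx.
Qed.

Lemma dotrv_oproj_res U x z : z \in U -> dotrv (x - oproj U x) z = 0.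
Proof.
by move=> zU; have /mem_orthovP/(_ _ zU) := oproj_orthov U x.
Qed.

Lemma dotrv_oproj U x z : z \in U -> dotrv (oproj U x) z = dotrv x z.
Proof.
move=> /(dotrv_oproj_res x)/eqP; rewrite dotrvDl dotrvNl subr_eq0.
by move=> /eqP.
Qed.

Lemma oproj_id U x : x \in U -> oproj U x = x.
Proof.
move=> xU; apply: oproj_unique => // z _; rewrite subrr.
by rewrite -(scale0r 0) dotrvZl mul0r.
Qed.

Lemma oproj_sym U x y : dotrv (oproj U x) y = dotrv x (oproj U y).
Proof.
rewrite -(dotrv_oproj x (oproj_mem U y)) dotrvC -[RHS]dotrvC.
by rewrite (dotrv_oproj y (oproj_mem U x)).
Qed.

Lemma dotrv_oproj_self U x : dotrv x (oproj U x) = enorm (oproj U x) ^+ 2.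
Proof. by rewrite enorm_sqr -(dotrv_oproj x (oproj_mem U x)). Qed.

Lemma oproj_le U x : enorm (oproj U x) <= enorm x.
Proof.
have [->|h] := eqVneq (enorm (oproj U x)) 0; first exact: enorm_ge0.
have h0 : 0 < enorm (oproj U x) by rewrite lt0r h enorm_ge0.
by rewrite -(ler_pM2r h0) -expr2 -dotrv_oproj_self dotrv_le.
Qed.

(** The plane [U] is the graph of a linear map with entries bounded by 1 over
    suitable coordinates: choose the [k] columns of a basis matrix whose minor
    has the largest absolute value, and normalise this block to the identity.
    By Cramer's rule each entry becomes the quotient of a minor by the largest
    one. *)
Lemma bounded_graph_basis U k : \dim U = k ->
  exists (M : 'M[R]_(k, d)) (f : 'I_k -> 'I_d),
  [/\ injective f, forall i, row i M \in U, forall i j, `|M i j| <= 1,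
      forall i j, M i (f j) = (i == j)%:R &
      forall x, x \in U -> exists c : 'rV_k, x = c *m M].
Proof.
move=> Uk; subst k; set k := \dim U.
pose B : 'M[R]_(k, d) := \matrix_i (vbasis U)`_i.
have BU c : c *m B = \sum_(i < k) c 0 i *: (vbasis U)`_i.
  rewrite mulmx_sum_row; apply: eq_bigr => i _.
  by congr (_ *: _); apply/rowP => j; rewrite !mxE.
have Bfull : row_full B^T.
  rewrite /row_full mxrank_tr -/(row_free B); apply/inj_row_free => c.
  rewrite BU => c0; have /freeP fB := basis_free (vbasisP U).
  by apply/rowP => i; rewrite (fB _ c0) mxE.
pose f0 : {ffun 'I_k -> 'I_d} := fullrankfun Bfull.
have det_f0 : \det (colsub f0 B) != 0.
  have := fullrowsub_unit Bfull; rewrite unitmxE unitfE -det_tr.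
  by congr (\det _ != 0); apply/matrixP => i j; rewrite !mxE.
pose f := [arg max_(f > f0) `|\det (colsub f B)|]%O.
have [det_f fmax] : \det (colsub f B) != 0 /\
    forall g : {ffun 'I_k -> 'I_d}, `|\det (colsub g B)| <= `|\det (colsub f B)|.
  rewrite /f; case: arg_maxP => //= g _ gmax; split; last by move=> h; exact: gmax.
  by rewrite -normr_gt0 (lt_le_trans _ (gmax f0 isT))// normr_gt0.
pose A := colsub f B.
have Aunit : A \in unitmx by rewrite unitmxE unitfE.
pose M := invmx A *m B.
have MI i j : M i (f j) = (i == j)%:R.
  have : invmx A *m A = 1%:M by rewrite mulVmx.
  move=> /matrixP/(_ i j); rewrite [in RHS]mxE => <-.
  by rewrite !mxE; apply: eq_bigr => l _; rewrite [in RHS]mxE.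
exists M, f; split=> //.
- move=> i j fij; apply/eqP; move: (MI i i) (MI i j).
  by rewrite fij eqxx => ->; case: eqP => // _ /eqP; rewrite oner_eq0.
- move=> i; rewrite rowE mulmxA BU rpred_sum// => j _.
  by rewrite rpredZ// vbasis_mem// mem_nth// size_tuple.
- move=> i j.
  pose g : {ffun 'I_k -> 'I_d} := [ffun l => if l == i then j else f l].
  have -> : M i j = (\det A)^-1 * \det (colsub g B).
    rewrite /M /invmx Aunit -scalemxAl mxE; congr (_ * _).
    rewrite (expand_det_col _ i) mxE; apply: eq_bigr => l _.
    rewrite !mxE ffunE eqxx mulrC; congr (_ * _); rewrite /cofactor.
    congr (_ * \det _); apply/matrixP => a b; rewrite !mxE ffunE.
    by rewrite eq_sym (negPf (neq_lift _ _)).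
  by rewrite normrM normfV ler_pdivrMl ?normr_gt0// mulr1 fmax.
- move=> x xU; have xB : x = (\row_i coord (vbasis U) i x) *m B.
    rewrite BU {1}(coord_vbasis xU); apply: eq_bigr => i _; by rewrite mxE.
  exists ((\row_i coord (vbasis U) i x) *m A).
  by rewrite /M -mulmxA (mulmxA A) mulmxV// mul1mx.
Qed.

End Projections.

(** * Rotations acting on the Grassmannian *)

Section Rotations.
Local Open Scope classical_set_scope.
Context {R : realType} {d k : nat} {kd : (k <= d)%N}.
Local Notation G := (grassmannian R kd).
Implicit Types (xi : G) (g : 'M[R]_d).

Lemma dim_val xi : \dim (val xi) = k.
Proof. exact/eqP/(valP xi). Qed.

Lemma proj_matrixE xi (x : 'rV[R]_d) : x *m proj_matrix xi = oproj (val xi) x.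
Proof. exact: mul_rV_lin1. Qed.

Lemma proj_matrix_entry xi i j :
  proj_matrix xi i j = dotrv (oproj (val xi) 'e_i) 'e_j.
Proof.
by rewrite -proj_matrixE -rowE dotrv_delta [RHS]mxE.
Qed.

Lemma proj_matrix_sym xi : (proj_matrix xi)^T = proj_matrix xi.
Proof.
by apply/matrixP => i j; rewrite mxE !proj_matrix_entry oproj_sym dotrvC.
Qed.

Lemma proj_matrix_le1 xi i j : `|proj_matrix xi i j| <= 1.
Proof.
have -> : proj_matrix xi i j = (oproj (val xi) 'e_i) 0 j.
  by rewrite -proj_matrixE -rowE [RHS]mxE.
apply: le_trans (coord_le_enorm _ _) _.
by rewrite (le_trans (oproj_le _ _))// enorm_delta.
Qed.

(** For a graph basis [M] of the plane, the projection factors as [N *m M] with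
    [M *m N] the identity of size [k], and traces are cyclic. *)
Lemma proj_matrix_trace xi : \tr (proj_matrix xi) = k%:R.
Proof.
have [M [f [_ Mxi _ Mf Mspan]]] := bounded_graph_basis (dim_val xi).
have MP : M *m proj_matrix xi = M.
  by apply/row_matrixP => i; rewrite row_mul proj_matrixE oproj_id.
pose N := colsub f (proj_matrix xi).
have PE : proj_matrix xi = N *m M.
  apply/row_matrixP => i; rewrite row_mul.
  have [c cE] : exists c : 'rV_k, row i (proj_matrix xi) = c *m M.
    by apply: Mspan; rewrite rowE proj_matrixE oproj_mem.
  rewrite cE; congr (_ *m _); apply/rowP => j.
  have /rowP/(_ (f j)) := cE; rewrite !mxE => ->.
  rewrite (bigD1 j)//= Mf eqxx mulr1 big1 ?addr0// => l /negPf lj.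
  by rewrite Mf lj mulr0.
rewrite PE mxtrace_mulC.
have -> : M *m N = 1%:M.
  apply/matrixP => i j; have /matrixP/(_ i (f j)) := MP.
  rewrite Mf => MPij; rewrite [RHS]mxE -MPij !mxE.
  by apply: eq_bigr => l _; rewrite [in LHS]mxE.
by rewrite mxtrace1.
Qed.

Lemma bmf_proj_matrix i j : bmf (fun xi : G => proj_matrix xi i j).
Proof.
split; last by exists 1 => xi; exact: proj_matrix_le1.
apply: (measurability _ (RGenOInfty.measurableE R)).
move=> _ [_ [a ->] <-]; rewrite setTI; apply: sub_sigma_algebra.
have c : continuous (fun xi : G => proj_matrix xi i j).
  move=> xi; apply: (@continuous_comp _ _ _ (proj_matrix : G -> 'M[R]_d)
    (fun A : 'M[R]_d => A i j)).
    exact: initial_continuous.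
  exact: coord_continuous.
by move/continuousP : c; apply; exact: interval_open.
Qed.

Definition rotate g (U : {vspace 'rV[R]_d}) := (linfun (mulmxr g) @: U)%VS.

Lemma rotateK g h U : g *m h = 1%:M -> rotate h (rotate g U) = U.
Proof.
move=> gh; rewrite /rotate -limg_comp -[RHS]lim1g; apply: eq_in_limg => x _.
by rewrite comp_lfunE !lfunE/= -mulmxA gh mulmx1.
Qed.

Lemma dim_rotate g U : g *m g^T = 1%:M -> \dim (rotate g U) = \dim U.
Proof.
move=> gg; apply: limg_dim_eq; apply/eqP; rewrite -subv0; apply/subvP => x.
rewrite memv_cap memv_ker lfunE/= memv0 => /andP[_ /eqP xg].
by rewrite -[x]mulmx1 -gg mulmxA xg mul0mx.
Qed.

Lemma rotate_proof g xi : g *m g^T = 1%:M -> \dim (rotate g (val xi)) == k.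
Proof. by move=> gg; rewrite dim_rotate// dim_val. Qed.

Definition Grotate g (gg : g *m g^T = 1%:M) xi : G :=
  exist (fun U : {vspace 'rV[R]_d} => \dim U == k) _ (rotate_proof xi gg).

Lemma orthogonal_tr g : g *m g^T = 1%:M -> g^T *m g = 1%:M.
Proof. exact: mulmx1C. Qed.

Lemma proj_matrix_rotate g (gg : g *m g^T = 1%:M) xi :
  proj_matrix (Grotate gg xi) = g^T *m proj_matrix xi *m g.
Proof.
apply/row_matrixP => i; rewrite !rowE proj_matrixE !mulmxA.
set x := 'e_i; apply: oproj_unique => [|z /memv_imgP[y yxi ->]].
  rewrite (_ : _ *m g = linfun (mulmxr g) (x *m g^T *m proj_matrix xi)); last first.
    by rewrite lfunE.
  by apply: memv_img; rewrite proj_matrixE oproj_mem.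
rewrite lfunE/= -{1}[x]mulmx1 -(orthogonal_tr gg) mulmxA -mulmxBl.
by rewrite dotrv_orthogonal// proj_matrixE dotrv_oproj_res.
Qed.

(** The topology of the Grassmannian is induced by [proj_matrix], which a
    rotation changes by the continuous map [A |-> g^T *m A *m g]. *)
Lemma measurable_Grotate g (gg : g *m g^T = 1%:M) :
  measurable_fun setT (Grotate gg).
Proof.
apply: (measurability (@open G)) => // _ [_ [Q oQ <-] <-].
rewrite setTI; apply: sub_sigma_algebra.
pose Phi (A : 'M[R]_d) := g^T *m A *m g.
have cPhi : continuous Phi.
  have -> : Phi = fun A => \sum_i \sum_j A i j *: Phi (delta_mx i j).
    apply/funext => A; rewrite /Phi {1}[A]matrix_sum_delta mulmx_sumr mulmx_suml.
    apply: eq_bigr => i _; rewrite mulmx_sumr mulmx_suml; apply: eq_bigr => j _.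
    by rewrite -scalemxAr -scalemxAl.
  apply: continuous_big => [|i _]; first exact: add_continuous.
  apply: continuous_big => [|j _ A]; first exact: add_continuous.
  by have cA := @coord_continuous R d d i j A; exact: cvgZr_tmp cA.
exists (Phi @^-1` Q); first by move/continuousP : cPhi; apply.
by apply/seteqP; split=> xi /=; rewrite proj_matrix_rotate.
Qed.

(** Invariance is a statement about images of sets; a preimage under the
    rotation [g] is an image under the inverse rotation [g^T]. *)
Lemma expect_rotate (sigma : probability G R) (f : G -> R) g
    (gg : g *m g^T = 1%:M) :
  rotation_invariant sigma -> \det g = 1 -> bmf f ->
  bmf (f \o Grotate gg) /\ expect sigma (f \o Grotate gg) = expect sigma f.
Proof.
move=> inv dg bf; apply: expect_comp => //; first exact: measurable_Grotate.
move=> A mA; rewrite -(inv g^T _ _ A mA) ?trmxK ?det_tr//; last first.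
  exact: orthogonal_tr.
congr (sigma _); apply/seteqP; split=> [xi Axi|eta [xi Axi etaE]].
- exists (Grotate gg xi) => //=; rewrite -/(rotate g (val xi)).
  by rewrite -/(rotate _ _) (rotateK _ gg).
- rewrite /= (_ : Grotate gg eta = xi)//; apply: val_inj => /=.
  by rewrite etaE -/(rotate _ _) rotateK// orthogonal_tr.
Qed.

End Rotations.

(** * First-order expansions with uniform remainder *)

(** Divide by [t] and let [t] tend to 0. *)
Lemma le_sqr_eq0 (R : realType) (b C : R) :
  (forall t, 0 <= t <= 1 -> `|t * b| <= C * t ^+ 2) -> b = 0.
Proof.
move=> key; apply/eqP; rewrite -normr_eq0; apply/eqP/le_anti.
rewrite normr_ge0 andbT; apply/ler_addgt0Pr => e e0; rewrite add0r.
have C1 : 0 < `|C| + 1 by rewrite ltr_wpDl.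
pose t := Num.min 1 (e / (`|C| + 1)).
have t0 : 0 < t by rewrite lt_min ltr01 divr_gt0.
have t01 : 0 <= t <= 1 by rewrite (ltW t0) ge_min lexx.
have := key t t01.
rewrite normrM (gtr0_norm t0) expr2 mulrCA ler_pM2l// => /le_trans; apply.
have : t <= e / (`|C| + 1) by rewrite ge_min lexx orbT.
rewrite ler_pdivlMr// => /(le_trans _); apply.
by rewrite mulrC ler_wpM2l ?(ltW t0)// (le_trans (ler_norm C))// lerDl.
Qed.

Section Jets.
Context {R : realType} {X : Type}.
Implicit Types (F H : R -> X -> R) (a b : X -> R).

Definition bounded a := exists M, forall x, `|a x| <= M.

(** [F t x = a x + t * b x + O(t^2)] as [t] tends to 0 from above, uniformly in
    [x]: the uniformity makes it possible to take expectations in [x]. *)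
Definition jet F a b := [/\ bounded a, bounded b & exists C, forall t x,
  0 <= t <= 1 -> `|F t x - a x - t * b x| <= C * t ^+ 2].

Lemma bounded_cst c : bounded (fun=> c).
Proof. by exists `|c|. Qed.

Lemma boundedD a b : bounded a -> bounded b -> bounded (fun x => a x + b x).
Proof.
move=> [M aM] [N bN]; exists (M + N) => x.
exact: le_trans (ler_normD _ _) (lerD _ _).
Qed.

Lemma boundedM a b : bounded a -> bounded b -> bounded (fun x => a x * b x).
Proof.
by move=> [M aM] [N bN]; exists (M * N) => x; rewrite normrM ler_pM.
Qed.

Lemma boundedX n a : bounded a -> bounded (fun x => a x ^+ n).
Proof.
move=> ba; elim: n => [|n IH]; first exact: bounded_cst.
by under eq_fun do rewrite exprS; exact: boundedM.
Qed.

Lemma jet_eq F a b a' b' : jet F a b -> a =1 a' -> b =1 b' -> jet F a' b'.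
Proof. by move=> + /funext <- /funext <-. Qed.

Lemma jet_cst a : bounded a -> jet (fun=> a) a (fun=> 0).
Proof.
move=> ba; split=> //; first exact: bounded_cst.
by exists 0 => t x _; rewrite mulr0 subr0 subrr normr0 mul0r.
Qed.

Lemma jetD F H a b a' b' : jet F a b -> jet H a' b' ->
  jet (fun t x => F t x + H t x) (fun x => a x + a' x) (fun x => b x + b' x).
Proof.
move=> [ba bb [C FC]] [ba' bb' [D HD]]; split; [exact: boundedD..|].
exists (C + D) => t x t01; rewrite mulrDl.
rewrite (_ : _ - _ - _ = (F t x - a x - t * b x) + (H t x - a' x - t * b' x)).
  exact: le_trans (ler_normD _ _) (lerD (FC _ _ t01) (HD _ _ t01)).
by ring.
Qed.

Lemma jetM F H a b a' b' : jet F a b -> jet H a' b' ->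
  jet (fun t x => F t x * H t x) (fun x => a x * a' x)
      (fun x => a x * b' x + b x * a' x).
Proof.
move=> [ba bb [C FC]] [ba' bb' [D HD]]; split.
- exact: boundedM.
- by apply: boundedD; exact: boundedM.
have [A aA] := ba; have [B bB] := bb; have [A' aA'] := ba'; have [B' bB'] := bb'.
exists (B * B' + (A + B) * D + C * (A' + B') + C * D) => t x t01.
have /andP[t0 t1] := t01.
have tt : 0 <= t ^+ 2 <= 1 by rewrite sqr_ge0 expr_le1.
have {}FC := FC _ x t01; have {}HD := HD _ x t01.
set r := F t x - a x - t * b x in FC; set r' := H t x - a' x - t * b' x in HD.
have ab : `|a x + t * b x| <= A + B.
  apply: le_trans (ler_normD _ _) (lerD (aA x) _).
  by rewrite normrM ger0_norm// (le_trans (ler_piMl _ t1)).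
have ab' : `|a' x + t * b' x| <= A' + B'.
  apply: le_trans (ler_normD _ _) (lerD (aA' x) _).
  by rewrite normrM ger0_norm// (le_trans (ler_piMl _ t1)).
rewrite (_ : _ - _ - _ = t ^+ 2 * (b x * b' x) + (a x + t * b x) * r' +
   r * (a' x + t * b' x) + r * r'); last by rewrite /r /r'; ring.
rewrite !mulrDl.
have h1 : `|t ^+ 2 * (b x * b' x)| <= B * B' * t ^+ 2.
  rewrite normrM (ger0_norm (sqr_ge0 t)) mulrC ler_wpM2r ?sqr_ge0//.
  by rewrite normrM ler_pM.
have h2 : `|(a x + t * b x) * r'| <= (A + B) * D * t ^+ 2.
  by rewrite normrM -mulrA ler_pM.
have h3 : `|r * (a' x + t * b' x)| <= C * (A' + B') * t ^+ 2.
  by rewrite normrM mulrAC ler_pM.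
have h4 : `|r * r'| <= C * D * t ^+ 2.
  rewrite normrM -mulrA; apply: le_trans (ler_pM _ _ FC HD) _ => //.
  rewrite -mulrA; have CD : 0 <= C * (t ^+ 2 * (D * t ^+ 2)).
    by rewrite mulrA mulr_ge0// (le_trans _ FC, le_trans _ HD).
  rewrite (_ : C * (t ^+ 2 * (D * t ^+ 2)) = t ^+ 2 * (C * (D * t ^+ 2))) in CD *.
    rewrite ler_piMl//; last by case/andP : tt.
    have [t2|t2] := eqVneq (t ^+ 2) 0; first by rewrite t2 !mulr0.
    by rewrite -(pmulr_rge0 _ (_ : 0 < t ^+ 2)) // lt0r t2 sqr_ge0.
  by ring.
rewrite -!mulrDl in h1 h2 h3 h4 *.
apply: le_trans (ler_normD _ _) _; rewrite [leRHS]mulrDl lerD//.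
apply: le_trans (ler_normD _ _) _; rewrite [leRHS]mulrDl lerD//.
by apply: le_trans (ler_normD _ _) _; rewrite [leRHS]mulrDl lerD.
Qed.

Lemma jetZ c F a b : jet F a b ->
  jet (fun t x => c * F t x) (fun x => c * a x) (fun x => c * b x).
Proof.
move=> jF; apply: (jet_eq (jetM (jet_cst (bounded_cst c)) jF)) => // x.
by rewrite mul0r addr0.
Qed.

Lemma jet_sum I (s : seq I) (F : I -> R -> X -> R) (a b : I -> X -> R) :
  (forall i, jet (F i) (a i) (b i)) ->
  jet (fun t x => \sum_(i <- s) F i t x) (fun x => \sum_(i <- s) a i x)
      (fun x => \sum_(i <- s) b i x).
Proof.
move=> jF; elim: s => [|i s IH].
  rewrite (_ : (fun t x => _) = (fun=> fun=> 0)); last first.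
    by apply/funext => t; apply/funext => x; rewrite big_nil.
  apply: (jet_eq (jet_cst (bounded_cst 0))) => x; by rewrite big_nil.
rewrite (_ : (fun t x => _) = (fun t x => F i t x + \sum_(j <- s) F j t x)).
  by apply: (jet_eq (jetD (jF i) IH)) => x; rewrite big_cons.
by apply/funext => t; apply/funext => x; rewrite big_cons.
Qed.

Lemma jetX n F a b : jet F a b ->
  jet (fun t x => F t x ^+ n) (fun x => a x ^+ n)
      (fun x => n%:R * a x ^+ n.-1 * b x).
Proof.
move=> jF; elim: n => [|n IH].
  apply: (jet_eq (jet_cst (bounded_cst 1))) => x; by rewrite ?mul0r.
rewrite (_ : (fun t x => _) = (fun t x => F t x * F t x ^+ n)).
  apply: (jet_eq (jetM jF IH)) => x; first by rewrite exprS.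
  case: n {IH} => [|n] /=; first by rewrite !mul0r mulr0 add0r expr0 !mulr1 mul1r.
  rewrite -[n.+2]addn1 natrD (exprS (a x) n); ring.
by apply/funext => t; apply/funext => x; rewrite exprS.
Qed.

End Jets.

Section InvSqrt.
Context {R : realType}.

(** The function [(1 + y)^(-1/2)]. All kernels and ridge profiles are combinations
    of its natural powers, so that exponents [-n/2] never have to be real powers. *)
Definition isq (y : R) : R := (Num.sqrt (1 + y))^-1.

Lemma isq_gt0 y : 0 <= y -> 0 < isq y.
Proof. by move=> y0; rewrite invr_gt0 sqrtr_gt0; lra. Qed.

Lemma isq_le1 y : 0 <= y -> isq y <= 1.
Proof.
move=> y0; rewrite invf_le1 ?sqrtr_gt0; last by lra.
by rewrite -[leLHS]sqrtr1 ler_wsqrtr//; lra.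
Qed.

Lemma isq_sqr y : 0 <= y -> isq y ^+ 2 = (1 + y)^-1.
Proof. by move=> y0; rewrite exprVn sqr_sqrtr//; lra. Qed.

Lemma isq_sqrM y : 0 <= y -> isq y ^+ 2 * (1 + y) = 1.
Proof. by move=> y0; rewrite isq_sqr// mulVf//; lra. Qed.

Lemma isq_ge0 (y : R) : 0 <= y -> 0 <= isq y.
Proof. by move=> /isq_gt0/ltW. Qed.

Lemma isq_mul_le1 (a : R) : 0 <= a -> a * isq (a ^+ 2) <= 1.
Proof.
move=> a0; have y0 : 0 <= a ^+ 2 by rewrite sqr_ge0.
rewrite -(@expr_le1 _ 2)// ?mulr_ge0 ?isq_ge0// exprMn isq_sqr//.
by rewrite ler_pdivrMr ?mul1r; lra.
Qed.

(** Dividing by [u + v] the difference of the relations [u^2 * (1 + a^2) = 1] and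
    [v^2 * (1 + b^2) = 1] displays the factor [a - b]; the cofactor is at most 1
    since [a * u] and [b * v] are. *)
Lemma isq_lipschitz (a b : R) : 0 <= a -> 0 <= b ->
  `|isq (a ^+ 2) - isq (b ^+ 2)| <= `|a - b|.
Proof.
move=> a0 b0.
have := isq_mul_le1 a0; have := isq_mul_le1 b0.
have := isq_sqrM (sqr_ge0 a); have := isq_sqrM (sqr_ge0 b).
have := isq_gt0 (sqr_ge0 a); have := isq_gt0 (sqr_ge0 b).
have := isq_le1 (sqr_ge0 a); have := isq_le1 (sqr_ge0 b).
move: (isq (a ^+ 2)) (isq (b ^+ 2)) => u v v1 u1 vp up vb ua bv au.
have u0 := ltW up; have v0 := ltW vp.
have s0 : 0 < u + v by rewrite addr_gt0.
have -> : u - v = (b - a) * ((u * v) * (u * (b * v) + v * (a * u)) / (u + v)).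
  have suv : u + v != 0 by rewrite gt_eqF.
  apply: (mulIf suv); rewrite [X in _ = X * _]mulrA divfK//.
  have -> : (u - v) * (u + v) = u ^+ 2 * (v ^+ 2 * (1 + b ^+ 2)) - v ^+ 2 * (u ^+ 2 * (1 + a ^+ 2)).
    by rewrite vb ua; ring.
  by ring.
rewrite normrM distrC ler_piMr// ger0_norm; last first.
  by rewrite divr_ge0 ?mulr_ge0 ?addr_ge0 ?mulr_ge0// ltW.
rewrite ler_pdivrMr// mul1r.
apply: (@le_trans _ _ (1 * (u + v))); last by rewrite mul1r.
apply: ler_pM; rewrite ?mulr_ge0 ?addr_ge0 ?mulr_ge0//.
  by rewrite -[leRHS]mul1r ler_pM.
by apply: lerD; rewrite -[leRHS]mulr1 ler_wpM2l.
Qed.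

Lemma isqX_lipschitz (n : nat) (a b : R) : 0 <= a -> 0 <= b ->
  `|isq (a ^+ 2) ^+ n - isq (b ^+ 2) ^+ n| <= n%:R * `|a - b|.
Proof.
move=> a0 b0; have := isq_lipschitz a0 b0.
have := isq_ge0 (sqr_ge0 a); have := isq_ge0 (sqr_ge0 b).
have := isq_le1 (sqr_ge0 a); have := isq_le1 (sqr_ge0 b).
move: (isq (a ^+ 2)) (isq (b ^+ 2)) => u v v1 u1 v0 u0 uv.
elim: n => [|n IH]; first by rewrite !expr0 subrr normr0 mul0r.
rewrite (_ : _ - _ = (u - v) * u ^+ n + v * (u ^+ n - v ^+ n)); last first.
  by rewrite !exprS; ring.
have -> : n.+1%:R = 1 + n%:R :> R by rewrite -natr1 addrC.
rewrite [leRHS]mulrDl mul1r; apply: le_trans (ler_normD _ _) (lerD _ _).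
  by rewrite normrM (le_trans _ uv)// ler_piMr// ger0_norm ?exprn_ge0// exprn_ile1.
by rewrite normrM (ger0_norm v0) (le_trans _ IH)// ler_piMl.
Qed.

Lemma isq_le_inv (a : R) : 0 <= a -> isq (a ^+ 2) <= 2 * (1 + a)^-1.
Proof.
move=> a0; have y0 : 0 <= a ^+ 2 by rewrite sqr_ge0.
rewrite -(@ler_pXn2r _ 2)// ?nnegrE ?isq_ge0 ?mulr_ge0 ?invr_ge0 ?addr_ge0//.
rewrite isq_sqr// exprMn exprVn -[leLHS]mul1r ler_pdivrMr; last by lra.
rewrite mulrAC ler_pdivlMr ?exprn_gt0//; last by lra.
by rewrite mul1r; nra.
Qed.

Lemma isq_prod (I : finType) (x : I -> R) :
  isq (\sum_i x i ^+ 2) ^+ (2 * #|I|) <= \prod_i isq (x i ^+ 2) ^+ 2.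
Proof.
have S0 : 0 <= \sum_i x i ^+ 2 by apply: sumr_ge0 => i _; rewrite sqr_ge0.
rewrite exprM -prodr_const [leRHS](eq_bigl (mem I))//.
apply: ler_prod => i _; rewrite exprn_ge0 ?isq_ge0//=.
rewrite !isq_sqr ?sqr_ge0// lef_pV2 ?posrE ?ltr_wpDr ?sqr_ge0//.
rewrite lerD2l (bigD1 i)//= lerDl; apply: sumr_ge0 => j _; exact: sqr_ge0.
Qed.

Lemma measurable_isq_max : measurable_fun setT (fun y : R => isq (Num.max 0 y)).
Proof.
rewrite (_ : (fun y => _) = fun y : R => (Num.sqrt (1 + Num.max 0 y)) `^ (-1)); last first.
  by apply/funext => y; rewrite powR_inv1 ?sqrtr_ge0.
apply: (measurableT_comp (measurable_powR (-1))).
apply: (@measurableT_comp _ _ _ _ _ _ (@Num.sqrt R)).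
  by apply: continuous_measurable_fun; exact: sqrt_continuous.
apply: measurable_funD; first exact: measurable_cst.
by apply: measurable_maxr => //; exact: measurable_id.
Qed.

Lemma bmf_isq disp (U : measurableType disp) (f : U -> R) :
  measurable_fun setT f -> (forall x, 0 <= f x) -> bmf (isq \o f).
Proof.
move=> mf f0; split.
  rewrite (_ : _ \o _ = (fun y => isq (Num.max 0 y)) \o f); last first.
    by apply/funext => xi /=; rewrite max_r.
  exact: (measurableT_comp measurable_isq_max).
by exists 1 => xi; rewrite ger0_norm ?isq_le1// ltW// isq_gt0.
Qed.

(** From [u^2 * (1 + y) = v^2 * (1 + z) = 1] follows
    [(v - u) * (u + v) = - (z - y) * u^2 * v^2]; using this relation twice
    exhibits the factor [(z - y)^2] of the remainder, with a cofactor that is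
    bounded because [u] and [v] lie in [[0, 1]]. *)
Lemma isq_taylor y z : 0 <= y -> 0 <= z ->
  `|isq z - isq y + 2^-1 * isq y ^+ 3 * (z - y)| <= (z - y) ^+ 2.
Proof.
move=> y0 z0.
have := isq_gt0 y0; have := isq_gt0 z0; have := isq_le1 y0; have := isq_le1 z0.
have := isq_sqrM y0; have := isq_sqrM z0.
move: (isq y) (isq z) => u v vz uy v1 u1 vp up.
have u0 := ltW up; have v0 := ltW vp.
set D := z - y.
have uv : (v - u) * (u + v) = - D * (u ^+ 2 * v ^+ 2).
  have -> : (v - u) * (u + v) = v ^+ 2 * (u ^+ 2 * (1 + y)) - u ^+ 2 * (v ^+ 2 * (1 + z)).
    by rewrite uy vz; ring.
  by rewrite /D; ring.
have s0 : 0 < u + v by lra.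
have uvE : v - u = - D * (u ^+ 2 * v ^+ 2) / (u + v) by rewrite -uv mulfK// gt_eqF.
have -> : v - u + 2^-1 * u ^+ 3 * D =
    - D * u ^+ 2 * ((2 * v + u) / (2 * (u + v))) * (v - u).
  rewrite -mulrA -[in RHS]mulrA.
  transitivity (- D * u ^+ 2 * (v ^+ 2 / (u + v) - u / 2)).
    by rewrite uvE; field; rewrite gt_eqF.
  rewrite (_ : v ^+ 2 / (u + v) - u / 2 =
    (2 * v + u) / (2 * (u + v)) * (v - u)); first by ring.
  by field; rewrite gt_eqF.
have w1 : `|v - u| <= `|D|.
  rewrite uvE !normrM normrN -mulrA ler_piMr// normfV !ger0_norm ?mulr_ge0 ?sqr_ge0 ?(ltW s0)//.
  rewrite ler_pdivrMr// mul1r.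
  have : u ^+ 2 * v ^+ 2 <= u * 1.
    rewrite ler_pM ?sqr_ge0//; first by rewrite expr2 ler_piMl.
    by rewrite expr_le1.
  by rewrite mulr1; lra.
have w2 : `|(2 * v + u) / (2 * (u + v))| <= 1.
  rewrite ger0_norm; last by rewrite divr_ge0//; lra.
  by rewrite ler_pdivrMr ?mul1r; lra.
have w3 : `|u ^+ 2| <= 1 by rewrite ger0_norm ?sqr_ge0// expr_le1.
rewrite 3!normrM normrN; apply: (@le_trans _ _ (`|D| * 1 * 1 * `|D|)).
  by do 3! (rewrite ler_pM ?mulr_ge0//).
by rewrite !mulr1 -normrM -expr2 ger0_norm ?sqr_ge0.
Qed.

Lemma jet_isq (X : Type) (F : R -> X -> R) a b : jet F a b ->
  (forall t x, 0 <= t <= 1 -> 0 <= F t x) -> (forall x, 0 <= a x) ->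
  jet (fun t x => isq (F t x)) (fun x => isq (a x))
      (fun x => - 2^-1 * isq (a x) ^+ 3 * b x).
Proof.
move=> [ba [B bB] [C FC]] F0 a0.
have bi : bounded (fun x => isq (a x)).
  by exists 1 => x; rewrite ger0_norm ?isq_le1// ltW// isq_gt0.
split=> //.
  by apply: boundedM; [apply: boundedM; [exact: bounded_cst|exact: boundedX]|exists B].
exists ((`|C| + B) ^+ 2 + `|C|) => t x t01.
have {}FC : `|F t x - a x - t * b x| <= `|C| * t ^+ 2.
  by rewrite (le_trans (FC _ x t01))// ler_wpM2r ?sqr_ge0// ler_norm.
have /andP[t0 t1] := t01.
have tay := isq_taylor (a0 x) (F0 t x t01).
set r := F t x - a x - t * b x in FC.
have FE : F t x - a x = t * b x + r by rewrite /r; ring.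
rewrite (_ : _ - _ - _ = (isq (F t x) - isq (a x) +
  2^-1 * isq (a x) ^+ 3 * (F t x - a x)) - 2^-1 * isq (a x) ^+ 3 * r); last first.
  by rewrite FE; ring.
rewrite mulrDl; apply: le_trans (ler_normB _ _) (lerD (le_trans tay _) _).
  rewrite -exprMn -[leLHS]ger0_norm ?sqr_ge0// normrX ler_pXn2r ?nnegrE//;
    last by rewrite mulr_ge0// addr_ge0// (le_trans _ (bB x)).
  rewrite FE mulrDl addrC; apply: le_trans (ler_normD _ _) (lerD _ _).
    by rewrite (le_trans FC)// expr2 mulrA ler_piMr// mulr_ge0.
  by rewrite normrM ger0_norm// mulrC ler_wpM2r.
rewrite normrM (le_trans _ FC)// ler_piMl// normrM.
have i1 : `|isq (a x) ^+ 3| <= 1.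
  rewrite ger0_norm ?exprn_ge0 ?(ltW (isq_gt0 _))//.
  by rewrite expr_le1 ?isq_le1// (ltW (isq_gt0 _)).
rewrite ger0_norm ?invr_ge0// (le_trans (ler_wpM2l _ i1)) ?invr_ge0// mulr1.
by rewrite invf_le1; lra.
Qed.
End InvSqrt.

(** * A Stein identity on the Grassmannian *)

Section Cayley.
Context {R : realType} {d : nat}.
Variable J : 'M[R]_d.
Hypothesis J_skew : J^T = - J.

(** For skew [J], a curve of rotations with velocity [2 *: J] at 0. It is rational
    in [t], so that its second-order remainder has the closed form [cayleyE]. *)
Definition cayley (t : R) : 'M[R]_d := invmx (1%:M - t *: J) *m (1%:M + t *: J).

(** If [x = t *: (x *m J)], then [dotrv x x = 0] since [dotrv (x *m J) x = 0]. *)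
Lemma skew_unit t : 1%:M - t *: J \in unitmx.
Proof.
rewrite -row_free_unit; apply/inj_row_free => x.
rewrite mulmxBr mulmx1 -scalemxAr => /eqP; rewrite subr_eq0 => /eqP xE.
have xJ : dotrv (x *m J) x = 0.
  have : dotrv (x *m J) x = - dotrv (x *m J) x.
    by rewrite {1}dotrv_mulmx J_skew mulmxN dotrvNr dotrvC.
  by lra.
apply/eqP; apply: contraT => /dotrv_gt0.
by rewrite {1}xE dotrvZl xJ mulr0 ltxx.
Qed.

Lemma tr_skew t : (1%:M + t *: J)^T = 1%:M - t *: J.
Proof. by rewrite linearD/= trmx1 linearZ/= J_skew scalerN. Qed.

Lemma cayley_orthogonal t : cayley t *m (cayley t)^T = 1%:M.
Proof.
have tr2 : (1%:M - t *: J)^T = 1%:M + t *: J by rewrite -tr_skew trmxK.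
have comm : (1%:M + t *: J) *m (1%:M - t *: J) =
    (1%:M - t *: J) *m (1%:M + t *: J).
  by rewrite !(mulmxBr, mulmxBl, mulmxDr, mulmxDl) !mulmx1 !mul1mx;
    rewrite mulNmx; move: (_ *m _) => B; apply/matrixP => i j; rewrite !mxE; ring.
have unit2 : 1%:M + t *: J \in unitmx by rewrite -unitmx_tr tr_skew skew_unit.
rewrite /cayley trmx_mul trmx_inv tr2 tr_skew mulmxA -(mulmxA (invmx _)) comm.
by rewrite mulmxA mulVmx ?skew_unit// mul1mx mulmxV.
Qed.

Lemma cayley_det t : \det (cayley t) = 1.
Proof.
rewrite /cayley det_mulmx det_inv -(det_tr (1%:M + t *: J)) tr_skew mulVf//.
by have := skew_unit t; rewrite unitmxE unitfE.
Qed.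

Lemma orthogonal_entry_le1 (g : 'M[R]_d) i j : g *m g^T = 1%:M -> `|g i j| <= 1.
Proof.
move=> gg; have -> : g i j = (('e_i : 'rV[R]_d) *m g) 0 j by rewrite -rowE [RHS]mxE.
apply: le_trans (coord_le_enorm _ _) _.
by rewrite /enorm dotrv_orthogonal// -/(enorm _) enorm_delta.
Qed.

Lemma cayleyE t :
  cayley t = 1%:M + (2 * t) *: J + t ^+ 2 *: (J *m J *m (1%:M + cayley t)).
Proof.
set g := cayley t.
have h : g = 1%:M + t *: J + t *: (J *m g).
  have : (1%:M - t *: J) *m g = 1%:M + t *: J.
    by rewrite /g /cayley mulmxA mulmxV ?skew_unit// mul1mx.
  move=> <-; rewrite mulmxBl mul1mx -scalemxAl subrK//.
transitivity (1%:M + t *: J + t *: (J *m (1%:M + t *: J + t *: (J *m g)))).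
  by rewrite -h.
rewrite !mulmxDr !mulmx1 -!scalemxAr !mulmxA.
move: (J *m J *m g) (J *m J) => A B.
by apply/matrixP => i j; rewrite !mxE; ring.
Qed.

Lemma cayley_jet (X : Type) i j :
  jet (fun t (_ : X) => cayley t i j) (fun=> (i == j)%:R) (fun=> 2 * J i j).
Proof.
split; [exact: bounded_cst..|].
exists (\sum_l `|(J *m J) i l| * 2) => t _ t01.
rewrite {1}cayleyE !mxE.
rewrite (_ : _ - _ - _ = t ^+ 2 *
  \sum_l (J *m J) i l * (1%:M + cayley t) l j); last by rewrite /=; ring.
rewrite normrM (ger0_norm (sqr_ge0 t)) mulrC ler_wpM2r ?sqr_ge0//.
apply: le_trans (ler_norm_sum _ _ _) _; apply: ler_sum => l _.
rewrite normrM ler_wpM2l// mxE (le_trans (ler_normD _ _))//.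
rewrite -[2]/(1 + 1) lerD//; last exact/orthogonal_entry_le1/cayley_orthogonal.
by rewrite mxE; case: eqP; rewrite ?normr1 ?normr0.
Qed.

End Cayley.

Section MatrixJets.
Context {R : realType} {X : Type}.

Definition mjet {m n} (F : R -> X -> 'M[R]_(m, n)) (A B : X -> 'M[R]_(m, n)) :=
  forall i j, jet (fun t x => F t x i j) (fun x => A x i j) (fun x => B x i j).

Lemma mjet_mul m n p (F : R -> X -> 'M[R]_(m, n)) (H : R -> X -> 'M[R]_(n, p))
    A B A' B' : mjet F A B -> mjet H A' B' ->
  mjet (fun t x => F t x *m H t x) (fun x => A x *m A' x)
       (fun x => A x *m B' x + B x *m A' x).
Proof.
move=> jF jH i j.
rewrite (_ : (fun t x => _) = fun t x => \sum_l F t x i l * H t x l j); last first.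
  by apply/funext => t; apply/funext => x; rewrite mxE.
apply: (jet_eq (jet_sum (index_enum _) (fun l => jetM (jF i l) (jH l j)))) => x.
  by rewrite mxE.
by rewrite !mxE -big_split.
Qed.

Lemma mjet_tr m n (F : R -> X -> 'M[R]_(m, n)) A B : mjet F A B ->
  mjet (fun t x => (F t x)^T) (fun x => (A x)^T) (fun x => (B x)^T).
Proof.
move=> jF i j.
rewrite (_ : (fun t x => _) = fun t x => F t x j i); last first.
  by apply/funext => t; apply/funext => x; rewrite mxE.
by apply: (jet_eq (jF j i)) => x; rewrite mxE.
Qed.

Lemma mjet_cst m n (A : X -> 'M[R]_(m, n)) :
  (forall i j, bounded (fun x => A x i j)) -> mjet (fun=> A) A (fun=> 0).
Proof. by move=> bA i j; apply: (jet_eq (jet_cst (bA i j))) => // x; rewrite mxE. Qed.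

End MatrixJets.

Section Stein.
Context {R : realType} {d k : nat} {kd : (k <= d)%N}.
Local Notation G := (grassmannian R kd).
Variable sigma : probability G R.
Hypothesis inv : rotation_invariant sigma.
Local Notation E := (expect sigma).

(** A function of [t] that is constant has a vanishing first-order term. *)
Lemma expect_jet_eq0 (F : R -> G -> R) (a b : G -> R) :
  jet F a b -> (forall t, 0 <= t <= 1 -> bmf (F t)) -> bmf a -> bmf b ->
  (forall t, 0 <= t <= 1 -> E (F t) = E a) -> E b = 0.
Proof.
move=> [_ _ [C FC]] bF ba bb Ec; apply: (@le_sqr_eq0 _ _ C) => t t01.
have bF' := bF t t01.
have bD : bmf (fun xi => F t xi - a xi - t * b xi).
  by apply: bmfB; [exact: bmfB|exact: bmfZ].
have -> : t * E b = - E (fun xi => F t xi - a xi - t * b xi).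
  rewrite expectB ?expectB ?expectZ ?Ec ?subrr ?sub0r ?opprK//.
    exact: bmfB.
  exact: bmfZ.
by rewrite normrN; apply: expect_norm_le => // xi; exact: FC.
Qed.

Variable x : 'rV[R]_d.
Let X := dotrv x x.
Let p (xi : G) := x *m proj_matrix xi.
Let Y (xi : G) := dotrv (p xi) x.

Lemma bmf_proj_coord i : bmf (fun xi => p xi 0 i).
Proof.
under eq_fun do rewrite mxE.
by apply: bmf_sum => j; apply: bmfZ; exact: bmf_proj_matrix.
Qed.

Lemma bmf_proj_form : bmf Y.
Proof. by apply: bmf_sum => i; apply: (bmfM (bmf_proj_coord i) (bmf_cst _ _)). Qed.

Lemma proj_form_ge0 xi : 0 <= Y xi.
Proof. by rewrite /Y dotrvC /p proj_matrixE dotrv_oproj_self sqr_ge0. Qed.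

Lemma dotrv_proj_self xi : dotrv (p xi) (p xi) = Y xi.
Proof. by rewrite /Y /p proj_matrixE -enorm_sqr -dotrv_oproj_self dotrvC. Qed.

(** The infinitesimal rotation in the plane spanned by [x] and ['e_i]. *)
Definition plane_generator (i : 'I_d) : 'M[R]_d :=
  x^T *m ('e_i : 'rV[R]_d) - ('e_i : 'rV[R]_d)^T *m x.

Lemma plane_generator_skew i : (plane_generator i)^T = - plane_generator i.
Proof. by rewrite /plane_generator linearB/= !trmx_mul !trmxK opprB. Qed.

Lemma mul_plane_generator (r : 'rV[R]_d) i :
  r *m plane_generator i = dotrv r x *: 'e_i - r 0 i *: x.
Proof.
rewrite /plane_generator mulmxBr !mulmxA.
rewrite [r *m x^T]mx11_scalar [r *m ('e_i)^T]mx11_scalar !mul_scalar_mx.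
by rewrite -(dotrvE r x) -(dotrvE r 'e_i) dotrv_delta.
Qed.

(** The mean of [(p xi)_i * isq (S * Y xi) ^+ n] does not change under the
    rotations generated by [plane_generator i], so that its derivative along
    them has mean 0. Summed over [i], these derivatives give the identity; the
    traces of the identity matrix and of the projection contribute [d] and [k]. *)
Lemma stein (S : R) (n : nat) : 0 <= S ->
  E (fun xi => (d%:R * Y xi - k%:R * X) * isq (S * Y xi) ^+ n
    - n%:R * S * (Y xi ^+ 2 - X * Y xi) * isq (S * Y xi) ^+ n.+2) = 0.
Proof.
move=> S0.
have bu : bmf (fun xi => isq (S * Y xi)).
  apply: (@bmf_isq _ _ _ (fun xi => S * Y xi)); first exact: (bmfZ _ bmf_proj_form).1.
  by move=> xi; rewrite mulr_ge0// proj_form_ge0.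
(* [q i] is the derivative of [p], and [b i] that of the [i]-th function. *)
pose q i xi : 'rV[R]_d := 2 *: ((Y xi *: 'e_i - p xi 0 i *: x) -
  (X *: row i (proj_matrix xi) - x 0 i *: p xi)).
pose b i xi := p xi 0 i * (n%:R * isq (S * Y xi) ^+ n.-1 *
   (- 2^-1 * isq (S * Y xi) ^+ 3 * (S * dotrv (q i xi) x))) +
   q i xi 0 i * isq (S * Y xi) ^+ n.
have qE i l xi : q i xi 0 l = 2 * ((Y xi * (i == l)%:R - p xi 0 i * x 0 l)
    - (X * proj_matrix xi i l - x 0 i * p xi 0 l)).
  by rewrite !mxE eqxx/= eq_sym.
have bq i l : bmf (fun xi => q i xi 0 l).
  under eq_fun do rewrite qE.
  apply: bmfZ; apply: bmfB; apply: bmfB.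
  - exact: (bmfM bmf_proj_form (bmf_cst _ _)).
  - exact: (bmfM (bmf_proj_coord i) (bmf_cst _ _)).
  - exact/bmfZ/bmf_proj_matrix.
  - exact/bmfZ/bmf_proj_coord.
have bb i : bmf (b i).
  apply: bmfD; last by apply: bmfM => //; exact: bmfX.
  apply: (bmfM (bmf_proj_coord i)); apply: bmfM; first exact/bmfZ/bmfX.
  apply: bmfM; first exact/bmfZ/bmfX.
  apply: bmfZ; apply: bmf_sum => l; exact: (bmfM (bq i l) (bmf_cst _ _)).
have Eb i : E (b i) = 0.
  have skew := plane_generator_skew i; set J := plane_generator i in skew.
  pose g t := cayley J t.
  have gg t : g t *m (g t)^T = 1%:M by exact: cayley_orthogonal.
  pose f xi := p xi 0 i * isq (S * Y xi) ^+ n.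
  have bf : bmf f by apply: (bmfM (bmf_proj_coord i)); exact: bmfX.
  pose F t : G -> R := f \o Grotate (gg t).
  have EF t : bmf (F t) /\ E (F t) = E f.
    by apply: expect_rotate => //; exact: cayley_det.
  apply: (@expect_jet_eq0 F f); [|by move=> t _; case: (EF t)|exact: bf|exact: bb|
    by move=> t _; case: (EF t)].
  pose P (xi : G) := proj_matrix xi.
  have jg : mjet (fun t (_ : G) => g t) (fun=> 1%:M) (fun=> 2 *: J).
    move=> a c; apply: (jet_eq (cayley_jet skew G a c)) => xi; first by rewrite mxE.
    by rewrite [RHS]mxE.
  have jP0 : mjet (fun=> P) P (fun=> 0).
    by apply: mjet_cst => a c; exists 1 => xi; exact: proj_matrix_le1.
  have jx : mjet (fun=> fun=> x) (fun _ : G => x) (fun=> 0).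
    by apply: mjet_cst => a c; exact: bounded_cst.
  have jz : mjet (fun t xi => p (Grotate (gg t) xi)) p (q i).
    have := mjet_mul jx (mjet_mul (mjet_mul (mjet_tr jg) jP0) jg).
    move=> jz a c; have := jz a c.
    rewrite (_ : (fun t x0 => _) = fun t xi => p (Grotate (gg t) xi) a c).
      move=> /jet_eq; apply=> xi; rewrite trmx1 mul1mx mulmx1//.
      rewrite mul0mx addr0 mulmx0 add0r -scalemxAr [(2 *: J)^T]linearZ/= skew; congr (fun_of_matrix _ a c).
      rewrite mulmxDr -scalemxAl -!scalemxAr mulNmx mulmxN scalerN -scalerBr.
      rewrite !mulmxA -/(p xi) !mul_plane_generator mulmxBl -!scalemxAl -rowE.
      by [].
    apply/funext => t; apply/funext => xi.
    by rewrite /p proj_matrix_rotate.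
  have jy : jet (fun t xi => Y (Grotate (gg t) xi)) Y (fun xi => dotrv (q i xi) x).
    apply: (jet_eq (jet_sum (index_enum 'I_d)
      (fun l => jetM (jz 0 l) (jet_cst (bounded_cst (x 0 l)))))) => // xi.
    by apply: eq_bigr => l _; rewrite mulr0 add0r.
  have ju := jet_isq (jetZ S jy)
    (fun t xi _ => mulr_ge0 S0 (proj_form_ge0 _)) (fun xi => mulr_ge0 S0 (proj_form_ge0 _)).
  have := jetM (jz 0 i) (jetX n ju).
  by move=> /jet_eq; apply.
have : E (fun xi => \sum_i b i xi) = 0.
  by rewrite expect_sum// big1.
have sumb xi : \sum_i b i xi = 2 * ((d%:R * Y xi - k%:R * X) * isq (S * Y xi) ^+ n
    - n%:R * S * (Y xi ^+ 2 - X * Y xi) * isq (S * Y xi) ^+ n.+2).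
  set u := isq _.
  have rowp i : dotrv (row i (proj_matrix xi)) x = p xi 0 i.
    by rewrite rowE dotrv_mulmx proj_matrix_sym dotrvC dotrv_delta.
  have qx i : dotrv (q i xi) x = 4 * (Y xi * x 0 i - X * p xi 0 i).
    rewrite /q dotrvZl dotrvDl dotrvNl !dotrvDl !dotrvNl !dotrvZl rowp -/X.
    by rewrite -[dotrv (p xi) x]/(Y xi) (dotrvC 'e_i) dotrv_delta; ring.
  have qi i : q i xi 0 i = 2 * (Y xi - X * proj_matrix xi i i).
    by rewrite qE eqxx mulr1; ring.
  have un : n%:R * u ^+ n.-1 * u ^+ 3 = n%:R * u ^+ n.+2.
    case: (n) => [|m]; first by rewrite !mul0r.
    by rewrite -mulrA -exprD addn3.
  rewrite (eq_bigr (fun i => (- 2 * n%:R * u ^+ n.+2 * S * Y xi) * (p xi 0 i * x 0 i)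
     + (2 * n%:R * u ^+ n.+2 * S * X) * (p xi 0 i * p xi 0 i)
     + (2 * u ^+ n * Y xi) * 1 - (2 * u ^+ n * X) * proj_matrix xi i i)); last first.
    move=> i _; rewrite /b qx qi -/u.
    rewrite (_ : p xi 0 i * _ = (n%:R * u ^+ n.-1 * u ^+ 3) *
      (- 2 * S * p xi 0 i * (Y xi * x 0 i - X * p xi 0 i))); last by field.
    by rewrite un; ring.
  rewrite !big_split/= sumrN -!mulr_sumr -/(dotrv (p xi) x) -/(dotrv (p xi) (p xi)).
  rewrite dotrv_proj_self -/(Y xi) -/(\tr (proj_matrix xi)) proj_matrix_trace sumr_const card_ord.
  by ring.
under eq_fun do rewrite sumb.
rewrite expectZ; first by move=> /eqP; rewrite mulf_eq0 pnatr_eq0 /= => /eqP.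
apply: bmfB.
  apply: bmfM (bmfX _ bu); apply: bmfB; [exact/bmfZ/bmf_proj_form|exact: bmf_cst].
apply: bmfM (bmfX _ bu); apply: bmfZ; apply: bmfB; first exact/bmfX/bmf_proj_form.
exact/bmfZ/bmf_proj_form.
Qed.

End Stein.

(** * Radial kernels as averages of ridge functions *)

Section Rderiv.
Context {R : realType}.
Implicit Types (f g : R -> R).

(** A remainder that is quadratic uniformly in [S] passes through expectations and
    can be added up over many small steps. *)
Definition rderiv f f' := exists C, forall S t,
  0 <= S -> 0 <= t <= 1 -> `|f (S + t) - f S - t * f' S| <= C * t ^+ 2.

Lemma rderivD f f' g g' : rderiv f f' -> rderiv g g' ->
  rderiv (fun S => f S + g S) (fun S => f' S + g' S).
Proof.
move=> [C fC] [D gD]; exists (C + D) => S t S0 t01; rewrite mulrDl.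
rewrite (_ : _ - _ - _ = (f (S + t) - f S - t * f' S) +
  (g (S + t) - g S - t * g' S)); last by ring.
exact: le_trans (ler_normD _ _) (lerD (fC _ _ S0 t01) (gD _ _ S0 t01)).
Qed.

Lemma rderivZ c f f' : rderiv f f' -> rderiv (fun S => c * f S) (fun S => c * f' S).
Proof.
move=> [C fC]; exists (`|c| * C) => S t S0 t01.
rewrite (_ : _ - _ - _ = c * (f (S + t) - f S - t * f' S)); last by ring.
by rewrite normrM -mulrA ler_wpM2l// fC.
Qed.

Lemma rderiv_sum (I : Type) (s : seq I) (f f' : I -> R -> R) :
  (forall i, rderiv (f i) (f' i)) ->
  rderiv (fun S => \sum_(i <- s) f i S) (fun S => \sum_(i <- s) f' i S).
Proof.
move=> fd; elim: s => [|i s IH].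
  exists 0 => S t _ _; rewrite !big_nil mulr0 !subr0 normr0 mul0r//.
rewrite (_ : (fun S => _) = fun S => f i S + \sum_(j <- s) f j S); last first.
  by apply/funext => S; rewrite big_cons.
rewrite (_ : (fun S => \sum_(_ <- _) _) = fun S => f' i S + \sum_(j <- s) f' j S); last first.
  by apply/funext => S; rewrite big_cons.
exact: rderivD.
Qed.

Lemma rderiv_unique f f' g' : rderiv f f' -> rderiv f g' ->
  forall S, 0 <= S -> f' S = g' S.
Proof.
move=> [C fC] [D fD] S S0; apply/eqP; rewrite -subr_eq0; apply/eqP.
apply: (@le_sqr_eq0 _ _ (D + C)) => t t01.
rewrite (_ : t * _ = (f (S + t) - f S - t * g' S) - (f (S + t) - f S - t * f' S)); last by ring.
rewrite mulrDl.
exact: le_trans (ler_normB _ _) (lerD (fD _ _ S0 t01) (fC _ _ S0 t01)).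
Qed.

Lemma eq_rderiv f g f' : (forall S, 0 <= S -> f S = g S) ->
  rderiv f f' -> rderiv g f'.
Proof.
move=> fg [C fC]; exists C => S t S0 /[dup] t01 /andP[t0 _].
by rewrite -!fg ?addr_ge0//; exact: fC.
Qed.

(** Over [N] steps of length [s / N] the increments add up to [O(1 / N)]. *)
Lemma constant_of_quadratic f (s C : R) : 0 <= s ->
  (forall S t, 0 <= S -> 0 <= t <= 1 -> S + t <= s ->
     `|f (S + t) - f S| <= C * t ^+ 2) -> f s = f 0.
Proof.
move=> s0 fC; apply/eqP; rewrite -subr_eq0 -normr_eq0; apply/eqP/le_anti.
rewrite normr_ge0 andbT; apply/ler_addgt0Pr => e e0; rewrite add0r.
pose N := (Num.truncn (s + `|C| * s ^+ 2 / e)).+1.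
have e1 : 0 <= `|C| * s ^+ 2 / e by rewrite divr_ge0 ?mulr_ge0 ?sqr_ge0// ltW.
have NgtS : s + `|C| * s ^+ 2 / e < N%:R by apply: truncnS_gt.
have N0 : 0 < N%:R :> R by [].
pose t := s / N%:R.
have t01 : 0 <= t <= 1.
  rewrite divr_ge0 ?(ltW N0)//= ler_pdivrMr// mul1r.
  by apply: ltW; apply: le_lt_trans NgtS; rewrite lerDl.
have step n : (n <= N)%N -> `|f (n%:R * t) - f 0| <= n%:R * (`|C| * t ^+ 2).
  elim: n => [|n IH] nN; first by rewrite !mul0r subrr normr0.
  have {}IH := IH (ltnW nN).
  rewrite (_ : _ - _ = (f (n%:R * t + t) - f (n%:R * t)) + (f (n%:R * t) - f 0)); last first.
    by rewrite -[n.+1]addn1 natrD mulrDl mul1r; ring.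
  rewrite -[n.+1]add1n natrD mulrDl mul1r.
  apply: le_trans (ler_normD _ _) (lerD _ IH).
  have /andP[t0 _] := t01.
  apply: le_trans (fC _ _ _ t01 _) _; first by rewrite mulr_ge0.
    rewrite -[X in _ + X]mul1r -mulrDl natr1 /t mulrCA ler_piMr//.
    by rewrite ler_pdivrMr// mul1r ler_nat.
  by rewrite ler_wpM2r ?sqr_ge0// ler_norm.
have := step N (leqnn N); rewrite /t mulrC divfK ?gt_eqF// => /le_trans; apply.
rewrite (_ : _ * _ = `|C| * s ^+ 2 / N%:R); last by field; rewrite gt_eqF.
rewrite ler_pdivrMr// -ler_pdivrMl// mulrC.
by apply: ltW; apply: le_lt_trans NgtS; rewrite lerDr.
Qed.

End Rderiv.

Section BaseExponent.
Context {R : realType} {d k : nat} {kd : (k <= d)%N}.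
Local Notation G := (grassmannian R kd).
Variable sigma : probability G R.
Hypothesis inv : rotation_invariant sigma.
Local Notation E := (expect sigma).
Variable x : 'rV[R]_d.
Let X := dotrv x x.
Let Y (xi : G) := dotrv (x *m proj_matrix xi) x.
Let u S xi := isq (S * Y xi).
Let A n S := E (fun xi => u S xi ^+ n).
Let w S := isq (S * X).
Let X0 : 0 <= X. Proof. exact: dotrv_ge0. Qed.
Let Y0 xi : 0 <= Y xi. Proof. exact: proj_form_ge0. Qed.
Let bY : bmf Y. Proof. exact: bmf_proj_form. Qed.

Let bu S : 0 <= S -> bmf (u S).
Proof.
by move=> S0; apply: bmf_isq => [|xi]; [exact: (bmfZ _ bY).1|rewrite mulr_ge0].
Qed.

Let u_sqr S xi : 0 <= S -> u S xi ^+ 2 * (1 + S * Y xi) = 1.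
Proof. by move=> S0; rewrite isq_sqrM// mulr_ge0. Qed.

Let w_sqr S : 0 <= S -> w S ^+ 2 * (1 + S * X) = 1.
Proof. by move=> S0; rewrite isq_sqrM// mulr_ge0. Qed.

(** The scale is the second component of the point at which the jet is taken, so
    that the remainder is uniform in it; its absolute value keeps the argument of
    [isq] nonnegative for all points. *)
Lemma jet_isq_scaled (Z : Type) (y : Z -> R) (n : nat) : bounded y ->
  (forall z, 0 <= y z) ->
  jet (fun t (p : Z * R) => isq ((`|p.2| + t) * y p.1) ^+ n)
      (fun p => isq (`|p.2| * y p.1) ^+ n)
      (fun p => - (n%:R / 2) * (y p.1 * isq (`|p.2| * y p.1) ^+ n.+2)).
Proof.
move=> [M yM] y0.
have i1 (p : Z * R) : `|isq (`|p.2| * y p.1)| <= 1.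
  by rewrite ger0_norm ?isq_le1 ?mulr_ge0// ltW// isq_gt0// mulr_ge0.
have j1 : jet (fun t (p : Z * R) => isq ((`|p.2| + t) * y p.1))
    (fun p => isq (`|p.2| * y p.1))
    (fun p => - 2^-1 * isq (`|p.2| * y p.1) ^+ 3 * y p.1).
  have bi : bounded (fun p : Z * R => isq (`|p.2| * y p.1)) by exists 1.
  split=> //.
    apply: boundedM; last by exists M => p; exact: yM.
    by apply: boundedM; [exact: bounded_cst|exact: boundedX].
  exists (M ^+ 2) => t p /andP[t0 t1].
  have := @isq_taylor R (`|p.2| * y p.1) ((`|p.2| + t) * y p.1).
  rewrite !mulr_ge0// ?addr_ge0// => /(_ isT isT).
  rewrite (_ : (_ + t) * _ - _ = t * y p.1); last by ring.
  rewrite (_ : _ - _ + _ = isq ((`|p.2| + t) * y p.1) - isq (`|p.2| * y p.1) -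
    t * (- 2^-1 * isq (`|p.2| * y p.1) ^+ 3 * y p.1)); last by ring.
  move=> /le_trans; apply; rewrite exprMn mulrC ler_wpM2r ?sqr_ge0//.
  rewrite -[y _ ^+ 2]ger0_norm ?sqr_ge0// normrX ler_pXn2r ?nnegrE//.
  exact: le_trans (yM p.1).
apply: (jet_eq (jetX n j1)) => // p.
have -> : n%:R * isq (`|p.2| * y p.1) ^+ n.-1 *
    (- 2^-1 * isq (`|p.2| * y p.1) ^+ 3 * y p.1) =
    - (n%:R * (isq (`|p.2| * y p.1) ^+ n.-1 * isq (`|p.2| * y p.1) ^+ 3)) / 2 * y p.1.
  by field.
case: n => [|n]; first by rewrite !mul0r oppr0 !mul0r.
by rewrite -exprD addn3; field.
Qed.

Lemma rderiv_expect_isq n : rderiv (A n)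
  (fun S => - (n%:R / 2) * E (fun xi => Y xi * u S xi ^+ n.+2)).
Proof.
have bdY : bounded Y by have [_] := bY.
have [_ _ [C jC]] := jet_isq_scaled n bdY Y0.
exists C => S t S0 /[dup] t01 /andP[t0 _].
have St : 0 <= S + t by rewrite addr_ge0.
have b2 : bmf (fun xi => Y xi * u S xi ^+ n.+2).
  by apply: bmfM => //; apply: bmfX; exact: bu.
have bn S' : 0 <= S' -> bmf (fun xi => u S' xi ^+ n).
  by move=> S'0; apply: bmfX; exact: bu.
rewrite /A -expectZ// -expectZ; last exact: bmfZ.
rewrite -expectB; [|exact: bn..].
rewrite -expectB; [|apply: bmfB; exact: bn|exact/bmfZ/bmfZ].
apply: expect_norm_le.
  by apply: bmfB; [apply: bmfB; exact: bn|exact/bmfZ/bmfZ].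
by move=> xi; have := jC t (xi, S) t01; rewrite /= (ger0_norm S0).
Qed.

Lemma rderiv_isq n : rderiv (fun S => w S ^+ n)
  (fun S => - (n%:R / 2) * (X * w S ^+ n.+2)).
Proof.
have bX : bounded (fun _ : unit => X) by exact: bounded_cst.
have [_ _ [C jC]] := jet_isq_scaled n bX (fun=> X0).
exists C => S t S0 t01.
by have := jC t (tt, S) t01; rewrite /= (ger0_norm S0).
Qed.

(** For the exponent [d] the terms in [Y^2] of [stein] cancel, and the identity
    expresses the derivative of [A d] in terms of [A d] itself. *)
Lemma stein_at_d S : 0 <= S ->
  d%:R * (1 + S * X) * E (fun xi => Y xi * u S xi ^+ d.+2) = k%:R * X * A d S.
Proof.
move=> S0; have := stein inv x d S0.
rewrite -/X (_ : (fun xi => _) = fun xi =>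
  d%:R * (1 + S * X) * (Y xi * u S xi ^+ d.+2) - k%:R * X * u S xi ^+ d).
  have b2 : bmf (fun xi => Y xi * u S xi ^+ d.+2).
    by apply: bmfM => //; apply: bmfX; exact: bu.
  have bd : bmf (fun xi => u S xi ^+ d) by apply: bmfX; exact: bu.
  rewrite expectB; [|exact: bmfZ..].
  by rewrite !expectZ// => /eqP; rewrite subr_eq0 => /eqP.
apply/funext => xi; rewrite -/(Y xi) -/(u S xi).
rewrite -(addn2 d) exprD; have := u_sqr xi S0.
move: (u S xi ^+ 2) (u S xi ^+ d) (Y xi) => a b y ay.
rewrite [X in X - _](_ : _ = (d%:R * y - k%:R * X) * b * (a * (1 + S * y))); last first.
  by rewrite ay mulr1.
rewrite [X in _ = _ - X](_ : _ = k%:R * X * b * (a * (1 + S * y))); last first.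
  by rewrite ay mulr1.
by ring.
Qed.

Hypothesis d_gt0 : (0 < d)%N.

(** By [stein_at_d] both sides solve [f' = - (k / 2) * X / (1 + s * X) * f] and
    equal 1 at 0; the quotient of the two has increments of second order, hence
    is constant. *)
Lemma expect_isq_d s : 0 <= s -> A d s = w s ^+ k.
Proof.
move=> s0.
have w0 S : 0 <= S -> 0 < w S by move=> S0; rewrite isq_gt0// mulr_ge0.
have w1 S : 0 <= S -> w S <= 1 by move=> S0; rewrite isq_le1// mulr_ge0.
pose f S := A d S / w S ^+ k.
have A1 S : 0 <= S -> `|A d S| <= 1.
  move=> S0; apply: expect_norm_le; first by apply: bmfX; exact: bu.
  move=> xi; have v0 : 0 <= u S xi by rewrite ltW// isq_gt0// mulr_ge0.
  rewrite ger0_norm ?exprn_ge0// expr_le1// isq_le1// mulr_ge0//.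
have w_inv S : 0 <= S -> S <= s -> (w S)^-1 <= 1 + s * X.
  move=> S0 Ss; rewrite /w /isq invrK.
  have sX : 1 <= 1 + s * X by rewrite lerDl mulr_ge0.
  apply: (@le_trans _ _ (Num.sqrt ((1 + s * X) ^+ 2))).
    rewrite ler_wsqrtr// expr2.
    apply: (@le_trans _ _ (1 + s * X)); first by rewrite lerD2l ler_wpM2r.
    by rewrite ler_peMr//; lra.
  by rewrite sqrtr_sqr ger0_norm//; lra.
have fs : f s = f 0.
  have [C AC] := rderiv_expect_isq d; have [D wD] := rderiv_isq k.
  apply: (@constant_of_quadratic _ f s ((C + D) * ((1 + s * X) ^+ k * (1 + s * X) ^+ k))) => //.
  move=> S t S0 /[dup] t01 /andP[t0 _] Sts.
  have St0 : 0 <= S + t by rewrite addr_ge0.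
  have wS := w0 S S0; have wSt := w0 _ St0.
  have -> : f (S + t) - f S = (A d (S + t) * w S ^+ k - A d S * w (S + t) ^+ k)
      * ((w S)^-1 ^+ k * (w (S + t))^-1 ^+ k).
    have a0 : w S ^+ k != 0 by rewrite expf_neq0// gt_eqF.
    have b0 : w (S + t) ^+ k != 0 by rewrite expf_neq0// gt_eqF.
    rewrite /f (exprVn (w S)) (exprVn (w (S + t))); move: (w S ^+ k) (w (S + t) ^+ k) a0 b0 => a b a0 b0.
    by field; rewrite a0 b0.
  have -> : A d (S + t) * w S ^+ k - A d S * w (S + t) ^+ k =
      (A d (S + t) - A d S - t * (- (d%:R / 2) * E (fun xi => Y xi * u S xi ^+ d.+2)))
        * w S ^+ k
      - A d S * (w (S + t) ^+ k - w S ^+ k - t * (- (k%:R / 2) * (X * w S ^+ k.+2))).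
    have st := stein_at_d S0.
    have dE : d%:R * E (fun xi => Y xi * u S xi ^+ d.+2) = k%:R * X * A d S * w S ^+ 2.
      rewrite -st; have := w_sqr S0; move: (E _) (w S ^+ 2) => e v vS.
      transitivity (d%:R * e * (v * (1 + S * X))); first by rewrite vS mulr1.
      by ring.
    rewrite -(addn2 k) exprD.
    have -> : t * (- (d%:R / 2) * E (fun xi => Y xi * u S xi ^+ d.+2)) =
      - t / 2 * (d%:R * E (fun xi => Y xi * u S xi ^+ d.+2)) by ring.
    by rewrite dE; ring.
  rewrite normrM [leRHS]mulrAC; apply: ler_pM => //.
    rewrite [leRHS]mulrDl; apply: le_trans (ler_normB _ _) (lerD _ _).
      apply: le_trans (AC S t S0 t01); rewrite normrM ler_piMr//.
      have w0' := ltW wS.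
      by rewrite ger0_norm ?exprn_ge0// exprn_ile1// w1.
    by apply: le_trans (wD S t S0 t01); rewrite normrM ler_piMl// A1.
  rewrite ger0_norm; last first.
    by rewrite mulr_ge0// exprn_ge0// invr_ge0 ltW.
  have Ss : S <= s by apply: le_trans Sts; rewrite lerDl.
  have winv0 S' : 0 <= S' -> 0 <= (w S')^-1 by move=> S'0; rewrite invr_ge0 ltW// w0.
  have sX0 : 0 <= 1 + s * X by rewrite addr_ge0// mulr_ge0.
  by apply: ler_pM; rewrite ?exprn_ge0 ?winv0//; apply: lerXn2r;
    rewrite ?nnegrE ?winv0 ?w_inv.
have f0 : f 0 = 1.
  rewrite /f /w mul0r /isq addr0 sqrtr1 invr1 expr1n divr1 /A.
  under eq_fun do rewrite /u mul0r /isq addr0 sqrtr1 invr1 expr1n.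
  exact: expect_cst.
have : A d s / w s ^+ k = 1 by rewrite -f0 -fs.
by move/(canRL (divfK _)) => ->; rewrite ?mul1r// expf_neq0// gt_eqF// w0.
Qed.

End BaseExponent.

(** With [u = isq (S * y)], the operator [S * d/dS] sends [u^n] to
    [(n / 2) * (u^(n + 2) - u^n)]. Applied to both sides of an identity with
    right-hand exponent [k + 2 * m] it yields one with exponent [k + 2 * m + 2];
    the recursion records its effect on the coefficients. *)
Fixpoint ridge_coef (R : realType) (d k m : nat) : nat -> R :=
  if m is m'.+1 then fun j =>
    ridge_coef R d k m' j * (1 - (d + 2 * j)%:R / (k + 2 * m')%:R) +
    (if j is j'.+1 then ridge_coef R d k m' j' * (d + 2 * j')%:R / (k + 2 * m')%:R
     else 0)
  else fun j => (j == 0%N)%:R.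

Lemma ridge_coef_gt (R : realType) d k m j : (m < j)%N -> ridge_coef R d k m j = 0.
Proof.
elim: m j => [|m IH] [|j]//= mj.
by rewrite !IH ?mul0r ?addr0// (ltn_trans (ltnSn m)).
Qed.

Section RaisedExponents.
Context {R : realType} {d k : nat} {kd : (k <= d)%N}.
Local Notation G := (grassmannian R kd).
Variable sigma : probability G R.
Hypothesis inv : rotation_invariant sigma.
Local Notation E := (expect sigma).
Hypothesis (k_gt0 : (0 < k)%N).
Local Notation coef := (ridge_coef R d k).

(** The scale [S] is the variable in which the identity is differentiated. *)
Lemma ridge_identity_scaled (x : 'rV[R]_d) m S : 0 <= S ->
  \sum_(j < m.+1) coef m j *
    E (fun xi => isq (S * dotrv (x *m proj_matrix xi) x) ^+ (d + 2 * j)) =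
  isq (S * dotrv x x) ^+ (k + 2 * m).
Proof.
have d_gt0 : (0 < d)%N by exact: leq_trans k_gt0 kd.
pose A n S := E (fun xi => isq (S * dotrv (x *m proj_matrix xi) x) ^+ n).
pose w S := isq (S * dotrv x x).
elim: m S => [|m IH] S S0.
  by rewrite big_ord_recl big_ord0 /= mul1r addr0 muln0 !addn0 expect_isq_d.
set q := (k + 2 * m)%:R : R.
have q0 : q != 0 by rewrite pnatr_eq0 -lt0n addn_gt0 k_gt0.
have der1 := rderiv_sum (index_enum 'I_m.+1)
  (fun j : 'I_m.+1 => rderivZ (coef m j) (rderiv_expect_isq sigma x (d + 2 * j))).
have der2 := eq_rderiv IH der1.
have E1 := rderiv_unique der2 (rderiv_isq x (k + 2 * m)) S0.
have E2 : q * (w S ^+ (k + 2 * m) - w S ^+ (k + 2 * m).+2) =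
    \sum_(j < m.+1) coef m j * ((d + 2 * j)%:R * (A (d + 2 * j)%N S - A (d + 2 * j).+2 S)).
  have SY (xi : G) : 0 <= S * dotrv (x *m proj_matrix xi) x.
    by rewrite mulr_ge0// proj_form_ge0.
  have bu : bmf (fun xi : G => isq (S * dotrv (x *m proj_matrix xi) x)).
    by apply: (@bmf_isq _ _ _ (fun xi : G => S * dotrv (x *m proj_matrix xi) x)) => //;
      exact: (bmfZ _ (bmf_proj_form x)).1.
  have SA n : A n S - A n.+2 S =
      S * E (fun xi => dotrv (x *m proj_matrix xi) x *
        isq (S * dotrv (x *m proj_matrix xi) x) ^+ n.+2).
    rewrite -expectZ; last by apply: bmfM (bmfX _ bu); exact: bmf_proj_form.
    rewrite /A -expectB; [|exact: bmfX..]; congr expect; apply/funext => xi.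
    rewrite -(addn2 n) exprD; have := isq_sqrM (SY xi).
    move: (dotrv _ x) => y; move: (isq _) => v vy.
    by rewrite -{1}[v ^+ n]mulr1 -vy; ring.
  have Sw n : w S ^+ n - w S ^+ n.+2 = S * (dotrv x x * w S ^+ n.+2).
    rewrite -(addn2 n) exprD; have := isq_sqrM (mulr_ge0 S0 (dotrv_ge0 x)).
    rewrite /w; move: (dotrv x x) => y; move: (isq _) => v vy.
    by rewrite -{1}[v ^+ n]mulr1 -vy; ring.
  rewrite Sw; under eq_bigr do rewrite SA.
  have -> : q * (S * (dotrv x x * w S ^+ (k + 2 * m).+2)) =
    - 2 * S * (- (q / 2) * (dotrv x x * w S ^+ (k + 2 * m).+2)) by field.
  rewrite -E1 mulr_sumr; apply: eq_bigr => j _.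
  by field.
have wE : w S ^+ (k + 2 * m) = \sum_(j < m.+1) coef m j * A (d + 2 * j)%N S.
  by rewrite -IH.
have -> : isq (S * dotrv x x) ^+ (k + 2 * m.+1) = w S ^+ (k + 2 * m) -
    q^-1 * (q * (w S ^+ (k + 2 * m) - w S ^+ (k + 2 * m).+2)).
  by rewrite mulrA mulVf// mul1r subKr mulnS addnCA add2n.
rewrite E2 wE mulr_sumr -sumrB.
rewrite (eq_bigr (fun j : 'I_m.+2 =>
    coef m j * (1 - (d + 2 * j)%:R / q) * A (d + 2 * j)%N S +
    (if (j : nat) is j'.+1 then coef m j' * (d + 2 * j')%:R / q else 0)
      * A (d + 2 * j)%N S)); last first.
  by move=> j _; rewrite /= mulrDl.
rewrite big_split/= big_ord_recr/= ridge_coef_gt// !mul0r addr0.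
rewrite [X in _ + X]big_ord_recl/= mul0r add0r -big_split/=.
apply: eq_bigr => j _; rewrite /bump/= add1n mulnS addnCA add2n.
by ring.
Qed.

Definition ridge_profile m (v : R) : R :=
  \sum_(j < m.+1) coef m j * isq v ^+ (d + 2 * j).

(** Radial kernels of arbitrarily fast decay are thus averages of functions of
    the projection of [x] to a random plane, without any information on the law
    of that projection beyond invariance. *)
Lemma ridge_identity (x : 'rV[R]_d) m :
  bmf (fun xi : G => ridge_profile m (enorm (oproj (val xi) x) ^+ 2)) /\
  E (fun xi => ridge_profile m (enorm (oproj (val xi) x) ^+ 2)) =
  isq (enorm x ^+ 2) ^+ (k + 2 * m).
Proof.
have yE (xi : G) : enorm (oproj (val xi) x) ^+ 2 = dotrv (x *m proj_matrix xi) x.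
  by rewrite proj_matrixE dotrvC dotrv_oproj_self.
have bj j : bmf (fun xi : G => isq (enorm (oproj (val xi) x) ^+ 2) ^+ j).
  apply: bmfX; under eq_fun do rewrite yE.
  apply: (@bmf_isq _ _ _ (fun xi : G => dotrv (x *m proj_matrix xi) x)) => [|xi].
    exact: (bmf_proj_form x).1.
  exact: proj_form_ge0.
split; first by apply: bmf_sum => j; exact: bmfZ.
have := ridge_identity_scaled x m ler01; rewrite mul1r -enorm_sqr => <-.
rewrite expect_sum; last by move=> j; exact: bmfZ.
apply: eq_bigr => j _; rewrite expectZ//; congr (_ * expect _ _).
by apply/funext => xi; rewrite mul1r yE.
Qed.

End RaisedExponents.

(** * Lattice sums in one dimension *)

Section OneDim.
Context {R : realType}.
Variable kap : nat.
Hypothesis kap_gt0 : (0 < kap)%N.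
Implicit Types a b s t q : R.

(** On the half-line, [rootdec ^+ kap.+1] is the derivative of [- kap * rootdec],
    so that its sums along a lattice are comparable to telescoping ones. *)
Definition rootdec t : R := (1 + `|t|) `^ (- kap%:R^-1).
Local Notation rho := rootdec.

Let base_gt0 t : 0 < 1 + `|t|.
Proof. by rewrite ltr_pwDl. Qed.

Lemma rootdec_gt0 t : 0 < rho t.
Proof. exact: powR_gt0. Qed.

Lemma rootdec_ge0 t : 0 <= rho t.
Proof. exact/ltW/rootdec_gt0. Qed.

Let k0 : kap%:R != 0 :> R.
Proof. by rewrite pnatr_eq0 -lt0n. Qed.

Lemma rootdec_expn t : rho t ^+ kap = (1 + `|t|)^-1.
Proof.
rewrite -powR_mulrn ?ltW ?rootdec_gt0// /rho -powRrM mulNr mulVf//.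
by rewrite powR_inv1 ?ltW.
Qed.

Lemma rootdec_le1 t : rho t <= 1.
Proof.
have : rho t ^+ kap <= 1 by rewrite rootdec_expn invf_le1 ?base_gt0// lerDl.
by rewrite expr_le1// ltW// rootdec_gt0.
Qed.

Lemma rootdec0 : rho 0 = 1.
Proof. by rewrite /rho normr0 addr0 powR1. Qed.

Lemma rootdecN t : rho (- t) = rho t.
Proof. by rewrite /rho normrN. Qed.

Lemma rootdec_anti a b : `|a| <= `|b| -> rho b <= rho a.
Proof.
move=> ab; rewrite -(@ler_pXn2r _ kap) ?nnegrE ?rootdec_ge0//.
by rewrite !rootdec_expn lef_pV2 ?posrE// lerD2l.
Qed.

(** The mean value inequality for [rootdec], obtained from the factorisation of
    the difference of the powers [rootdec ^+ kap], which are rational. *)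
Lemma rootdec_decrement a b : 0 <= a -> a <= b ->
  (b - a) * rho b ^+ kap.+1 <= kap%:R * (rho a - rho b).
Proof.
move=> a0 ab; have b0 := le_trans a0 ab.
have := rootdec_expn a; have := rootdec_expn b.
have rab : rho b <= rho a by rewrite rootdec_anti// !ger0_norm.
have := rootdec_gt0 b; have := rootdec_gt0 a; have := rootdec_le1 a.
rewrite (ger0_norm a0) (ger0_norm b0) in rab *.
move: (rho a) (rho b) rab => p r rp p1 p0 r0 rb pa.
have pk0 : 0 < p ^+ kap by rewrite exprn_gt0.
have rk0 : 0 < r ^+ kap by rewrite exprn_gt0.
have -> : b - a = (r ^+ kap)^-1 - (p ^+ kap)^-1.
  by rewrite rb pa !invrK; ring.
have -> : ((r ^+ kap)^-1 - (p ^+ kap)^-1) * r ^+ kap.+1 =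
    (p ^+ kap - r ^+ kap) * (r / p ^+ kap).
  by rewrite exprS; field; rewrite !gt_eqF.
have step : p ^+ kap - r ^+ kap <= (p - r) * (kap%:R * p ^+ kap.-1).
  rewrite subrXX ler_wpM2l ?subr_ge0//.
  rewrite (_ : kap%:R * _ = \sum_(i < kap) p ^+ kap.-1); last first.
    by rewrite sumr_const card_ord mulr_natl.
  apply: ler_sum => i _.
  have ik : (i <= kap.-1)%N by rewrite -ltnS prednK// ltn_ord.
  rewrite -[in leRHS](subnK ik) exprD ler_wpM2l ?exprn_ge0 ?(ltW p0)//.
  by apply: lerXn2r => //; rewrite nnegrE ltW.
apply: le_trans (ler_wpM2r _ step) _; first by rewrite divr_ge0// ltW.
rewrite (_ : (p - r) * _ * _ = kap%:R * (p - r) * (r / p)); last first.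
  have -> : p ^+ kap = p * p ^+ kap.-1 by rewrite -exprS prednK.
  by field; rewrite expf_neq0 gt_eqF.
rewrite ler_piMr ?mulr_ge0 ?subr_ge0//.
by rewrite ler_pdivrMr// mul1r.
Qed.

(** A shift by at most 1 at most doubles [1 + |a|]. *)
Lemma rootdec_half a q : 0 <= q <= 1 ->
  rho a ^+ kap.+1 <= 4 * rho (`|a| + q) ^+ kap.+1.
Proof.
move=> /andP[q0 q1].
have aq0 : 0 <= `|a| + q by rewrite addr_ge0.
have ra := rootdec_gt0 a; have raq := rootdec_gt0 (`|a| + q).
have le : rho (`|a| + q) <= rho a by rewrite rootdec_anti// (ger0_norm aq0) lerDl.
have hk : rho a ^+ kap <= 2 * rho (`|a| + q) ^+ kap.
  rewrite !rootdec_expn (ger0_norm aq0) -lef_pV2 ?posrE ?invr_gt0 ?mulr_gt0 ?invr_gt0 ?ltr_pwDl//.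
  rewrite invfM !invrK; have := normr_ge0 a; lra.
have h1 : rho a <= 2 * rho (`|a| + q).
  rewrite -(@ler_pXn2r _ kap) ?nnegrE ?mulr_ge0 ?rootdec_ge0// (le_trans hk)// exprMn.
  by rewrite ler_wpM2r ?exprn_ge0 ?rootdec_ge0// ler_eXnr// ler1n.
rewrite !exprS (_ : 4 * _ = (2 * rho (`|a| + q)) * (2 * rho (`|a| + q) ^+ kap)); last by ring.
by rewrite ler_pM// ?exprn_ge0 ?rootdec_ge0.
Qed.

(** A bounded primitive of [rootdec ^+ kap.+1] on the whole line, up to the
    factor [kap]. *)
Definition potential t : R := if 0 <= t then 1 - rho t else rho t - 1.

Lemma potential_norm t : `|potential t| <= 1.
Proof.
have := rootdec_gt0 t; have := rootdec_le1 t; rewrite /potential ler_norml => h1 h2.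
by case: ifP => _; apply/andP; split; lra.
Qed.

(** The three cases are those of an interval [[s - q, s]] to the right of 0, to
    the left of 0, and around 0. In the first one the value at [s] is the smallest
    on the interval; in the others it is not, and [rootdec_half] compares the
    values of [rootdec ^+ kap.+1] at points of distance at most 1. *)
Lemma potential_increment s q : 0 < q <= 1 ->
  q * rho s ^+ kap.+1 <= 4 * kap%:R * (potential s - potential (s - q)).
Proof.
move=> /andP[q0 q1].
have kp : 0 < kap%:R :> R by rewrite ltr0n.
have phi0 t : 0 <= rho t ^+ kap.+1 by rewrite exprn_ge0// ltW// rootdec_gt0.
have phi1 t : rho t ^+ kap.+1 <= 1.
  by rewrite exprn_ile1 ?rootdec_le1// ltW// rootdec_gt0.
have key a b : 0 <= a -> a <= b -> (b - a) * rho b ^+ kap.+1 <= kap%:R * (rho a - rho b).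
  exact: rootdec_decrement.
have [sq|sq] := leP q s.
  have s0 : 0 <= s by lra.
  rewrite /potential s0 subr_ge0 sq.
  have := key (s - q) s; rewrite subr_ge0 => /(_ sq).
  rewrite gerBl => /(_ (ltW q0)); rewrite (_ : s - (s - q) = q); last by ring.
  have : 0 <= q * rho s ^+ kap.+1 by rewrite mulr_ge0// ltW.
  rewrite (_ : 4 * _ * _ = 4 * (kap%:R * (rho (s - q) - rho s))); last by ring.
  by move: (q * _) (kap%:R * _) => y z; lra.
have sq0 : (0 <= s - q) = false by rewrite subr_ge0 leNgt sq.
have [s0|s0] := leP 0 s; last first.
  have s0F : (0 <= s) = false by rewrite leNgt s0.
  rewrite /potential sq0 s0F.
  have q01 : 0 <= q <= 1 by rewrite (ltW q0).
  have := rootdec_half s q01; have := key `|s| (`|s| + q) (normr_ge0 s).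
  rewrite lerDl => /(_ (ltW q0)); rewrite addrC addKr.
  rewrite (_ : rho `|s| = rho s); last by rewrite -(rootdecN s) ltr0_norm.
  rewrite (_ : rho (`|s| + q) = rho (s - q)); last first.
    by rewrite -(rootdecN (s - q)); congr rho; rewrite ltr0_norm//; ring.
  rewrite (_ : 4 * _ * _ = 4 * (kap%:R * (rho s - rho (s - q)))); last by ring.
  move: (kap%:R * _) => y h1 h2.
  by apply: le_trans (ler_wpM2l (ltW q0) h2) _; rewrite mulrCA ler_wpM2l.
rewrite /potential s0 sq0.
have k1 := key 0 s (lexx _) s0; rewrite rootdec0 subr0 in k1.
have k2 := key 0 (q - s) (lexx _); rewrite subr_ge0 rootdec0 subr0 in k2.
have {}k2 := k2 (ltW sq).
have quarter t : 0 <= t <= 1 -> 1 <= 4 * rho t ^+ kap.+1.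
  by move=> t01; have := rootdec_half 0 t01; rewrite rootdec0 expr1n normr0 add0r.
have r1 := quarter s; have r2 := quarter (q - s).
have -> : rho (s - q) = rho (q - s) by rewrite -rootdecN opprB.
have {}r1 : 1 <= 4 * rho s ^+ kap.+1 by apply: r1; rewrite s0; lra.
have {}r2 : 1 <= 4 * rho (q - s) ^+ kap.+1 by apply: r2; lra.
apply: (@le_trans _ _ q); first by rewrite ler_piMr// ltW.
rewrite (_ : 4 * _ * _ = 4 * (kap%:R * (1 - rho s)) + 4 * (kap%:R * (1 - rho (q - s)))); last by ring.
have h1 : s <= 4 * (kap%:R * (1 - rho s)).
  apply: (@le_trans _ _ (s * (4 * rho s ^+ kap.+1))); first by rewrite ler_peMr.
  by rewrite mulrCA ler_wpM2l.
have h2 : q - s <= 4 * (kap%:R * (1 - rho (q - s))).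
  apply: (@le_trans _ _ ((q - s) * (4 * rho (q - s) ^+ kap.+1))).
    by rewrite ler_peMr// subr_ge0 ltW.
  by rewrite mulrCA ler_wpM2l.
by lra.
Qed.

(** The increments of [potential] telescope, and it takes values in [[-1, 1]]. *)
Lemma sum_rootdec (M : nat) q t : 0 < q <= 1 ->
  \sum_(n < M) rho (q * n%:R - t) ^+ kap.+1 <= 8 * kap%:R / q.
Proof.
move=> /[dup] q01 /andP[q0 q1].
pose f (n : nat) := potential (q * (n%:R - 1) - t).
apply: (@le_trans _ _ (\sum_(0 <= n < M) (4 * kap%:R / q) * (f n.+1 - f n))).
  rewrite big_mkord; apply: ler_sum => n _.
  rewrite mulrAC ler_pdivlMr// mulrC.
  have := potential_increment (q * n%:R - t) q01.
  rewrite /f (_ : n.+1%:R - 1 = n%:R); last by rewrite -natr1 addrK.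
  by rewrite (_ : q * n%:R - t - q = q * (n%:R - 1) - t) //; ring.
rewrite -mulr_sumr telescope_sumr//.
rewrite (_ : 8 * kap%:R / q = (4 * kap%:R / q) * 2); last by field; rewrite gt_eqF.
rewrite ler_wpM2l ?divr_ge0 ?mulr_ge0 ?(ltW q0)//.
have fn n : `|f n| <= 1 by exact: potential_norm.
have := fn M; have := fn 0%N; rewrite !ler_norml => /andP[a1 a2] /andP[b1 b2].
by move: (f M) (f 0%N) a1 a2 b1 b2 => a b; lra.
Qed.

End OneDim.

(** * Lattice sums over boxes and tubes *)

Section Boxes.
Context {d : nat}.
Implicit Types (N : nat) (z : 'rV[int]_d).

Definition box_point N (f : {ffun 'I_d -> 'I_(N.*2.+1)}) : 'rV[int]_d :=
  \row_i ((f i)%:Z - N%:Z).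

(** A sequence of vectors of the whole lattice, so that translates of a box can be
    formed. *)
Definition box N : seq 'rV[int]_d := [seq box_point f | f : {ffun 'I_d -> 'I_(N.*2.+1)}].

Lemma box_point_inj N : injective (@box_point N).
Proof.
move=> f g /rowP fg; apply/ffunP => i; apply/val_inj.
by have := fg i; rewrite !mxE => /addIr [].
Qed.

Lemma box_uniq N : uniq (box N).
Proof. by rewrite map_inj_uniq ?enum_uniq//; exact: box_point_inj. Qed.

Lemma mem_box N z : (forall i, (absz (z ord0 i) <= N)%N) -> z \in box N.
Proof.
move=> zN; pose f : {ffun 'I_d -> 'I_(N.*2.+1)} := [ffun i => inord (absz (z ord0 i + N%:Z))].
apply/mapP; exists f; first by rewrite mem_enum.
apply/rowP => i; rewrite mxE ffunE.
have := zN i => h.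
have h0 : 0 <= z ord0 i + N%:Z by lia.
rewrite inordK; last by lia.
by rewrite gez0_abs// addrK.
Qed.

Lemma box_coord_le N z i : z \in box N -> (absz (z ord0 i) <= N)%N.
Proof.
move=> /mapP[f _ ->]; rewrite mxE.
by have := ltn_ord (f i); move: (nat_of_ord (f i)) => n; lia.
Qed.

Lemma sum_box (R : realType) N (h : 'rV[int]_d -> R) :
  \sum_(z <- box N) h z = \sum_(f : {ffun 'I_d -> 'I_(N.*2.+1)}) h (box_point f).
Proof. by rewrite big_map big_enum. Qed.

Lemma sum_box_prod (R : realType) N (F : 'I_d -> int -> R) :
  \sum_(z <- box N) \prod_i F i (z 0 i) =
  \prod_i \sum_(n < N.*2.+1) F i (n%:Z - N%:Z).
Proof.
rewrite sum_box bigA_distr_bigA; apply: eq_bigr => f _.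
by apply: eq_bigr => i _; rewrite mxE.
Qed.

Lemma sum_uniq_supp (R : realType) (s t : seq 'rV[int]_d) (h : 'rV[int]_d -> R) :
  uniq s -> uniq t -> (forall z, h z != 0 -> z \in s) ->
  (forall z, h z != 0 -> z \in t) ->
  \sum_(z <- s) h z = \sum_(z <- t) h z.
Proof.
move=> us ut hs ht.
have nz (r : seq 'rV[int]_d) : \sum_(z <- r) h z = \sum_(z <- [seq z <- r | h z != 0]) h z.
  rewrite big_filter [RHS]big_mkcond/=; apply: eq_bigr => z _.
  by case: ifPn => // /negPn/eqP.
rewrite nz [RHS]nz; apply: perm_big; apply: uniq_perm; rewrite ?filter_uniq//.
move=> z; rewrite !mem_filter; case: (boolP (h z != 0)) => //= hz.
by rewrite hs// ht.
Qed.

End Boxes.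

Lemma sum_family (R : realType) (I J : finType) (Q : I -> pred J) (F : I -> J -> R) :
  \sum_(f : {ffun I -> J} | [forall i, Q i (f i)]) \prod_i F i (f i) =
  \prod_i \sum_(j | Q i j) F i j.
Proof.
rewrite bigA_distr_big_dep; apply: eq_bigl => f.
by apply/forallP/familyP => h i; have := h i; rewrite ?inE.
Qed.

Section Tube.
Context {R : realType} {d k : nat}.
Variables (N : nat) (f : 'I_k -> 'I_d) (q : R) (t : 'I_k -> 'rV[int]_d -> R).
Variable G : 'rV[int]_d -> R.
Hypothesis f_inj : injective f.
Hypothesis k_gt0 : (0 < k)%N.
Hypothesis q01 : 0 < q <= 1.
Hypothesis t_ext : forall i (z z' : 'rV[int]_d),
  (forall j, j \notin codom f -> z 0 j = z' 0 j) -> t i z = t i z'.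
Hypothesis G_le : forall z, G z <=
  \prod_i rootdec k (q * (z 0 (f i))%:~R - t i z) ^+ k.+1.

(** Once the coordinates outside the image of [f] are fixed, the numbers [t i]
    are fixed too, and the sum over the remaining [k] coordinates factors into
    sums to which [sum_rootdec] applies. There are [(2 * N + 1) ^ (d - k)] such
    slices. *)
Lemma tube_sum :
  \sum_(z <- box N) G z <= (N.*2.+1)%:R ^+ (d - k) * (8 * k%:R / q) ^+ k.
Proof.
rewrite sum_box.
(* The slices are the fibres of [r], which erases the coordinates in the image
   of [f]. *)
pose r (y : {ffun 'I_d -> 'I_(N.*2.+1)}) : {ffun 'I_d -> 'I_(N.*2.+1)} :=
  [ffun i => if i \in codom f then ord0 else y i].
pose Q0 (i : 'I_d) : pred 'I_(N.*2.+1) :=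
  fun n => if i \in codom f then n == ord0 else true.
rewrite (partition_big r (fun c => [forall i, Q0 i (c i)])) /=; last first.
  by move=> y _; apply/forallP => i; rewrite /Q0 ffunE; case: (i \in codom f).
set B := (8 * k%:R / q).
have inner c : \sum_(y | r y == c) G (box_point y) <= B ^+ k.
  pose H (j : 'I_d) (n : 'I_(N.*2.+1)) : R := \prod_(i < k | f i == j)
    rootdec k (q * (n%:Z - N%:Z)%:~R - t i (box_point c)) ^+ k.+1.
  have H0 j n : 0 <= H j n.
    by apply: prodr_ge0 => i _; rewrite exprn_ge0 ?rootdec_ge0.
  pose Q (j : 'I_d) : pred 'I_(N.*2.+1) :=
    fun n => if j \in codom f then true else n == c j.
  apply: (@le_trans _ _ (\sum_(y : {ffun 'I_d -> 'I_(N.*2.+1)} |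
      [forall j, Q j (y j)]) \prod_j H j (y j))).
    rewrite [leLHS]big_mkcond [leRHS]big_mkcond/=; apply: ler_sum => y _.
    case: ifPn => [/eqP yc|_]; last by case: ifP => // _; exact: prodr_ge0.
    have yQ j : Q j (y j).
      by rewrite /Q; case: ifPn => // /negPf jf; rewrite -yc ffunE jf.
    rewrite (introT forallP yQ) (le_trans (G_le _))//.
    have -> : \prod_j H j (y j) = \prod_i rootdec k
        (q * ((y (f i))%:Z - N%:Z)%:~R - t i (box_point c)) ^+ k.+1.
      rewrite /H (exchange_big_dep predT)//=; apply: eq_bigr => i _.
      by rewrite (big_pred1 (f i)).
    apply: ler_prod => i _; rewrite exprn_ge0 ?rootdec_ge0//= mxE.
    rewrite (@t_ext i (box_point y) (box_point c))// => j jf; rewrite !mxE.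
    by have := yQ j; rewrite /Q (negPf jf) => /eqP ->.
  rewrite sum_family.
  apply: (@le_trans _ _ (\prod_(j < d) if j \in codom f then B else 1)).
    apply: ler_prod => j _; rewrite sumr_ge0//=.
    rewrite /Q /H; case: ifPn => [/codomP[i ->]|jf].
      rewrite (eq_bigr (fun n : 'I_(N.*2.+1) => rootdec k (q * n%:R -
          (q * N%:R + t i (box_point c))) ^+ k.+1)).
        exact: sum_rootdec.
      move=> n _; rewrite (big_pred1 i); last first.
        by move=> i'; rewrite /= (inj_eq f_inj).
      by congr (rootdec _ _ ^+ _); rewrite intrB !pmulrn; ring.
    rewrite big_pred1_eq big_pred0// => i; apply: contraNF jf => /eqP <-.
    exact: codom_f.
  rewrite -big_mkcond/= prodr_const card_codom// card_ord//.
apply: (@le_trans _ _ (\sum_(c : {ffun 'I_d -> 'I_(N.*2.+1)} | [forall i, Q0 i (c i)]) B ^+ k)).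
  by apply: ler_sum => c _; exact: inner.
have card : \sum_(c : {ffun 'I_d -> 'I_(N.*2.+1)} | [forall i, Q0 i (c i)]) 1 =
    (N.*2.+1)%:R ^+ (d - k) :> R.
  pose one (i : 'I_d) (n : 'I_(N.*2.+1)) : R := 1.
  transitivity (\sum_(c : {ffun 'I_d -> 'I_(N.*2.+1)} | [forall i, Q0 i (c i)])
     \prod_i one i (c i)).
    by apply: eq_bigr => c _; rewrite big1.
  rewrite sum_family.
  rewrite (eq_bigr (fun i => if i \in [predC codom f] then (N.*2.+1)%:R else 1)).
    rewrite -big_mkcond/= prodr_const; congr (_ ^+ _).
    have := cardC [in codom f]; rewrite card_codom// !card_ord => cd.
    have -> : (d - k = k + #|[predC codom f]| - k)%N by congr (_ - _)%N; exact/esym.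
    by rewrite addKn.
  move=> i _; rewrite /Q0 inE /one; case: (i \in codom f) => /=; first by rewrite (big_pred1 ord0).
  by rewrite sumr_const card_ord.
by rewrite -card mulr_suml; under [leRHS]eq_bigr do rewrite mul1r.
Qed.

End Tube.

(** * Kernel sums over a lattice *)

Section LatticeSums.
Context {R : realType} {d : nat}.
Implicit Types (z : 'rV[int]_d) (q : R).

Definition lat q z : 'rV[R]_d := \row_i (q * (z ord0 i)%:~R).

Lemma latB q z y : lat q (z - y) = lat q z - lat q y.
Proof. by apply/rowP => i; rewrite !mxE intrB; ring. Qed.
Lemma latD q z y : lat q (z + y) = lat q z + lat q y.
Proof. by apply/rowP => i; rewrite !mxE intrD; ring. Qed.
Lemma latZ c q z : lat (c * q) z = c *: lat q z.
Proof. by apply/rowP => i; rewrite !mxE mulrA. Qed.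

Definition kern (p : nat) (v : 'rV[R]_d) : R := isq (enorm v ^+ 2) ^+ p.

Lemma kern_ge0 p v : 0 <= kern p v.
Proof. by rewrite exprn_ge0// isq_ge0// sqr_ge0. Qed.

(** The function [|v| * kern p v] is at most [(1 + |v|^2)^(-d)], which is bounded
    by the product over the coordinates of [(1 + t^2)^(-1) <= 4 * rootdec 1 t ^+ 2]. *)
Lemma kern_moment_sum (p N : nat) q : (2 * d < p)%N -> 0 < q <= 1 ->
  \sum_(z <- box N) enorm (lat q z) * kern p (lat q z) <= (32 / q) ^+ d.
Proof.
move=> dp q01; have /andP[q0 q1] := q01.
pose F (i : 'I_d) (n : int) : R := 4 * rootdec 1 (q * n%:~R) ^+ 2.
apply: (@le_trans _ _ (\sum_(z <- box N) \prod_i F i (z ord0 i))).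
  apply: ler_sum => z _; set v := lat q z.
  have v0 : 0 <= enorm v := enorm_ge0 v.
  have w0 : 0 <= isq (enorm v ^+ 2) by rewrite isq_ge0// sqr_ge0.
  have w1 : isq (enorm v ^+ 2) <= 1 by rewrite isq_le1// sqr_ge0.
  apply: (@le_trans _ _ (isq (enorm v ^+ 2) ^+ (2 * d))).
    rewrite /kern -(subnK dp) addnS exprS mulrA -[leRHS]mul1r.
    apply: ler_pM; rewrite ?mulr_ge0 ?exprn_ge0//; first exact: isq_mul_le1.
    by rewrite exprD ler_piMl ?exprn_ge0// exprn_ile1.
  rewrite enorm_sqr /dotrv (eq_bigr (fun i => v 0 i ^+ 2))//.
  rewrite -[d in (2 * d)%N]card_ord; apply: le_trans (isq_prod _) _.
  apply: ler_prod => i _; rewrite exprn_ge0 ?isq_ge0 ?sqr_ge0//= /F mxE.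
  set t := q * _.
  have -> : 4 * rootdec 1 t ^+ 2 = (2 * (1 + `|t|)^-1) ^+ 2.
    by rewrite -[rootdec 1 t]expr1 rootdec_expn// exprMn; congr (_ * _); ring.
  rewrite -[t ^+ 2]ger0_norm ?sqr_ge0// normrX.
  by apply: lerXn2r; rewrite ?nnegrE ?isq_ge0 ?sqr_ge0 ?mulr_ge0 ?invr_ge0 ?addr_ge0 ?isq_le_inv.
rewrite sum_box_prod -[d in leRHS]card_ord -prodr_const.
apply: ler_prod => i _; rewrite sumr_ge0/=; last first.
  by move=> n _; rewrite mulr_ge0// exprn_ge0// rootdec_ge0.
rewrite -mulr_sumr (_ : 32 / q = 4 * (8 * 1%:R / q)); last by rewrite mulr1; field; rewrite gt_eqF.
rewrite ler_wpM2l// (eq_bigr (fun n : 'I_(N.*2.+1) =>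
  rootdec 1 (q * n%:R - q * N%:R) ^+ 2)); first exact: sum_rootdec.
by move=> n _; rewrite intrB !pmulrn mulrBr.
Qed.

(** At least [n0 ^ d] lattice points have coordinates in [[-1, 1]] after rescaling,
    and there [|v|^2 <= d]. *)
Lemma kern_mass_ge (p n0 N : nat) : (0 < n0)%N -> (n0 <= N)%N ->
  isq d%:R ^+ p * n0%:R ^+ d <= \sum_(z <- box N) kern p (lat (n0%:R^-1) z).
Proof.
move=> n00 n0N; set q := n0%:R^-1 : R.
have q0 : 0 < q by rewrite invr_gt0 ltr0n.
pose F (i : 'I_d) (n : int) : R := ((absz n <= n0)%N)%:R.
apply: (@le_trans _ _ (\sum_(z <- box N) isq d%:R ^+ p * \prod_i F i (z ord0 i))).
  rewrite -mulr_sumr sum_box_prod ler_wpM2l ?exprn_ge0 ?isq_ge0//.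
  rewrite -[d in leLHS]card_ord -prodr_const.
  apply: ler_prod => i _; rewrite ler0n/= /F.
  rewrite -(big_mkord predT (fun n => ((absz (n%:Z - N%:Z) <= n0)%N)%:R : R)).
  have h1 : (N <= N + n0)%N by rewrite leq_addr.
  have h2 : (N + n0 <= N.*2.+1)%N by rewrite -addnn ltnW// ltnS leq_add2l.
  rewrite (@big_cat_nat _ _ _ (N + n0)%N 0%N)//= (@big_cat_nat _ _ _ N 0%N)//=.
  rewrite ler_wpDr ?sumr_ge0// ler_wpDl ?sumr_ge0//.
  rewrite big_nat (eq_bigr (fun=> 1)); last first.
    by move=> n /andP[n1 n2]; rewrite (_ : (absz _ <= _)%N)//; lia.
  by rewrite -big_nat sumr_const_nat addKn.
apply: ler_sum => z _.
have [zn|/forallPn[i]] := boolP [forall i, (absz (z ord0 i) <= n0)%N]; last first.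
  move=> /negPf zi; rewrite (bigD1 i)//= /F zi mul0r mulr0; exact: kern_ge0.
apply: (@le_trans _ _ (isq d%:R ^+ p)).
  rewrite ler_piMr ?exprn_ge0 ?isq_ge0//.
  by apply: prodr_ile1 => i; rewrite /F; case: (_ <= _)%N; rewrite ?ler01 ?lexx.
rewrite /kern; apply: lerXn2r; rewrite ?nnegrE ?isq_ge0 ?sqr_ge0//.
rewrite /isq lef_pV2 ?posrE ?sqrtr_gt0 ?ltr_pwDl ?sqr_ge0//.
rewrite ler_wsqrtr// lerD2l enorm_sqr /dotrv -[d in leRHS]card_ord -sumr_const.
apply: ler_sum => i _; rewrite mxE -expr2 -[leLHS]ger0_norm ?sqr_ge0//.
rewrite normrX expr_le1// normrM gtr0_norm// /q mulrC ler_pdivrMr ?ltr0n//.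
by rewrite mul1r -intr_norm -natr_absz ler_nat; exact: (forallP zn i).
Qed.

Section TubeEstimate.
Context {k : nat} {kd : (k <= d)%N}.
Local Notation G := (grassmannian R kd).
Hypothesis k_gt0 : (0 < k)%N.
Hypothesis k_lt_d : (k < d)%N.

(** Take a graph basis [M] of the plane. As its rows have norm at most [d], the
    forms [dotrv v (row i M)] are at most [d] times the norm of the projection of
    [v = w - lat q z]; and the [i]-th form involves only one of the coordinates
    of [z] in the image of [f], with coefficient [- q]. The summand is therefore
    dominated by a product as in [tube_sum]. The exponent [d >= k + 1] suffices
    for [k] factors of decay [(k + 1) / k]. *)
Lemma tube_estimate (xi : G) (w : 'rV[R]_d) (N : nat) q : 0 < q <= 1 ->
  \sum_(z <- box N) isq (enorm (oproj (val xi) (w - lat q z)) ^+ 2) ^+ d <=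
  2 ^+ d * ((N.*2.+1)%:R ^+ (d - k) * (8 * k%:R * d%:R / q) ^+ k).
Proof.
move=> /andP[q0 q1].
have [M [f [f_inj Mxi M1 Mf _]]] := bounded_graph_basis (dim_val xi).
have d0 : 0 < d%:R :> R by rewrite ltr0n (leq_ltn_trans _ k_lt_d).
have d1 : 1 <= d%:R :> R by rewrite ler1n (leq_ltn_trans _ k_lt_d).
rewrite -ler_pdivrMl ?exprn_gt0// mulr_sumr.
rewrite (_ : 8 * k%:R * d%:R / q = 8 * k%:R / (q / d%:R)); last first.
  by field; rewrite !gt_eqF.
pose t (i : 'I_k) (z : 'rV[int]_d) : R := (dotrv w (row i M) -
  \sum_(j | j \notin codom f) q * (z ord0 j)%:~R * M i j) / d%:R.
apply: (@tube_sum _ _ _ _ f _ t) => //.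
- by rewrite divr_gt0//= ler_pdivrMr// mul1r (le_trans q1).
- move=> i z z' zz'; rewrite /t; congr ((_ - _) / _); apply: eq_bigr => j jf.
  by rewrite zz'.
move=> z; set v := w - lat q z; set a := enorm (oproj (val xi) v).
have a0 : 0 <= a := enorm_ge0 _.
have tE i : q / d%:R * (z 0 (f i))%:~R - t i z = - (dotrv v (row i M) / d%:R).
  have -> : dotrv v (row i M) = dotrv w (row i M) -
      (q * (z ord0 (f i))%:~R + \sum_(j | j \notin codom f) q * (z ord0 j)%:~R * M i j).
    rewrite /v dotrvDl dotrvNl; congr (_ - _).
    rewrite {1}/dotrv (bigID [in codom f])/=; congr (_ + _).
      rewrite (bigD1 (f i)) ?codom_f//= !mxE Mf eqxx mulr1 big1 ?addr0//.
      move=> j /andP[/codomP[l ->] lf]; rewrite !mxE Mf.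
      by have [il|_] := eqVneq i l; rewrite ?mulr0//; move: lf; rewrite il eqxx.
    by apply: eq_bigr => j _; rewrite !mxE.
  by rewrite /t; field; rewrite gt_eqF.
have wM i : `|q / d%:R * (z 0 (f i))%:~R - t i z| <= `|a|.
  rewrite tE normrN normrM normfV (gtr0_norm d0) ler_pdivrMr//.
  rewrite -(dotrv_oproj v (Mxi i)) (ger0_norm a0).
  have mle : enorm (row i M) <= d%:R.
    rewrite -[leRHS]mulr1; apply: enorm_le_const => j; rewrite mxE; exact: M1.
  by apply: le_trans (norm_dotrv_le _ _) _; rewrite ler_wpM2l.
apply: (@le_trans _ _ (\prod_(i < k) rootdec k a ^+ k.+1)); last first.
  apply: ler_prod => i _; rewrite exprn_ge0 ?rootdec_ge0//=.
  by apply: lerXn2r; rewrite ?nnegrE ?rootdec_ge0// rootdec_anti.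
rewrite prodr_const card_ord -exprM mulnC exprM rootdec_expn// (ger0_norm a0).
set e := (1 + a)^-1.
have e0 : 0 <= e by rewrite invr_ge0 addr_ge0.
have e1 : e <= 1 by rewrite invf_le1 ?ltr_pwDl// lerDl.
rewrite ler_pdivrMl ?exprn_gt0//.
apply: (@le_trans _ _ ((2 * e) ^+ d)).
  by apply: lerXn2r; rewrite ?nnegrE ?isq_ge0 ?sqr_ge0 ?mulr_ge0// isq_le_inv.
rewrite exprMn ler_wpM2l ?exprn_ge0//.
by rewrite -(subnK k_lt_d) exprD ler_piMl ?exprn_ge0// exprn_ile1.
Qed.

End TubeEstimate.

End LatticeSums.

(** * Lattice convolutions and their ridge components *)

Section Profile.
Context {R : realType} {d k : nat}.
Variable m : nat.
Local Notation coef := (ridge_coef R d k m).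
Local Notation psi := (@ridge_profile R d k m).

Definition profile_size : R := \sum_(j < m.+1) `|coef j|.
Definition profile_lip : R := \sum_(j < m.+1) `|coef j| * (d + 2 * j)%:R.

Lemma profile_size_ge0 : 0 <= profile_size.
Proof. by apply: sumr_ge0. Qed.
Lemma profile_lip_ge0 : 0 <= profile_lip.
Proof. by apply: sumr_ge0 => j _; rewrite mulr_ge0. Qed.

Lemma profile_bound v : 0 <= v -> `|psi v| <= profile_size * isq v ^+ d.
Proof.
move=> v0; rewrite /profile_size mulr_suml; apply: le_trans (ler_norm_sum _ _ _) _.
apply: ler_sum => j _; rewrite normrM ler_wpM2l//.
rewrite ger0_norm ?exprn_ge0 ?isq_ge0// exprD ler_piMr ?exprn_ge0 ?isq_ge0//.
by rewrite exprn_ile1 ?isq_le1 ?isq_ge0.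
Qed.

Lemma profile_lipschitz (a b : R) : 0 <= a -> 0 <= b ->
  `|psi (a ^+ 2) - psi (b ^+ 2)| <= profile_lip * `|a - b|.
Proof.
move=> a0 b0; rewrite /ridge_profile -sumrB /profile_lip mulr_suml.
apply: le_trans (ler_norm_sum _ _ _) _; apply: ler_sum => j _.
by rewrite -mulrBr normrM -mulrA ler_wpM2l// isqX_lipschitz.
Qed.

End Profile.

Lemma sum_undup_le (R : numDomainType) (I : eqType) (s : seq I) (h : I -> R) :
  (forall i, 0 <= h i) -> \sum_(i <- undup s) h i <= \sum_(i <- s) h i.
Proof.
move=> h0; elim: s => [|i s IH] /=; first by rewrite !big_nil.
by rewrite big_cons; case: ifP => _; rewrite ?big_cons ?lerD2l// ler_wpDl.
Qed.

Section Approximation.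
Context {R : realType} {d : nat}.
Variables (F : 'rV[R]_d -> R) (eps q BF : R) (N1 : nat).
Hypothesis F_lip : lipschitz1 F.
Hypothesis eps0 : 0 < eps.
Hypothesis q01 : 0 < q <= 1.
Let delta := eps * q.
Hypothesis F_supp : forall y, F (lat delta y) != 0 -> y \in box N1.
Hypothesis F_bound : forall x, `|F x| <= BF.

Let q0 : 0 < q. Proof. by case/andP : q01. Qed.
Let delta0 : 0 < delta. Proof. exact: mulr_gt0. Qed.

(** The lattice form of [F * K_eps = F + O(eps)]: in the difference the increments
    [F z0 - F (z0 - z)] are weighted by the kernel, and the first moment of the
    kernel is finite. *)
Lemma kernel_approx (p N0 : nat) z0 : (2 * d < p)%N -> z0 \in box N0 ->
  `|F (lat delta z0) * (\sum_(z <- @box d (N0 + N1)) kern p (lat q z)) -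
    \sum_(y <- @box d N1) F (lat delta y) * kern p (lat q (z0 - y))| <=
  eps * (32 / q) ^+ d.
Proof.
move=> dp z0N.
have -> : \sum_(y <- @box d N1) F (lat delta y) * kern p (lat q (z0 - y)) =
    \sum_(z <- @box d (N0 + N1)) F (lat delta (z0 - z)) * kern p (lat q z).
  transitivity (\sum_(z <- [seq z0 - y | y <- @box d N1])
      F (lat delta (z0 - z)) * kern p (lat q z)).
    by rewrite [RHS]big_map; apply: eq_bigr => y _; rewrite subKr.
  have nz z : F (lat delta (z0 - z)) * kern p (lat q z) != 0 -> z0 - z \in box N1.
    by rewrite mulf_eq0 negb_or => /andP[/F_supp].
  apply: sum_uniq_supp.
  - by rewrite map_inj_uniq ?box_uniq// => y y' /addrI/oppr_inj.
  - exact: box_uniq.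
  - move=> z /nz z1; apply/mapP; exists (z0 - z) => //; by rewrite subKr.
  - move=> z /nz z1; apply: mem_box => i.
    have := box_coord_le i z1; have := box_coord_le i z0N; rewrite !mxE.
    by move: (z0 ord0 i) (z ord0 i) => a b; lia.
rewrite mulr_sumr -sumrB; apply: le_trans (ler_norm_sum _ _ _) _.
apply: (@le_trans _ _ (\sum_(z <- @box d (N0 + N1)) eps * (enorm (lat q z) * kern p (lat q z)))).
  apply: ler_sum => z _; rewrite -mulrBl normrM (ger0_norm (kern_ge0 _ _)) mulrA.
  rewrite ler_wpM2r ?kern_ge0//; apply: le_trans (lipschitz1_norm _ _ F_lip) _.
  by rewrite -latB subKr latZ enormZ gtr0_norm.
by rewrite -mulr_sumr ler_wpM2l ?(ltW eps0)// kern_moment_sum.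
Qed.

Section RidgeSum.
Context {k : nat} {kd : (k <= d)%N}.
Variables (xi : grassmannian R kd) (m : nat).
Local Notation psi := (@ridge_profile R d k m).
Local Notation P := (oproj (val xi)).

(** The component along [xi] of the convolution of [F] with the rescaled kernel:
    by [ridge_identity] its mean over [xi] is that convolution. *)
Definition ridge_sum (x : 'rV[R]_d) : R :=
  \sum_(y <- @box d N1) F (lat delta y) * psi (enorm (P (eps^-1 *: x - lat q y)) ^+ 2).

Lemma ridge_sum_oproj x : ridge_sum (P x) = ridge_sum x.
Proof.
apply: eq_bigr => y _; rewrite !linearB/= !linearZ/=.
by rewrite (oproj_id (oproj_mem _ _)).
Qed.

Variable T : R.
Hypothesis tube : forall w, \sum_(z <- @box d N1) isq (enorm (P (w - lat q z)) ^+ 2) ^+ d <= T.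

(** A translation of [x] along the plane is transferred to [F], which is
    1-Lipschitz; what remains is the sum of the profile over the box and its
    translate, each bounded by the tube estimate [T]. The lattice only admits the
    translations [lat delta v], and the last term, of order [q], is the error of
    rounding. *)
Lemma ridge_sum_lip x x' :
  `|ridge_sum x - ridge_sum x'| <=
  2 * profile_size (R := R) (d := d) (k := k) m * T * (enorm (P (x - x')) + d%:R * delta) +
  (N1.*2.+1)%:R ^+ d * (BF * (profile_lip (R := R) (d := d) (k := k) m * (d%:R * q))).
Proof.
set Cp := profile_size m; set Lp := profile_lip m.
pose e := P (x' - x).
(* [lat delta v] is the displacement [e] rounded down to the lattice. *)
pose v : 'rV[int]_d := \row_i Num.floor (e 0 i / delta).
pose Psi (w : 'rV[R]_d) := psi (enorm (P w) ^+ 2).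
have ve i : `|(lat delta v - e) 0 i| <= delta.
  rewrite !mxE; set t := e 0 i.
  have /andP[] := real_floor_itv (num_real (t / delta)).
  rewrite ler_pdivlMr// ltr_pdivrMr// intrD mulrDl mul1r [_ * delta]mulrC ler_norml.
  by move=> h1 h2; apply/andP; split; lra.
have ved : enorm (lat delta v - e) <= d%:R * delta by exact: enorm_le_const.
pose A := \sum_(y <- @box d N1) F (lat delta y) * Psi (eps^-1 *: x + lat q v - lat q y).
have step1 : `|ridge_sum x' - A| <= (N1.*2.+1)%:R ^+ d * (BF * (Lp * (d%:R * q))).
  rewrite -sumrB; apply: le_trans (ler_norm_sum _ _ _) _.
  have -> : (N1.*2.+1)%:R ^+ d * (BF * (Lp * (d%:R * q))) =
      \sum_(y <- @box d N1 : seq 'rV[int]_d) BF * (Lp * (d%:R * q)).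
    rewrite sum_box sumr_const card_ffun !card_ord -natrX.
    by rewrite -[RHS]mulr_natl.
  apply: ler_sum => y _; rewrite -mulrBr normrM ler_pM//.
  apply: le_trans (profile_lipschitz _ (enorm_ge0 _) (enorm_ge0 _)) _.
  rewrite ler_wpM2l ?profile_lip_ge0//.
  apply: le_trans (enorm_dist _ _) _.
  rewrite -linearB/= (_ : _ - _ = eps^-1 *: (x' - x) - lat q v); last first.
    by apply/rowP => i; rewrite !mxE; ring.
  rewrite linearB/= linearZ/= -/e -(oproj_id (oproj_mem _ _ : e \in val xi)).
  rewrite -linearZ/= -linearB/=; apply: le_trans (oproj_le _ _) _.
  have -> : eps^-1 *: e - lat q v = - eps^-1 *: (lat delta v - e).
    by rewrite /delta latZ scalerBr !scaleNr opprK scalerA mulVf ?gt_eqF// scale1r addrC.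
  rewrite enormZ normrN gtr0_norm ?invr_gt0// ler_pdivrMl//.
  by rewrite mulrCA mulrA; apply: le_trans ved _; rewrite /delta; lra.
have step2 : `|A - ridge_sum x| <= enorm (lat delta v) * (2 * Cp * T).
  have -> : A = \sum_(z <- [seq y - v | y <- @box d N1])
      F (lat delta (z + v)) * Psi (eps^-1 *: x - lat q z).
    rewrite big_map; apply: eq_bigr => y _; rewrite subrK; congr (_ * Psi _).
    by rewrite latB opprB addrA.
  pose s := undup (box N1 ++ [seq y - v | y <- @box d N1]).
  have us : uniq s by exact: undup_uniq.
  have um : uniq [seq y - v | y <- @box d N1].
    by rewrite map_inj_uniq ?box_uniq// => y y' /addIr.
  have -> : \sum_(z <- [seq y - v | y <- @box d N1])
      F (lat delta (z + v)) * Psi (eps^-1 *: x - lat q z) =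
      \sum_(z <- s) F (lat delta (z + v)) * Psi (eps^-1 *: x - lat q z).
    apply: sum_uniq_supp => // z; rewrite mulf_eq0 negb_or => /andP[/F_supp zv _].
      by apply/mapP; exists (z + v); rewrite ?addrK.
    rewrite mem_undup mem_cat; apply/orP; right.
    by apply/mapP; exists (z + v); rewrite ?addrK.
  have -> : ridge_sum x = \sum_(z <- s) F (lat delta z) * Psi (eps^-1 *: x - lat q z).
    apply: sum_uniq_supp; rewrite ?box_uniq// => z;
      rewrite mulf_eq0 negb_or => /andP[/F_supp zv _] //.
    by rewrite mem_undup mem_cat zv.
  rewrite -sumrB; apply: le_trans (ler_norm_sum _ _ _) _.
  apply: (@le_trans _ _ (\sum_(z <- s) enorm (lat delta v) * (Cp *
      isq (enorm (P (eps^-1 *: x - lat q z)) ^+ 2) ^+ d))).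
    apply: ler_sum => z _; rewrite -mulrBl normrM ler_pM//.
      apply: le_trans (lipschitz1_norm _ _ F_lip) _.
      by rewrite latD addrC addKr.
    by apply: profile_bound; rewrite sqr_ge0.
  rewrite -mulr_sumr ler_wpM2l ?enorm_ge0// -mulr_sumr -mulrA mulrCA.
  rewrite ler_wpM2l ?profile_size_ge0//.
  apply: le_trans (sum_undup_le _ _) _ => [z|].
    by rewrite exprn_ge0// isq_ge0// sqr_ge0.
  rewrite big_cat/= mulrDl mul1r; apply: lerD; first exact: tube.
  rewrite big_map; under eq_bigr => y _ do rewrite latB opprB addrA.
  exact: tube.
rewrite distrC; apply: (le_trans (ler_distD A _ _)).
rewrite addrC; apply: lerD => //; apply: le_trans step2 _.
have T0 : 0 <= T.
  apply: le_trans (tube 0); apply: sumr_ge0 => z _.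
  by rewrite exprn_ge0// isq_ge0// sqr_ge0.
rewrite mulrC ler_wpM2l//; first by rewrite !mulr_ge0 ?profile_size_ge0.
have -> : enorm (P (x - x')) = enorm e.
  by rewrite /e -opprB linearN/= enormN.
rewrite addrC; apply: le_trans (lerD ved (lexx (enorm e))).
by rewrite -{1}(subrK e (lat delta v)) enormD.
Qed.

End RidgeSum.
End Approximation.

(** * Testing the two measures against a smoothed potential *)

Section NonmeasurableIntegrals.
Local Open Scope classical_set_scope.

(** The integral of a nonnegative function is a supremum over the simple functions
    below it, so it is monotone without measurability. The integrand of [SW1] is
    compared in this way. *)
Lemma ge0_le_integral_nonmeasurable {R : realType} disp (U : measurableType disp)
    (mu : {measure set U -> \bar R}) (f g : U -> \bar R) :
  (forall x, 0 <= f x)%E -> (forall x, f x <= g x)%E ->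
  (\int[mu]_x f x <= \int[mu]_x g x)%E.
Proof.
move=> f0 fg; have g0 x : (0 <= g x)%E by exact: le_trans (f0 x) (fg x).
rewrite !ge0_integralTE//; apply: ereal_sup_le => _ [h hf <-].
by exists h => // x; exact: le_trans (hf x) (fg x).
Qed.

End NonmeasurableIntegrals.

Section FunctionalBound.
Local Open Scope classical_set_scope.
Context {R : realType} {d k : nat} {kd : (k <= d)%N}.
Local Notation G := (grassmannian R kd).
Hypothesis k_gt0 : (0 < k)%N.
Hypothesis k_lt_d : (k < d)%N.
Variable sigma : probability G R.
Hypothesis inv : rotation_invariant sigma.
Variables (mu nu : probability 'rV[R]_d R) (T : finType) (E : T -> set 'rV[R]_d).
Variables (zt : T -> 'rV[int]_d) (F : 'rV[R]_d -> R) (eps q BF s : R) (N0 N1 : nat).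
Hypothesis mE : forall t, measurable (E t).
Hypothesis tE : trivIset setT E.
Hypothesis muE : (\sum_t mu (E t) = 1)%E.
Hypothesis nuE : (\sum_t nu (E t) = 1)%E.
Hypothesis F_lip : lipschitz1 F.
Hypothesis eps0 : 0 < eps.
Hypothesis q01 : 0 < q <= 1.
Let delta := eps * q.
Hypothesis E_near : forall t x, E t x -> enorm (x - lat delta (zt t)) <= d%:R * delta.
Hypothesis zt_box : forall t, zt t \in box N0.
Hypothesis F_supp : forall y, F (lat delta y) != 0 -> y \in box N1.
Hypothesis F_bound : forall x, `|F x| <= BF.
Hypothesis SWs : SW1 sigma mu nu = s%:E.

Let p := (k + 2 * d)%N.
Let Cp : R := profile_size (R := R) (d := d) (k := k) d.
Let Lp : R := profile_lip (R := R) (d := d) (k := k) d.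
Let Tube : R := 2 ^+ d * ((N1.*2.+1)%:R ^+ (d - k) * (8 * k%:R * d%:R / q) ^+ k).
Let L := 2 * (Cp + 1) * Tube.
Let eta := L * (d%:R * delta) + (N1.*2.+1)%:R ^+ d * (BF * (Lp * (d%:R * q))).
Let a t := fine (mu (E t)).
Let b t := fine (nu (E t)).
Let g (xi : G) (x : 'rV[R]_d) := @ridge_sum R d F eps q N1 k kd xi d x.

Let q0 : 0 < q. Proof. by case/andP: q01. Qed.
Let Cp0 : 0 <= Cp. Proof. exact: profile_size_ge0. Qed.
Let d0 : 0 < d%:R :> R. Proof. by rewrite ltr0n (leq_ltn_trans _ k_lt_d). Qed.
Let Tube0 : 0 < Tube.
Proof.
rewrite mulr_gt0 ?exprn_gt0// mulr_gt0 ?exprn_gt0 ?ltr0n//.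
by rewrite divr_gt0// mulr_gt0// mulr_gt0// ltr0n.
Qed.
Let L0 : 0 < L. Proof. by rewrite mulr_gt0// mulr_gt0// ltr_wpDl. Qed.

Lemma g_lip xi x x' : `|g xi x - g xi x'| <= L * enorm (oproj (val xi) (x - x')) + eta.
Proof.
have h := ridge_sum_lip F_lip eps0 q01 F_supp F_bound (xi := xi) d
  (fun w => @tube_estimate R d k kd k_gt0 k_lt_d xi w N1 q q01) x x'.
apply: le_trans h _; rewrite -/Cp -/Lp -/delta -/Tube /eta addrA -mulrDr lerD2r.
have dd : 0 <= d%:R * delta by rewrite mulr_ge0 ?(ltW d0)// ltW// mulr_gt0.
rewrite ler_wpM2r ?addr_ge0 ?enorm_ge0// /L ler_wpM2r ?(ltW Tube0)//.
by rewrite ler_wpM2l// lerDl.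
Qed.

Lemma bmf_g xi : bmf (g xi).
Proof.
apply: bmf_sum => y; apply: bmfZ; apply: bmf_sum => j; apply: bmfZ; apply: bmfX.
apply: (@bmf_isq R _ 'rV[R]_d
  (fun x => enorm (oproj (val xi) (eps^-1 *: x - lat q y)) ^+ 2)).
  apply: measurable_funX; apply: measurable_enorm_comp => i.
  rewrite (_ : (fun x => _) = fun x => eps^-1 * (oproj (val xi) x) 0 i -
      (oproj (val xi) (lat q y)) 0 i); last first.
    by apply/funext => x; rewrite linearB/= linearZ/= !mxE.
  apply: measurable_funB; last exact: measurable_cst.
  apply: measurable_funM; first exact: measurable_cst.
  exact: (measurableT_comp (measurable_coord i) (oproj_measurable _)).
by move=> x; rewrite sqr_ge0.
Qed.

Let D xi := \sum_t (a t - b t) * g xi (lat delta (zt t)).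

(** The function [g xi] factors through the projection to [xi], hence its means
    under [mu] and [nu] are means under the projected measures, and
    [W1_ge_expect] applies. Passing from these means to the sum [D xi] over the
    cells costs twice the oscillation of [g xi] on a cell. *)
Lemma D_le_W1 xi :
  (((D xi - 3 * eta - 2 * (L * (d%:R * delta))) / L)%:E <=
   W1 (distribution mu (oproj (val xi))) (distribution nu (oproj (val xi))))%E.
Proof.
have bg := bmf_g xi.
have cellb (P : probability 'rV[R]_d R) : (\sum_t P (E t) = 1)%E ->
    `|expect P (g xi) - \sum_t fine (P (E t)) * g xi (lat delta (zt t))| <=
    L * (d%:R * delta) + eta.
  move=> PE; apply: expect_cells => // t x Ex.
  apply: le_trans (g_lip _ _ _) _; rewrite lerD2r ler_wpM2l ?(ltW L0)//.
  by apply: le_trans (oproj_le _ _) (E_near Ex).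
have push (P : probability 'rV[R]_d R) :
    expect (distribution P (oproj (val xi))) (g xi) = expect P (g xi).
  have [_ <-] := @expect_comp R _ _ _ _ P (distribution P (oproj (val xi)))
    (oproj (val xi)) (g xi) (oproj_measurable _) (fun A _ => erefl) bg.
  by congr expect; apply/funext => x /=; rewrite /g ridge_sum_oproj.
apply: le_trans (@W1_ge_expect R d _ _ (g xi) L eta bg L0 _); last first.
  move=> x y; apply: le_trans (ler_norm _) _; apply: le_trans (g_lip _ _ _) _.
  by rewrite lerD2r ler_wpM2l ?(ltW L0)// oproj_le.
rewrite lee_fin ler_pM2r ?invr_gt0// !push.
have := cellb mu muE; have := cellb nu nuE; rewrite !ler_norml.
have -> : D xi = \sum_t fine (mu (E t)) * g xi (lat delta (zt t)) -
    \sum_t fine (nu (E t)) * g xi (lat delta (zt t)).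
  by rewrite -sumrB; apply: eq_bigr => t _; rewrite mulrBl.
by move=> /andP[h1 h2] /andP[h3 h4]; lra.
Qed.

(** In the mean over the planes, the ridge components rebuild the kernel. *)
Lemma expect_g t : bmf (fun xi => g xi (lat delta (zt t))) /\
  expect sigma (fun xi => g xi (lat delta (zt t))) =
  \sum_(y <- @box d N1) F (lat delta y) * kern p (lat q (zt t - y)).
Proof.
have pt y : eps^-1 *: lat delta (zt t) - lat q y = lat q (zt t - y).
  by rewrite /delta latZ scalerA mulVf ?gt_eqF// scale1r latB.
have id y := ridge_identity inv k_gt0 (lat q (zt t - y)) d.
have gE : (fun xi => g xi (lat delta (zt t))) = fun xi => \sum_(y <- @box d N1)
    F (lat delta y) * @ridge_profile R d k d (enorm (oproj (val xi) (lat q (zt t - y))) ^+ 2).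
  by apply/funext => xi; apply: eq_bigr => y _; rewrite pt.
rewrite gE; split.
  by apply: bmf_sum => y; apply: bmfZ; exact: (id y).1.
rewrite expect_sum; last by move=> y; apply: bmfZ; exact: (id y).1.
apply: eq_bigr => y _; rewrite expectZ; last exact: (id y).1.
by rewrite (id y).2.
Qed.

Lemma expect_D_le : bmf D /\
  expect sigma D <= L * s + 3 * eta + 2 * (L * (d%:R * delta)).
Proof.
have bD : bmf D by apply: bmf_sum => t; apply: bmfZ; exact: (expect_g t).1.
split=> //.
set c := 3 * eta + 2 * (L * (d%:R * delta)).
pose h xi := (D xi - c) / L.
have bh : bmf h.
  have := bmfZ L^-1 (bmfB bD (bmf_cst _ c)); congr bmf.
  by apply/funext => xi; rewrite mulrC.
(* Only the positive part of [h] can be compared with the integrand of [SW1],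
   monotonicity being restricted to nonnegative functions. *)
have bh0 : bmf (fun xi => Num.max 0 (h xi)).
  have [mh [M hM]] := bh; split.
    by apply: measurable_maxr => //; exact: measurable_cst.
  exists M => xi; apply: le_trans (hM xi); rewrite /Num.max; case: ifP => // _.
  by rewrite normr0.
have le_s : expect sigma (fun xi => Num.max 0 (h xi)) <= s.
  rewrite -lee_fin expect_EFin// -SWs /SW1; apply: ge0_le_integral_nonmeasurable => xi.
    by rewrite lee_fin le_max lexx.
  rewrite EFin_max ge_max W1_ge0/=; apply: le_trans (D_le_W1 xi).
  by rewrite lee_fin /h /c opprD addrA.
have : expect sigma h <= s.
  by apply: le_trans le_s; apply: le_expect => // xi; rewrite le_max lexx orbT.
have -> : expect sigma h = L^-1 * (expect sigma D - c).
  rewrite -[c in RHS](expect_cst sigma) -expectB//; last exact: bmf_cst.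
  rewrite -expectZ; last by apply: bmfB => //; exact: bmf_cst.
  by congr expect; apply/funext => xi; rewrite mulrC.
by rewrite ler_pdivrMl// -addrA -/c; lra.
Qed.

(** The potential [F] is exchanged for its convolution at the cost of
    [kernel_approx], and the convolution is tested by [expect_D_le]. *)
Lemma functional_bound :
  (\sum_(z <- @box d (N0 + N1)) kern p (lat q z)) *
    \sum_t (a t - b t) * F (lat delta (zt t)) <=
  2 * (eps * (32 / q) ^+ d) + (L * s + 3 * eta + 2 * (L * (d%:R * delta))).
Proof.
have [bD ED] := expect_D_le.
set Kn := \sum_(z <- _) _.
have p2d : (2 * d < p)%N by rewrite /p; lia.
have ED' : expect sigma D = \sum_t (a t - b t) *
    \sum_(y <- @box d N1) F (lat delta y) * kern p (lat q (zt t - y)).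
  rewrite expect_sum; last by move=> t; apply: bmfZ; exact: (expect_g t).1.
  apply: eq_bigr => t _; rewrite expectZ; last exact: (expect_g t).1.
  by rewrite (expect_g t).2.
have ab0 t : 0 <= a t /\ 0 <= b t by rewrite !fine_ge0.
rewrite mulr_sumr.
apply: (@le_trans _ _ (\sum_t ((a t + b t) * (eps * (32 / q) ^+ d) +
   (a t - b t) * \sum_(y <- @box d N1) F (lat delta y) * kern p (lat q (zt t - y))))).
  apply: ler_sum => t _; have [a0 b0] := ab0 t.
  have := kernel_approx F_lip eps0 q01 F_supp p2d (zt_box t).
  rewrite -/delta -/Kn; set S := \sum_(y <- _) _ => h.
  rewrite -lerBlDr (_ : _ - _ = (a t - b t) * (F (lat delta (zt t)) * Kn - S)); last by ring.
  apply: le_trans (ler_norm _) _; rewrite normrM; apply: ler_pM; [by []|by []| |exact: h].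
  apply: le_trans (ler_normB (a t) (b t)) _.
  by rewrite (ger0_norm a0) (ger0_norm b0).
rewrite big_split; apply: lerD; last by rewrite -ED'.
by rewrite -mulr_suml big_split/= !sum_fine_cells.
Qed.

End FunctionalBound.

(** * Discretisation and choice of the scale *)

Section GridCells.
Local Open Scope classical_set_scope.
Context {R : realType} {d : nat}.
Variables (delta r : R).
Hypothesis delta0 : 0 < delta.

Definition grid_cell (z : 'rV[int]_d) : set 'rV[R]_d :=
  \bigcap_(i in [set: 'I_d]) (fun x : 'rV[R]_d => x 0 i) @^-1`
    `[delta * (z ord0 i)%:~R, delta * (z ord0 i + 1)%:~R[.

Definition grid_radius : nat := (Num.truncn (r / delta)).+1.

Lemma measurable_grid_cell z : measurable (grid_cell z).
Proof.
apply: fin_bigcap_measurable => // i _.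
rewrite -[X in measurable X]setTI.
exact: (@measurable_coord R d i measurableT _ (measurable_itv _)).
Qed.

Lemma grid_cell_inj z z' x : grid_cell z x -> grid_cell z' x -> z = z'.
Proof.
move=> zx zx'; apply/rowP => i.
have := zx i I; have := zx' i I; rewrite /= !in_itv/= => /andP[h1 h2] /andP[h3 h4].
have := le_lt_trans h3 h2; have := le_lt_trans h1 h4.
rewrite !(ltr_pM2l delta0) !ltr_int.
by move: (z ord0 i) (z' ord0 i) => a b; lia.
Qed.

Lemma grid_cell_near z x : grid_cell z x -> enorm (x - lat delta z) <= d%:R * delta.
Proof.
move=> zx; apply: enorm_le_const => i; rewrite !mxE.
have := zx i I; rewrite /= in_itv/= intrD mulrDr mulr1 => /andP[h1 h2].
by rewrite ler_norml; apply/andP; split; lra.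
Qed.

Lemma grid_cover (x : 'rV[R]_d) : enorm x <= r ->
  exists2 z, z \in box grid_radius & grid_cell z x.
Proof.
move=> xr; pose z : 'rV[int]_d := \row_i Num.floor (x 0 i / delta).
exists z; last first.
  move=> i _ /=; rewrite in_itv/= mxE.
  have /andP[] := real_floor_itv (num_real (x 0 i / delta)).
  by rewrite ler_pdivlMr// ltr_pdivrMr// ![delta * _]mulrC => -> ->.
apply: mem_box => i; rewrite mxE /grid_radius.
have /andP[h1 h2] := real_floor_itv (num_real (x 0 i / delta)).
have xi : `|x 0 i / delta| <= r / delta.
  rewrite normrM normfV (gtr0_norm delta0) ler_pM2r ?invr_gt0//.
  exact: le_trans (coord_le_enorm x i) xr.
have h3 := truncnS_gt (r / delta); set n := Num.truncn _ in h3 *.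
move: xi; rewrite ler_norml => /andP[h4 h5].
rewrite intrD in h2; move: (Num.floor _) h1 h2 => m h1 h2.
have m1 : m%:~R < (n.+1%:Z)%:~R :> R by rewrite -pmulrn; lra.
have m2 : (- (n.+1%:Z) - 1)%:~R < m%:~R :> R.
  by rewrite intrB intrN -pmulrn; lra.
by rewrite !ltr_int in m1 m2; lia.
Qed.

End GridCells.

Section CoreBound.
Local Open Scope classical_set_scope.
Context {R : realType} {d k : nat} {kd : (k <= d)%N}.
Local Notation G := (grassmannian R kd).
Hypothesis k_gt0 : (0 < k)%N.
Hypothesis k_lt_d : (k < d)%N.

Let Cp : R := profile_size (R := R) (d := d) (k := k) d.
Let Lp : R := profile_lip (R := R) (d := d) (k := k) d.
Let c0 : R := isq d%:R ^+ (k + 2 * d).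

(** [approx_const] comes from smoothing at the scale [eps], [slope_const] from the
    Lipschitz constants of the ridge components, and [grid_error] from the
    lattice: it is divided by the number of mesh sizes in [eps]. *)
Definition approx_const : R := c0^-1 * (2 * 32 ^+ d).
Definition slope_const : R :=
  c0^-1 * (2 * (Cp + 1) * 2 ^+ d * (8 * k%:R * d%:R) ^+ k * (11 * d%:R) ^+ (d - k)).
Definition grid_error (r eps : R) : R :=
  5 * (slope_const * (r / eps) ^+ (d - k)) * (d%:R * eps) +
  c0^-1 * (3 * ((11 * d%:R * (r / eps)) ^+ d * (8 * d%:R * r * (Lp * d%:R)))) +
  2 * d%:R * eps.

Let d0 : 0 < d%:R :> R. Proof. by rewrite ltr0n (leq_ltn_trans _ k_lt_d). Qed.
Let d1 : 1 <= d%:R :> R. Proof. by rewrite ler1n (leq_ltn_trans _ k_lt_d). Qed.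
Let c00 : 0 < c0. Proof. by rewrite exprn_gt0// isq_gt0. Qed.
Let Cp0 : 0 <= Cp. Proof. exact: profile_size_ge0. Qed.
Let Lp0 : 0 <= Lp. Proof. exact: profile_lip_ge0. Qed.

Lemma approx_const_ge0 : 0 <= approx_const.
Proof. by rewrite /approx_const mulr_ge0 ?invr_ge0 ?(ltW c00)// mulr_ge0 ?exprn_ge0. Qed.

Lemma slope_const_ge0 : 0 <= slope_const.
Proof.
rewrite /slope_const; apply: mulr_ge0; first by rewrite invr_ge0 (ltW c00).
have h1 : 0 <= 2 * (Cp + 1) by rewrite mulr_ge0 ?addr_ge0.
have h2 : 0 <= 2 ^+ d :> R by rewrite exprn_ge0.
have h3 : 0 <= (8 * k%:R * d%:R) ^+ k :> R by rewrite exprn_ge0 ?mulr_ge0.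
have h4 : 0 <= (11 * d%:R) ^+ (d - k) :> R by rewrite exprn_ge0 ?mulr_ge0.
exact: mulr_ge0 (mulr_ge0 (mulr_ge0 h1 h2) h3) h4.
Qed.

(** Division by the kernel mass [Kn], of order [n0 ^ d]. The tube has at most
    [O((r / eps * n0) ^ (d - k))] slices of [O(n0 ^ k)] points, so that the same
    power of [n0] occurs in the first two terms; the others keep a factor
    [1 / n0]. *)
Lemma collect_bounds (V Kn r eps s : R) (n0 N1 : nat) :
  0 < eps -> eps <= r -> 0 <= s -> (0 < n0)%N ->
  (N1.*2.+1)%:R <= 11 * d%:R * (r / eps) * n0%:R ->
  c0 * n0%:R ^+ d <= Kn ->
  let q := n0%:R^-1 in
  let delta := eps * q in
  let Tube := 2 ^+ d * ((N1.*2.+1)%:R ^+ (d - k) * (8 * k%:R * d%:R / q) ^+ k) in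
  let L := 2 * (Cp + 1) * Tube in
  let eta := L * (d%:R * delta) + (N1.*2.+1)%:R ^+ d * (8 * d%:R * r * (Lp * (d%:R * q))) in
  Kn * V <= 2 * (eps * (32 / q) ^+ d) + (L * s + 3 * eta + 2 * (L * (d%:R * delta))) ->
  V + 2 * (d%:R * delta) <=
    approx_const * eps + slope_const * (r / eps) ^+ (d - k) * s + grid_error r eps / n0%:R.
Proof.
move=> eps0 epsr s0 n00 hN hK q delta Tube L eta hV.
have n0r : 0 < n0%:R :> R by rewrite ltr0n.
set n := n0%:R in n0r hN hK *.
have nd : 0 < n ^+ d by rewrite exprn_gt0.
have r0 : 0 < r by exact: lt_le_trans epsr.
set rho := r / eps in hN *.
have rho0 : 0 < rho by rewrite divr_gt0.
have A0 : 0 <= 11 * d%:R * rho by apply: mulr_ge0; [rewrite mulr_ge0|exact: ltW].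
set M := (N1.*2.+1)%:R in hN *.
have M0 : 0 <= M by [].
have qE : q = n^-1 by [].
pose Lam := c0 * (slope_const * rho ^+ (d - k)).
have LamE : Lam = 2 * (Cp + 1) * 2 ^+ d * (8 * k%:R * d%:R) ^+ k * (11 * d%:R * rho) ^+ (d - k).
  by rewrite /Lam /slope_const !exprMn; field; rewrite gt_eqF.
have hL : L <= Lam * n ^+ d.
  have -> : n ^+ d = n ^+ (d - k) * n ^+ k by rewrite -exprD subnK// ltnW.
  rewrite LamE /L /Tube qE invrK.
  have -> : 2 * (Cp + 1) * 2 ^+ d * (8 * k%:R * d%:R) ^+ k * (11 * d%:R * rho) ^+ (d - k) *
     (n ^+ (d - k) * n ^+ k) = 2 * (Cp + 1) *
     (2 ^+ d * ((11 * d%:R * rho * n) ^+ (d - k) * (8 * k%:R * d%:R * n) ^+ k)).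
    by rewrite !exprMn; ring.
  rewrite ler_wpM2l ?mulr_ge0 ?addr_ge0// ler_wpM2l ?exprn_ge0//.
  rewrite ler_wpM2r ?exprn_ge0 ?mulr_ge0 ?(ltW n0r)//.
  by apply: lerXn2r; rewrite ?nnegrE//; apply: mulr_ge0 => //; exact: ltW.
have hM : M ^+ d <= (11 * d%:R * rho) ^+ d * n ^+ d.
  by rewrite -exprMn; apply: lerXn2r; rewrite ?nnegrE//; apply: mulr_ge0 => //; exact: ltW.
have Lam0 : 0 <= Lam.
  by rewrite mulr_ge0 ?(ltW c00)// mulr_ge0 ?slope_const_ge0// exprn_ge0// ltW.
set D := d%:R * delta in hV *.
have DE : D = d%:R * eps / n by rewrite /D /delta qE mulrA.
have D0 : 0 <= D by rewrite DE divr_ge0 ?mulr_ge0 ?ltW.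
set W := (11 * d%:R * rho) ^+ d * (8 * d%:R * r * (Lp * d%:R)).
have heta : eta <= (Lam * D + W / n) * n ^+ d.
  rewrite /eta [leRHS]mulrDl; apply: lerD.
    by rewrite [leRHS]mulrAC; apply: ler_wpM2r.
  rewrite /W qE; have -> : 8 * d%:R * r * (Lp * (d%:R / n)) = 8 * d%:R * r * (Lp * d%:R) / n by ring.
  set B := 8 * d%:R * r * (Lp * d%:R).
  have B0 : 0 <= B by rewrite !mulr_ge0 ?(ltW r0).
  have -> : (11 * d%:R * rho) ^+ d * B / n * n ^+ d =
    ((11 * d%:R * rho) ^+ d * n ^+ d) * (B / n) by ring.
  by rewrite ler_wpM2r// divr_ge0// ltW.
have h32 : (32 / q) ^+ d = 32 ^+ d * n ^+ d by rewrite qE invrK exprMn.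
pose Z := 2 * 32 ^+ d * eps + Lam * s + 3 * (Lam * D + W / n) + 2 * (Lam * D).
have hZ : Kn * V <= Z * n ^+ d.
  apply: le_trans hV _; rewrite h32 /Z.
  have e1 : L * s <= Lam * n ^+ d * s by rewrite ler_wpM2r.
  have e2 : L * D <= Lam * n ^+ d * D by rewrite ler_wpM2r.
  have -> : (2 * 32 ^+ d * eps + Lam * s + 3 * (Lam * D + W / n) + 2 * (Lam * D)) * n ^+ d =
    2 * (eps * (32 ^+ d * n ^+ d)) + (Lam * n ^+ d * s + 3 * ((Lam * D + W / n) * n ^+ d) +
     2 * (Lam * n ^+ d * D)) by ring.
  by rewrite lerD2l; move: e1 e2 heta; rewrite -/D; lra.
have W0 : 0 <= W.
  apply: mulr_ge0; first by rewrite exprn_ge0.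
  by apply: mulr_ge0; apply: mulr_ge0; rewrite ?(ltW r0) ?mulr_ge0.
have LamD0 : 0 <= Lam * D by exact: mulr_ge0.
have Wn0 : 0 <= W / n by rewrite divr_ge0 ?(ltW n0r).
have Z0 : 0 <= Z.
  have h1 : 0 <= 2 * 32 ^+ d * eps by rewrite mulr_ge0 ?(ltW eps0)// mulr_ge0 ?exprn_ge0.
  have h2 : 0 <= Lam * s by exact: mulr_ge0.
  by rewrite /Z; lra.
have V_le : V <= Z / c0.
  rewrite ler_pdivlMr//.
  have [V0|V0] := leP V 0; first by rewrite (le_trans _ Z0)// mulr_le0_ge0// ltW.
  rewrite -(ler_pM2r nd); apply: le_trans _ hZ.
  have -> : V * c0 * n ^+ d = c0 * n ^+ d * V by ring.
  by rewrite ler_wpM2r ?(ltW V0).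
apply: le_trans (lerD V_le (lexx _)) _.
rewrite le_eqVlt; apply/orP; left; apply/eqP.
rewrite /Z /grid_error /approx_const -/rho -/W (_ : slope_const * rho ^+ (d - k) = Lam / c0); last first.
  by rewrite /Lam [RHS]mulrC mulKf// gt_eqF.
rewrite DE; field.
by rewrite !gt_eqF.
Qed.


Variable sigma : probability G R.
Hypothesis inv : rotation_invariant sigma.
Variables (mu nu : probability 'rV[R]_d R) (r : R).
Hypothesis r0 : 0 < r.
Hypothesis mu_supp : supported_on mu (eclosed_ball r).
Hypothesis nu_supp : supported_on nu (eclosed_ball r).

(** The transport plan whose only cell is the ball. *)
Lemma W1_le_diam : (W1 mu nu <= (2 * r)%:E)%E.
Proof.
have := @W1_le_plan R d mu nu unit (fun=> eclosed_ball r) (fun _ _ => 1)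
  (fun _ _ => 2 * r) (fun=> measurable_eclosed_ball r).
have b1 (x : R) : \sum_(t : unit) x = x by rewrite sumr_const card_unit.
have be (x : \bar R) : (\sum_(t : unit) x = x)%E.
  by rewrite (big_pred1 tt)// => -[].
rewrite !b1 mul1r !be; apply=> //.
- by move=> [] [] _ _.
- by rewrite mu_supp.
- by rewrite nu_supp.
move=> _ _ x y xr yr; apply: le_trans (enormD _ _) _; rewrite enormN.
by move: xr yr; rewrite /eclosed_ball /=; lra.
Qed.

(** The measures are discretised on the cells of a lattice of mesh [eps / n0]. By
    [W1_le_plan] and [kantorovich_finite] it suffices to bound all 1-Lipschitz
    test functions on the lattice, which [functional_bound] does; then [n0] is
    taken large. *)
Lemma W1_le_scale (s eps : R) : SW1 sigma mu nu = s%:E -> 0 < eps -> eps <= r ->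
  (W1 mu nu <= (approx_const * eps + slope_const * (r / eps) ^+ (d - k) * s)%:E)%E.
Proof.
move=> SWs eps0 epsr.
have s0 : 0 <= s.
  rewrite -lee_fin -SWs; apply: integral_ge0 => xi _; exact: W1_ge0.
apply/lee_addgt0Pr => e e0.
pose n0 := (Num.truncn (grid_error r eps / e)).+1.
have n00 : (0 < n0)%N by [].
have n0r : 0 < n0%:R :> R by rewrite ltr0n.
have n01 : 1 <= n0%:R :> R by rewrite ler1n.
have n0e : grid_error r eps / n0%:R <= e.
  rewrite ler_pdivrMr// -ler_pdivrMl// mulrC.
  exact/ltW/truncnS_gt.
pose q : R := n0%:R^-1; pose delta := eps * q.
have q01 : 0 < q <= 1 by rewrite invr_gt0 n0r/= invf_le1.
have /andP[q0 q1] := q01.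
have delta0 : 0 < delta by rewrite mulr_gt0.
have delta_eps : delta <= eps by rewrite ler_piMr// ltW.
(* Cells with indices in [box N0] cover the ball; the test functions vanish at
   lattice points outside of [box N1]. *)
pose N0 := grid_radius delta r.
pose T : finType := {ffun 'I_d -> 'I_(N0.*2.+1)}.
pose zt (t : T) : 'rV[int]_d := box_point t.
pose E (t : T) := @grid_cell R d delta (zt t).
have zt_box t : zt t \in box N0 by apply/mapP; exists t; rewrite ?mem_enum.
have mE t : measurable (E t) by exact: measurable_grid_cell.
have tE : trivIset setT E.
  move=> t t' _ _ [x [Ex Ex']]; apply: (@box_point_inj d N0).
  exact: (grid_cell_inj delta0 Ex Ex').
have mass (P : probability 'rV[R]_d R) : supported_on P (eclosed_ball r) ->
    (\sum_t P (E t) = 1)%E.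
  move=> Pr; rewrite -measure_bigcup_fin//.
  apply/eqP; rewrite eq_le probability_le1/=; last exact: fin_bigcup_measurable.
  rewrite -Pr; apply: le_measure; rewrite ?inE.
  - exact: measurable_eclosed_ball.
  - exact: fin_bigcup_measurable.
  move=> x /(grid_cover delta0)[z /mapP[t _ zE] zx].
  by exists t => //; rewrite /E /zt -zE.
have E_near t x : E t x -> enorm (x - lat delta (zt t)) <= d%:R * delta.
  exact: grid_cell_near.
pose rho := 2 * d%:R * r.
have trunc_le (y : R) : 0 <= y -> (Num.truncn y)%:R <= y.
  by move=> y0; rewrite truncn_le.
have p_rho t : enorm (lat delta (zt t)) <= rho.
  have rd : 0 <= r / delta by rewrite divr_ge0// ltW.
  apply: (@le_trans _ _ (d%:R * (delta * N0%:R))).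
    apply: enorm_le_const => i; rewrite mxE normrM gtr0_norm// ler_wpM2l ?(ltW delta0)//.
    by rewrite -intr_norm -natr_absz ler_nat box_coord_le.
  have -> : rho = d%:R * (2 * r) by rewrite /rho mulrAC mulrC.
  rewrite ler_wpM2l ?(ltW d0)//.
  rewrite /N0 /grid_radius -natr1 mulrDr mulr1 mulr_natl mulr2n.
  apply: lerD; last exact: le_trans epsr.
  by rewrite mulrC -ler_pdivlMr// trunc_le.
pose N1 := (Num.truncn (4 * d%:R * r / delta)).+1.
pose a t := fine (mu (E t)); pose b t := fine (nu (E t)).
have sum1 (P : probability 'rV[R]_d R) : supported_on P (eclosed_ball r) ->
    \sum_t fine (P (E t)) = 1.
  by move=> /mass; exact: sum_fine_cells.
pose V0 := approx_const * eps + slope_const * (r / eps) ^+ (d - k) * s + grid_error r eps / n0%:R -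
  2 * (d%:R * delta).
have [||||//|F F_lip F_supp0|pi [pi0 pi_a pi_b pi_c]] :=
  @kantorovich_finite R d T (fun t => lat delta (zt t)) rho a b V0.
- by move=> t; rewrite fine_ge0.
- by move=> t; rewrite fine_ge0.
- exact: sum1.
- exact: sum1.
- have rho2 : 2 * rho = 4 * d%:R * r by rewrite /rho; ring.
  have rho0 : 0 < 2 * rho by rewrite rho2 !mulr_gt0.
  have F_supp y : F (lat delta y) != 0 -> y \in box N1.
    move=> Fy; apply: mem_box => i.
    have yr : enorm (lat delta y) < 2 * rho.
      by rewrite ltNge; apply: contra_neqN Fy; exact: F_supp0.
    have := le_lt_trans (coord_le_enorm (lat delta y) i) yr.
    rewrite mxE normrM gtr0_norm// mulrC -ltr_pdivlMr// rho2 => yi.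
    have := lt_trans yi (truncnS_gt _); rewrite -intr_norm -natr_absz ltr_nat.
    exact: ltnW.
  have F_bound x : `|F x| <= 8 * d%:R * r.
    have [xr|xr] := leP (2 * rho) (enorm x).
      by rewrite F_supp0// normr0 !mulr_ge0// ltW.
    have dgt0 : (0 < d)%N by rewrite -(ltr0n R).
    pose x0 : 'rV[R]_d := (2 * rho) *: 'e_(Ordinal dgt0).
    have x0r : enorm x0 = 2 * rho by rewrite enormZ enorm_delta mulr1 gtr0_norm.
    have := lipschitz1_norm x x0 F_lip; rewrite (F_supp0 x0) ?x0r// subr0.
    move=> /le_trans; apply; apply: le_trans (enormD _ _) _.
    by rewrite enormN x0r; move: xr; rewrite rho2; lra.
  have fb := functional_bound k_gt0 k_lt_d inv mE tE (mass mu mu_supp)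
    (mass nu nu_supp) F_lip eps0 q01 E_near zt_box F_supp F_bound SWs.
  have dr : 0 <= 4 * d%:R * r / delta by rewrite divr_ge0 ?mulr_ge0 ?ltW.
  have rd1 : 1 <= d%:R * (r / eps) * n0%:R.
    have re1 : 1 <= r / eps by rewrite ler_pdivlMr// mul1r.
    by apply: mulr_ege1 => //; exact: mulr_ege1.
  rewrite /V0 lerBrDr; apply: (collect_bounds _ _ _ _ _ _ fb) => //.
    rewrite -addnn -addn1 !natrD /N1 -natr1.
    have := trunc_le _ dr.
    have -> : 4 * d%:R * r / delta = 4 * (d%:R * (r / eps) * n0%:R).
      by rewrite /delta /q; field; rewrite !gt_eqF.
    have -> : 11 * d%:R * (r / eps) * n0%:R = 11 * (d%:R * (r / eps) * n0%:R) by ring.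
    by move: (d%:R * (r / eps) * n0%:R) rd1 => y; lra.
  apply: kern_mass_ge => //; apply: leq_trans (leq_addl _ _).
  rewrite /N1 -(ler_nat R); apply/ltW; apply: le_lt_trans (truncnS_gt _).
  have -> : 4 * d%:R * r / delta = 4 * (d%:R * (r / eps) * n0%:R).
    by rewrite /delta /q; field; rewrite !gt_eqF.
  have : n0%:R <= d%:R * (r / eps) * n0%:R.
    rewrite ler_peMl//; apply: mulr_ege1 => //.
    by rewrite ler_pdivlMr ?mul1r.
  by lra.
have c_ge t t' x y : E t x -> E t' y -> enorm (x - y) <=
    enorm (lat delta (zt t) - lat delta (zt t')) + 2 * (d%:R * delta).
  move=> /E_near h1 /E_near; rewrite enorm_distC => h2.
  have := enorm_triangle (lat delta (zt t)) x y.
  by have := enorm_triangle (lat delta (zt t')) (lat delta (zt t)) y; lra.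
have := @W1_le_plan R d mu nu T E pi _ mE tE (mass mu mu_supp) (mass nu nu_supp)
  pi0 pi_a pi_b c_ge.
move=> /le_trans; apply; rewrite -EFinD lee_fin.
under eq_bigr do under eq_bigr do rewrite mulrDr.
under eq_bigr do rewrite big_split/= -mulr_suml pi_a.
rewrite big_split/= -mulr_suml sum1// mul1r.
by move: pi_c n0e; rewrite /V0; lra.
Qed.

End CoreBound.

Theorem theorem3p1 (R : realType) (d k : nat) (k_ge1 : (1 <= k)%N)
    (k_lt_d : (k < d)%N) :
  exists C : R,
  forall sigma : probability (grassmannian R (ltnW k_lt_d)) R,
  rotation_invariant sigma ->
  forall (r : R) (mu nu : probability 'rV[R]_d R),
  0 < r ->
  supported_on mu (eclosed_ball r) -> supported_on nu (eclosed_ball r) ->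
  (W1 mu nu <=
   (C * r `^ ((d - k)%:R / (d - k + 1)%:R))%:E *
   SW1 sigma mu nu `^ (1 / (d - k + 1)%:R))%E.
Proof.
pose C1 : R := @approx_const R d k; pose C2 : R := @slope_const R d k.
have C10 : 0 <= C1 := approx_const_ge0.
have C20 : 0 <= C2 := slope_const_ge0.
exists (C1 + C2 + 2) => sigma inv r mu nu r0 mur nur.
have C0 : 0 < C1 + C2 + 2 by rewrite ltr_wpDl// addr_ge0.
set m := (d - k)%N.
set beta : R := 1 / (m + 1)%:R; set alpha : R := m%:R / (m + 1)%:R.
have m1 : 0 < (m + 1)%:R :> R by rewrite ltr0n addn1.
have beta0 : 0 < beta by rewrite divr_gt0.
have ab : alpha + beta = 1.
  by rewrite /alpha /beta -mulrDl -[1 in X in X / _]/(1%:R) -natrD divff// gt_eqF.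
have SW0 : (0 <= SW1 sigma mu nu)%E.
  by apply: integral_ge0 => xi _; exact: W1_ge0.
have ra : 0 < r `^ alpha by exact: powR_gt0.
(* The bound is trivial if the sliced distance is infinite, and follows by
   letting [eps] tend to 0 if it is 0. *)
case SWE : (SW1 sigma mu nu) SW0 => [s| |]// s0; last first.
  rewrite poweRyr ?gt_eqF// gt0_muley ?leey//.
  by rewrite lte_fin mulr_gt0.
rewrite lee_fin in s0.
rewrite poweR_EFin -EFinM.
have core eps := W1_le_scale k_ge1 k_lt_d inv r0 mur nur SWE (eps := eps).
move: s0; rewrite le_eqVlt => /orP[/eqP s0|s0].
  rewrite -s0 powR0 ?gt_eqF// mulr0.
  apply/lee_addgt0Pr => e e0; rewrite add0e.
  pose eps := Num.min r (e / (C1 + 1)).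
  have C11 : 0 < C1 + 1 by rewrite ltr_wpDl.
  have eps0 : 0 < eps by rewrite lt_min r0 divr_gt0.
  have epsr : eps <= r by rewrite ge_min lexx.
  apply: le_trans (core eps eps0 epsr) _; rewrite lee_fin -s0 mulr0 addr0.
  have : eps <= e / (C1 + 1) by rewrite ge_min lexx orbT.
  rewrite ler_pdivlMr// => /(le_trans _); apply.
  by rewrite mulrC ler_wpM2l ?(ltW eps0)// lerDl.
have sb : 0 < s `^ beta by exact: powR_gt0.
have split (y : R) : 0 < y -> y = y `^ alpha * y `^ beta.
  by move=> y0; rewrite -powRD ab ?powRr1// ?ltW// oner_eq0.
(* If [s > r], the bound exceeds the diameter; otherwise the choice
   [eps = r `^ alpha * s `^ beta] balances the two terms. *)
have [sr|sr] := leP s r; last first.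
  apply: le_trans (W1_le_diam mur nur) _; rewrite lee_fin.
  have h : r <= r `^ alpha * s `^ beta.
    rewrite {1}(split r r0) ler_wpM2l ?(ltW ra)//.
    by apply: ge0_ler_powR; rewrite ?nnegrE ltW.
  rewrite -mulrA; apply: le_trans (ler_wpM2l _ h) _ => //.
  by rewrite ler_wpM2r ?(mulr_ge0 (ltW ra) (ltW sb))// lerDr addr_ge0.
pose eps := r `^ alpha * s `^ beta.
have eps0 : 0 < eps by rewrite mulr_gt0.
have epsr : eps <= r.
  rewrite [leRHS](split r r0) ler_wpM2l ?(ltW ra)//.
  by apply: ge0_ler_powR; rewrite ?nnegrE ?(ltW beta0) ?(ltW s0) ?(ltW r0).
apply: le_trans (core eps eps0 epsr) _; rewrite lee_fin -mulrA -/eps.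
have key : (r / eps) ^+ m * s = eps.
  have root y : 0 < y -> (y `^ beta) ^+ m.+1 = y.
    move=> y0; rewrite -powR_mulrn ?powR_ge0// -powRrM /beta mul1r addn1.
    by rewrite mulVf ?gt_eqF// powRr1// ltW.
  have raE : r `^ alpha = (r `^ beta) ^+ m.
    rewrite -powR_mulrn ?powR_ge0// -powRrM; congr (_ `^ _).
    by rewrite /alpha /beta mul1r mulrC.
  have rb : 0 < r `^ beta by exact: powR_gt0.
  suff h (x y : R) : 0 < x -> 0 < y -> (x ^+ m.+1 / (x ^+ m * y)) ^+ m * y ^+ m.+1 = x ^+ m * y.
    by have := h _ _ rb sb; rewrite !root// -raE.
  move=> x0 y0; rewrite !exprS.
  have -> : x * x ^+ m / (x ^+ m * y) = x / y.
    by field; rewrite expf_neq0 gt_eqF.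
  by rewrite expr_div_n; field; rewrite expf_neq0// gt_eqF.
rewrite -/m -/C1 -/C2 key -[leRHS]mulrA -/eps -mulrDl ler_wpM2r ?(ltW eps0)//.
by rewrite lerDl.
Qed.
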